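(* Let $f$ be an inner function with $f(0)=0$ which is not a rotation, and put $\lambda:=\overline{f'(0)}$. For every $\delta\ge 1$ there exists a positive constant $C(\delta,f)$, depending only on $\delta$ and $f$, such that the following holds. Let $(a_n)_{n=1}^\infty$ be any sequence of complex numbers satisfying $$\sum_{n=1}^\infty |a_n|^2=\infty\quad\text{and}\quad \lim_{N\to\infty}\frac{|a_N|^2}{\sum_{n=1}^N|a_n|^2}=0,$$ and set $$\sigma_N:=\Big\|\sum_{n=1}^N a_n f^{\circ n}\Big\|_{L^2(\mathbb T)},\qquad Z_N:=\frac1{\sigma_N}\sum_{n=1}^N a_n f^{\circ n}.$$ Then for every $N\ge 1$ such that $a_1,\dots,a_N$ are not all zero, $$\sup_{x\in\mathbb R,\ \alpha\in\mathbb T}\Big|\mathbb P\big(\mathrm{Re}(\alpha Z_N)\le x\big)-\mathbb P\big(\mathcal N(0,1/2)\le x\big)\Big|\le C(\delta,f)\Big(\sum_{n=1}^N|a_n|^4\Big)^{\frac{1+\delta}{6+4\delta}}\Big(\sum_{n=1}^N|a_n|^2\Big)^{-\frac{1+\delta}{3+2\delta}}+2.7\cdot\frac{|\lambda|}{1-|\lambda|}\cdot\frac{\big|\sum_{n=1}^N\lambda^{N-n}a_n\big|}{\sqrt{\sum_{n=1}^N|a_n|^2}}.$$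
   Context: $\mathbb D=\{z\in\mathbb C:|z|<1\}$ and $\mathbb T=\{z\in\mathbb C:|z|=1\}$, the latter equipped with normalized Lebesgue measure $m$; $\mathbb P$ refers to the probability space $(\mathbb T,m)$ for random variables defined on $\mathbb T$. An analytic function $f:\mathbb D\to\mathbb D$ is inner if its radial limits $f(\omega):=\lim_{r\to1}f(r\omega)$ have modulus one for almost every $\omega\in\mathbb T$; the induced a.e.-defined boundary map $\mathbb T\to\mathbb T$ is also denoted $f$. If $f(0)=0$ this boundary map preserves $m$. A rotation is a map $z\mapsto cz$ with $|c|=1$; if $f$ is not a rotation and $f(0)=0$ then $|f'(0)|<1$. $f^{\circ n}$ denotes the $n$-th iterate of $f$ (regarded as a function on $\mathbb T$). $\mathcal N(0,\sigma^2)$ is the real normal distribution with mean $0$ and variance $\sigma^2$ (and, inside $\mathbb P(\cdot)$, a random variable with this law). Convention: $\lambda^0=1$ (also when $\lambda=0$). *)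

(* Defs.v *)
From HB Require Import structures.
From mathcomp Require Import all_boot all_order all_algebra.
From mathcomp Require Import all_classical all_reals all_analysis.
From mathcomp Require Import complex.

Set Implicit Arguments.
Unset Strict Implicit.
Unset Printing Implicit Defensive.

Import Order.TTheory GRing.Theory Num.Theory.
Import numFieldNormedType.Exports.
Export ComplexField.Normc.

Local Open Scope classical_set_scope.
Local Open Scope ring_scope.
Local Open Scope complex_scope.

(* Complex numbers have type [R[i]^o], so that they carry the topology and the
   normed-module structure over the field [R[i]].  On them [`|z|] is the modulus
   as a complex number and [normc z : R] is the same modulus as a real number.
   The scalar field is [R[i]], so [derivable f z 1] is complex differentiability
   at [z]. *)
Definition analytic_on_disc (R : realType) (f : R[i]^o -> R[i]^o) : Prop :=
  forall z : R[i]^o, `|z| < 1 -> derivable f z 1.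

Definition is_rotation (R : realType) (f : R[i]^o -> R[i]^o) : Prop :=
  exists2 c : R[i]^o, `|c| = 1 & forall z : R[i]^o, `|z| < 1 -> f z = c * z.

Definition circle (R : realType) : Type := {z : R[i]^o | `|z| == 1}.

Definition circle1 (R : realType) : circle R :=
  exist _ 1 (introT eqP (normr1 _)).

HB.instance Definition _ (R : realType) := Choice.on (circle R).
HB.instance Definition _ (R : realType) := isPointed.Build (circle R) (circle1 R).

Definition circle_open (R : realType) : set_system (circle R) :=
  [set (fun w : circle R => val w) @^-1` U | U in @open R[i]^o].

HB.instance Definition _ (R : realType) :=
  Measurable.copy (circle R) (g_sigma_algebraType (@circle_open R)).

Definition circle_exp (R : realType) (t : measurableTypeR R) : R[i]^o :=
  cos (2 * pi * t) +i* sin (2 * pi * t).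

Lemma circle_exp_norm (R : realType) (t : measurableTypeR R) :
  `|circle_exp t| == 1.
Proof. by rewrite normc_def /= cos2Dsin2 sqrtr1. Qed.

Definition circle_param (R : realType) (t : measurableTypeR R) : circle R :=
  exist _ (circle_exp t) (circle_exp_norm t).

Lemma continuous_circle_exp (R : realType) :
  continuous (@circle_exp R : R -> R[i]^o).
Proof.
move=> t; apply/(@cvgrPdist_lt R[i] R[i]^o) => e e0.
have e2 : e = (complex.Re e)%:C by apply/esym/RRe_real; exact: gtr0_real.
have Re0 : 0 < complex.Re e by rewrite -(ltcR 0) -e2.
have c2 : continuous (fun s : R => 2 * pi * s).
  by move=> s; apply: cvgM; [exact: cvg_cst|exact: cvg_id].
have cc : cos (2 * pi * s) @[s --> t] --> cos (2 * pi * t).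
  exact: (continuous_comp (c2 t) (@continuous_cos R _)).
have cs : sin (2 * pi * s) @[s --> t] --> sin (2 * pi * t).
  exact: (continuous_comp (c2 t) (@continuous_sin R _)).
have h0 : 0 < complex.Re e / 2 by rewrite divr_gt0.
near=> s.
rewrite e2 (_ : _ - _ = (cos (2 * pi * t) - cos (2 * pi * s)) +i*
    (sin (2 * pi * t) - sin (2 * pi * s))) //.
rewrite normc_def /= ltcR [ltRHS](splitr (complex.Re e)).
set u := _ - _; set v := _ - _.
have u0 : `|u| < complex.Re e / 2.
  by rewrite /u; near: s; move/cvgrPdist_lt: cc; exact.
have v0 : `|v| < complex.Re e / 2.
  by rewrite /v; near: s; move/cvgrPdist_lt: cs; exact.
apply: le_lt_trans (ltrD u0 v0).
rewrite -(ler_pXn2r (n := 2)) ?nnegrE ?sqrtr_ge0 ?addr_ge0//.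
rewrite sqr_sqrtr ?addr_ge0 ?sqr_ge0// -(real_normK (num_real u)).
rewrite -(real_normK (num_real v)) sqrrD.
by rewrite lerD2r lerDl mulrn_wge0// mulr_ge0.
Unshelve. all: by end_near. Qed.

Lemma measurable_circle_param (R : realType) :
  measurable_fun [set: measurableTypeR R] (@circle_param R).
Proof.
apply: (@measurability _ _ _ _ _ _ (@circle_open R)) => //.
move=> _ [_ [U oU <-] <-]; rewrite setTI.
apply: (@measurable_realfun.open_measurable R).
by apply: (@open_comp R R[i]^o (@circle_exp R) U) => // t _; exact: continuous_circle_exp.
Qed.

(* Normalized Lebesgue measure [m]: the image of Lebesgue measure on [[0, 1[]
   under [t |-> exp (2 i pi t)]. *)
Definition circle_measure (R : realType) : set (circle R) -> \bar R :=
  pushforward (mrestr (@lebesgue_measure R) (measurable_itv `[0%R, 1%R[))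
    (@circle_param R).

Section circle_measure_instances.
Variable R : realType.
Local Open Scope ereal_scope.

Let mparam := @measurable_circle_param R.

Let circle_measure0 : @circle_measure R set0 = 0.
Proof. by rewrite /circle_measure /pushforward preimage_set0 measure0. Qed.

Let circle_measure_ge0 (A : set (circle R)) : 0 <= circle_measure A.
Proof. exact: measure_ge0. Qed.

Let circle_measure_sigma_additive : semi_sigma_additive (@circle_measure R).
Proof. by apply: measure_semi_sigma_additive; exact: mparam. Qed.

HB.instance Definition _ := isMeasure.Build _ _ _ (@circle_measure R)
  circle_measure0 circle_measure_ge0 circle_measure_sigma_additive.

Let circle_measure_setT : circle_measure [set: circle R] = 1.
Proof.
rewrite /circle_measure /pushforward /mrestr preimage_setT setTI.
by rewrite lebesgue_measure_itv /= lte_fin ltr01 oppr0 adde0.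
Qed.

HB.instance Definition _ := Measure_isProbability.Build _ _ _
  (@circle_measure R) circle_measure_setT.

End circle_measure_instances.

Definition inner (R : realType) (f : R[i]^o -> R[i]^o) : Prop :=
  [/\ analytic_on_disc f,
      forall z : R[i]^o, `|z| < 1 -> `|f z| < 1 &
      {ae @circle_measure R, forall w : circle R, exists2 l : R[i]^o,
        f (r%:C * val w) @[r --> (1 : R)^'-] --> l & `|l| = 1}].

(* The a.e.-defined boundary map as a total map: the value [1] is a junk value
   taken where the radial limit does not exist or is not of modulus one. *)
Definition boundary (R : realType) (f : R[i]^o -> R[i]^o) (w : circle R) :
    circle R :=
  xget (circle1 R)
    [set l : circle R | f (r%:C * val w) @[r --> (1 : R)^'-] --> val l].

Definition boundary_sum (R : realType) (f : R[i]^o -> R[i]^o)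
    (a : nat -> R[i]^o) (N : nat) (w : circle R) : R[i]^o :=
  \sum_(1 <= n < N.+1) a n * val (iter n (boundary f) w).

Definition sigmaN (R : realType) (f : R[i]^o -> R[i]^o)
    (a : nat -> R[i]^o) (N : nat) : R :=
  fine ('N[@circle_measure R]_2%:E [EFin \o (fun w => normc (boundary_sum f a N w))])%E.

Definition ZN (R : realType) (f : R[i]^o -> R[i]^o)
    (a : nat -> R[i]^o) (N : nat) (w : circle R) : R[i]^o :=
  ((sigmaN f a N)^-1)%:C * boundary_sum f a N w.

(* Main.v *)
Require Import Defs.
From mathcomp Require Import all_boot all_order all_algebra.
From mathcomp Require Import all_classical all_reals all_analysis.
From mathcomp Require Import complex.
From mathcomp Require Import measurable_realfun ring lra.
Import Order.TTheory GRing.Theory Num.Theory.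
Import numFieldNormedType.Exports.
Local Open Scope classical_set_scope.
Local Open Scope ring_scope.

Set Implicit Arguments.
Unset Strict Implicit.
Unset Printing Implicit Defensive.

(* Let [Z] be the boundary map of [f], [z] the identity of the circle and
   [lam = conj (f' 0)].  The circle means of [f ^ j / z ^ k] do not depend on the
   radius (Goursat); letting the radius tend to [0] and to [1] gives
   [E (z | Z) = lam Z] and [E (z ^ 2 | Z) = mu Z + lam ^ 2 Z ^ 2] with
   [|mu| <= 1].  Hence, with [A_m = sum_(n <= m) lam ^ (m - n) a_n], the sum of
   the [a_n f^(n)] is a martingale in reversed time with increments
   [A_m (z - lam Z)], started at [lam A_N z].  Lindeberg's method, with a
   corrector absorbing the term [mu Z] of the conditional variances and with
   Bolthausen's self-bounding of the smoothing error, gives a Kolmogorov distance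
   [O(M ln (1 / M))] for [M = max |A_m| / sigma_N = O(L ^ (1 / 4))], where
   [L] is the ratio of [sum |a_n| ^ 4] to [(sum |a_n| ^ 2) ^ 2].  Since
   [(1 + delta) / (6 + 4 delta) < 1 / 4], this is
   [O(L ^ ((1 + delta) / (6 + 4 delta)))]: the first term of the bound already
   dominates. *)

(** Two obstacles shape the Lindeberg step. Given [S w], an increment has conditional variance half
    of [var_incr A + Re (A ^ 2 mu Z)]. The fluctuating part has mean zero, but it is multiplied by a
    second derivative of the test function and so does not average out. The corrector [Re (B z) / v]
    has conditional mean [Re (lam B Z) / v]; letting [B] become [lam B + A ^ 2 mu / 4] from one step
    to the next cancels that part exactly. Secondly, a step costs about [M |A| ^ 2 / v ^ (3 / 2)].
    Summed as it stands this gives [M / eps] at smoothing scale [eps], hence only a rate [sqrt M].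
    But every error carries a weight living where the walk is within [sqrt v] of [x], and the mean
    of this weight is [O(sqrt v + D)] if [D] bounds the Kolmogorov distance. The total becomes
    [M ln (1 / M) + D M / eps], and with [eps] a large multiple of [M] the coefficient of [D] is
    small. Conditional expectations are never formed: they are tested against bounded functions of
    [Z], to which identities between Fourier coefficients extend. *)

Definition bounded_measurable d (T : measurableType d) (R : realType)
    (h : T -> R) : Prop :=
  measurable_fun [set: T] h /\ exists K, forall w, `|h w| <= K.

(** * Bounded measurable functions and their expectations *)

Section bounded_measurable.
Context d (T : measurableType d) (R : realType).
Implicit Types f g h : T -> R.

Lemma bounded_measurable_cst (c : R) : bounded_measurable (fun _ : T => c).
Proof. by split; [exact: measurable_cst|exists `|c|]. Qed.

Lemma bounded_measurableD f g : bounded_measurable f -> bounded_measurable g ->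
  bounded_measurable (fun w => f w + g w).
Proof.
move=> [mf [K fK]] [mg [L gL]]; split; first exact: measurable_funD.
by exists (K + L) => w; rewrite (le_trans (ler_normD _ _))// lerD.
Qed.

Lemma bounded_measurableM f g : bounded_measurable f -> bounded_measurable g ->
  bounded_measurable (fun w => f w * g w).
Proof.
move=> [mf [K fK]] [mg [L gL]]; split; first exact: measurable_funM.
by exists (K * L) => w; rewrite normrM ler_pM.
Qed.

Lemma bounded_measurableN f : bounded_measurable f ->
  bounded_measurable (fun w => - f w).
Proof.
move=> [mf [K fK]]; split; first exact: measurableT_comp.
by exists K => w; rewrite normrN.
Qed.

Lemma bounded_measurableB f g : bounded_measurable f -> bounded_measurable g ->
  bounded_measurable (fun w => f w - g w).
Proof. by move=> bf /bounded_measurableN; exact: bounded_measurableD. Qed.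

Lemma bounded_measurableX f n : bounded_measurable f ->
  bounded_measurable (fun w => f w ^+ n).
Proof.
move=> bf; elim: n => [|n IH].
  by under eq_fun do rewrite expr0; exact: bounded_measurable_cst.
by under eq_fun do rewrite exprS; exact: bounded_measurableM.
Qed.

Lemma bounded_measurable_sum I (r : seq I) (F : I -> T -> R) :
  (forall i, bounded_measurable (F i)) ->
  bounded_measurable (fun w => \sum_(i <- r) F i w).
Proof.
move=> bF; elim: r => [|i r IH].
  by under eq_fun do rewrite big_nil; exact: bounded_measurable_cst.
by under eq_fun do rewrite big_cons; exact: bounded_measurableD.
Qed.

Lemma bounded_measurable_comp f (g : R -> R) : measurable_fun [set: T] f ->
  measurable_fun [set: R] g -> (exists K, forall x, `|g x| <= K) ->
  bounded_measurable (fun w => g (f w)).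
Proof.
move=> mf mg [K gK]; split; first exact: measurableT_comp.
by exists K.
Qed.

Lemma bounded_measurable_indic (A : set T) : measurable A ->
  bounded_measurable (\1_A : T -> R).
Proof.
move=> mA; split; first exact: measurable_indic.
by exists 1 => w; rewrite indicE; case: (_ \in _); rewrite /= ?normr0 ?normr1.
Qed.

Lemma bounded_measurable_precomp d' (U : measurableType d') (t : U -> T) h :
  measurable_fun [set: U] t -> bounded_measurable h ->
  bounded_measurable (fun w => h (t w)).
Proof.
move=> mt [mh [K hK]]; split; first exact: (measurableT_comp mh mt).
by exists K.
Qed.

End bounded_measurable.

Definition expect d (T : measurableType d) (R : realType)
  (P : probability T R) (h : T -> R) : R := \int[P]_w h w.

Section expect.
Context d (T : measurableType d) (R : realType) (P : probability T R).
Implicit Types f g h : T -> R.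
Local Notation bm := bounded_measurable.
Local Notation E := (expect P).

Lemma bounded_measurable_integrable h : bm h -> P.-integrable [set: T] (EFin \o h).
Proof.
move=> [mh [K hK]]; apply: measurable_bounded_integrable => //.
  by rewrite (le_lt_trans (probability_le1 _ _))// ltry.
exists K; split; first exact: num_real.
by move=> x Kx w _ /=; rewrite (le_trans (hK w))// ltW.
Qed.

Lemma expectD f g : bm f -> bm g -> E (fun w => f w + g w) = E f + E g.
Proof.
by move=> bf bg; rewrite /expect RintegralD//; exact: bounded_measurable_integrable.
Qed.

Lemma expectZ (c : R) f : bm f -> E (fun w => c * f w) = c * E f.
Proof.
by move=> bf; rewrite /expect RintegralZl//; exact: bounded_measurable_integrable.
Qed.

Lemma expectB f g : bm f -> bm g -> E (fun w => f w - g w) = E f - E g.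
Proof.
by move=> bf bg; rewrite /expect RintegralB//; exact: bounded_measurable_integrable.
Qed.

Lemma expectN f : bm f -> E (fun w => - f w) = - E f.
Proof.
by move=> bf; under eq_fun do rewrite -mulN1r; rewrite expectZ// mulN1r.
Qed.

Lemma expect_cst (c : R) : E (fun _ => c) = c.
Proof.
have PT : P [set: T] = 1%E by exact: probability_setT.
by rewrite /expect Rintegral_cst//= PT mulr1.
Qed.

Lemma expect_sum I (r : seq I) (F : I -> T -> R) : (forall i, bm (F i)) ->
  E (fun w => \sum_(i <- r) F i w) = \sum_(i <- r) E (F i).
Proof.
move=> bF; elim: r => [|i r IH].
  by under eq_fun do rewrite big_nil; rewrite expect_cst big_nil.
under eq_fun do rewrite big_cons.
by rewrite expectD ?IH ?big_cons//; exact: bounded_measurable_sum.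
Qed.

Lemma eq_expect f g : f =1 g -> E f = E g.
Proof. by move=> /funext ->. Qed.

Lemma le_expect f g : bm f -> bm g -> (forall w, f w <= g w) -> E f <= E g.
Proof.
move=> bf bg fg; rewrite /expect le_Rintegral//; exact: bounded_measurable_integrable.
Qed.

Lemma expect_ge0 f : (forall w, 0 <= f w) -> 0 <= E f.
Proof. by move=> f0; rewrite /expect Rintegral_ge0. Qed.

Lemma expect_norm_le f g : bm f -> bm g -> (forall w, `|f w| <= g w) ->
  `|E f| <= E g.
Proof.
move=> bf bg fg; rewrite ler_norml -expectN// !le_expect//.
- by move=> w; have := fg w; rewrite ler_norml => /andP[].
- exact: bounded_measurableN.
- by move=> w; have := fg w; rewrite ler_norml => /andP[].
Qed.

Lemma expect_indic (A : set T) : measurable A -> E (\1_A) = fine (P A).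
Proof. by move=> mA; rewrite /expect /Rintegral integral_indic// setIT. Qed.

Lemma expect_dominated_convergence (f_ : nat -> T -> R) f (K : R) :
  (forall n, measurable_fun [set: T] (f_ n)) -> bm f ->
  (forall n w, `|f_ n w| <= K) ->
  {ae P, forall w, f_ n w @[n --> \oo] --> f w} ->
  E (f_ n) @[n --> \oo] --> E f.
Proof.
move=> mf_ bf fK fcvg.
have [mf _] := bf.
have := @dominated_convergence _ _ _ P setT measurableT
  (fun n w => (f_ n w)%:E) (fun w => (f w)%:E) (fun=> K%:E).
case.
- by move=> n; exact/measurable_EFinP.
- exact/measurable_EFinP.
- by apply: filterS fcvg => w fw _; apply: cvg_EFin; [exact: nearW|exact: fw].
- by apply: (@bounded_measurable_integrable (fun=> K)); exact: bounded_measurable_cst.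
- by apply: aeW => w n _; rewrite /= lee_fin.
move=> _ _ h; rewrite /expect /Rintegral.
apply: fine_cvg; rewrite fineK//.
by apply: integrable_fin_num => //; exact: bounded_measurable_integrable.
Qed.

End expect.

(** * The Gaussian distribution function *)

Section mean_value_bound.
Context (R : realType).

Lemma mean_value_bound (f f' : R -> R) (a b K : R) :
  (forall t : R, is_derive t 1 f (f' t)) ->
  (forall t, `|t - a| <= `|b - a| -> `|f' t| <= K) ->
  `|f b - f a| <= K * `|b - a|.
Proof.
move=> df fB.
have cf : continuous f.
  move=> x; apply: differentiable_continuous; apply/derivable1_diffP.
  by have [] := df x.
have [ab|/ltW ba] := leP a b.
  have [c cab ->] := @MVT_segment R f f' a b ab (fun x _ => df x) (continuous_subspaceT cf).
  rewrite normrM ler_wpM2r// fB//; move: cab; rewrite in_itv/= => /andP[ac cb].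
  by rewrite !ger0_norm ?subr_ge0// lerB.
rewrite distrC.
have [c cab ->] := @MVT_segment R f f' b a ba (fun x _ => df x) (continuous_subspaceT cf).
rewrite normrM (distrC b) ler_wpM2r// fB//; move: cab; rewrite in_itv/= => /andP[bc ca].
by rewrite !ler0_norm ?subr_le0// lerN2 lerB.
Qed.

End mean_value_bound.

Section gauss.
Context (R : realType).
Implicit Types x y z h r : R.

Definition half_sd : R := Num.sqrt 2^-1.

Definition gauss_cdf (y : R) : R := fine (normal_prob 0 half_sd `]-oo, y]).

(** With variance [1 / 2] the exponent of the normal density is exactly [- y ^+ 2]; [gauss_pdfE]
    identifies the two forms. *)
Definition gauss_pdf (y : R) : R := normal_peak half_sd * expR (- y ^+ 2).

(** Localises every error estimate. Its tail dominates the Gaussian ones, yet it decays slowly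
    enough to change by a bounded factor under bounded shifts, so that it can be transported along
    the walk. *)
Definition cauchy_weight (y : R) : R := (1 + y ^+ 2)^-1.

Local Notation Phi := gauss_cdf.
Local Notation phi := gauss_pdf.
Local Notation q := cauchy_weight.

Lemma half_sd_sqr : half_sd ^+ 2 = 2^-1.
Proof. by rewrite sqr_sqrtr// invr_ge0. Qed.

Lemma half_sd_neq0 : half_sd != 0.
Proof. by rewrite gt_eqF// sqrtr_gt0 invr_gt0. Qed.

Lemma gauss_pdfE : phi = normal_pdf 0 half_sd.
Proof.
apply/funext => y; rewrite normal_pdfE ?half_sd_neq0// /phi /normal_fun subr0.
by rewrite half_sd_sqr -mulr_natr mulVf ?divr1.
Qed.

Lemma gauss_pdf_ge0 y : 0 <= phi y.
Proof. by rewrite gauss_pdfE normal_pdf_ge0. Qed.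

Lemma gauss_peak_le1 : normal_peak half_sd <= 1.
Proof.
rewrite /normal_peak half_sd_sqr invf_le1; last first.
  by rewrite sqrtr_gt0 -mulr_natr mulrC !mulr_gt0 ?pi_gt0.
rewrite -[leLHS]sqrtr1 ler_wsqrtr// -mulr_natr.
by have := pi_ge2 R; lra.
Qed.

Lemma cauchy_weight_gt0 y : 0 < q y.
Proof. by rewrite invr_gt0 ltr_wpDr ?sqr_ge0. Qed.

Lemma cauchy_weight_le1 y : q y <= 1.
Proof. by rewrite invf_le1 ?lerDl ?sqr_ge0// ltr_wpDr ?sqr_ge0. Qed.

Lemma cauchy_weight_peetre y z : q z <= 2 * (1 + (y - z) ^+ 2) * q y.
Proof.
rewrite /q ler_pdivlMr ?ltr_wpDr ?sqr_ge0// mulrC ler_pdivrMr ?ltr_wpDr ?sqr_ge0//.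
set d := y - z; have -> : y = z + d by rewrite /d; ring.
have := sqr_ge0 (z - d); have := sqr_ge0 (z * d); lra.
Qed.

Definition gauss_const : R := 256.
Local Notation B := gauss_const.

Lemma gauss_const_gt0 : 0 < B. Proof. by []. Qed.

Lemma gauss_pdf_bound y : phi y <= B * q y ^+ 4.
Proof.
rewrite /B.
(* [1 + y ^ 2 <= 4 (1 + y ^ 2 / 4) <= 4 expR (y ^ 2 / 4)], raised to the fourth power: this is the
   origin of [256 = 4 ^ 4]. *)
have h : (1 + y ^+ 2) ^+ 4 <= 256 * expR (y ^+ 2).
  have y2 := sqr_ge0 y.
  have -> : y ^+ 2 = y ^+ 2 / 4 * 4%:R by field.
  rewrite expRM_natr (_ : 256 = 4 ^+ 4); last by ring.
  have e1 := expR_ge1Dx (y ^+ 2 / 4).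
  rewrite -exprMn lerXn2r ?nnegrE//; lra.
have p0 : 0 < (1 + y ^+ 2) ^+ 4 by rewrite exprn_gt0// ltr_wpDr ?sqr_ge0.
rewrite /phi /q exprVn expRN ler_pdivlMr// mulrAC ler_pdivrMr ?expR_gt0//.
rewrite (le_trans _ h)// ler_piMl ?gauss_peak_le1//; exact: ltW.
Qed.

(** [|y| ^ k] is at most [(1 + y ^ 2) ^ 2], which uses up two of the four powers of [q] in
    [gauss_pdf_bound]; one more is dropped because [q <= 1]. *)
Lemma gauss_moment_bound y k : (k <= 4)%N -> `|y| ^+ k * phi y <= B * q y.
Proof.
move=> k4.
have B0 := gauss_const_gt0; have q0 := cauchy_weight_gt0 y; have q1 := cauchy_weight_le1 y.
have hk : `|y| ^+ k <= (1 + y ^+ 2) ^+ 2.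
  rewrite -(real_normK (num_real y)); set t := `|y|.
  have t0 : 0 <= t by exact: normr_ge0.
  have [t1|t1] := leP t 1.
    by apply: (@le_trans _ _ 1); [rewrite exprn_ile1|nra].
  apply: (@le_trans _ _ (t ^+ 4)); first by rewrite ler_eXn2l.
  by rewrite (_ : 4 = (2 * 2))%N// exprM; nra.
apply: (@le_trans _ _ ((1 + y ^+ 2) ^+ 2 * (B * q y ^+ 4))).
  by rewrite ler_pM ?gauss_pdf_ge0 ?gauss_pdf_bound// exprn_ge0.
have -> : (1 + y ^+ 2) ^+ 2 * (B * q y ^+ 4) = B * q y ^+ 2.
  rewrite /q; field; rewrite gt_eqF// ltr_wpDr ?sqr_ge0//.
have : q y ^+ 2 <= q y by rewrite expr2 ler_piMr// ltW.
lra.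
Qed.

Lemma gauss_cdf_ge0 y : 0 <= Phi y.
Proof. by rewrite fine_ge0. Qed.

Lemma gauss_cdf_fin y : normal_prob 0 half_sd `]-oo, y] = (Phi y)%:E.
Proof. by rewrite fineK// fin_num_measure. Qed.

Lemma gauss_cdf_le1 y : Phi y <= 1.
Proof. by rewrite -lee_fin -gauss_cdf_fin probability_le1. Qed.

Lemma gauss_pdf_integrable (D : set R) : measurable D ->
  lebesgue_measure.-integrable D (EFin \o phi).
Proof.
move=> mD; apply: (integrableS measurableT) => //.
by rewrite gauss_pdfE; exact: integrable_normal_pdf.
Qed.

Lemma is_derive_gauss_cdf y : is_derive y 1 Phi (phi y).
Proof.
have [|||] := @continuous_FTC1 R phi -oo%O y (y + 1) _
    (gauss_pdf_integrable (measurable_itv _)).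
- by rewrite ltrDl.
- by rewrite ltNyr.
- by rewrite gauss_pdfE; apply: continuous_normal_pdf; exact: half_sd_neq0.
move=> dF F'.
have -> : Phi = (fun x => \int[lebesgue_measure]_(t in `]-oo, x]) phi t).
  by apply/funext => x; rewrite /gauss_cdf /normal_prob gauss_pdfE.
by apply: DeriveDef; [exact: dF|rewrite -derive1E; exact: F'].
Qed.

Definition gauss_pdf' y : R := - 2 * y * phi y.
Definition gauss_pdf'' y : R := (4 * y ^+ 2 - 2) * phi y.
Local Notation phi' := gauss_pdf'.
Local Notation phi'' := gauss_pdf''.

Lemma is_derive_gauss_pdf y : is_derive y 1 phi (phi' y).
Proof.
have h : is_derive y 1 (fun x : R => expR (- x ^+ 2)) (expR (- y ^+ 2) * (- (2 * y))).
  apply: is_derive1_comp.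
  by apply: is_derive_eq; rewrite /GRing.scale/=; ring.
have -> : phi = (normal_peak half_sd \*: (fun x : R => expR (- x ^+ 2))) by [].
by apply: is_derive_eq; rewrite /phi' /phi /GRing.scale/=; ring.
Qed.

Lemma is_derive_gauss_pdf' y : is_derive y 1 phi' (phi'' y).
Proof.
have hp := is_derive_gauss_pdf y.
have -> : phi' = (fun x : R => x *: (- 2 *: phi x)).
  by apply/funext => x; rewrite /phi' /GRing.scale/=; ring.
apply: is_derive_eq; rewrite /phi'' /phi' /GRing.scale/=; ring.
Qed.

(** Completing the square: [t - t ^ 2 = 1 / 4 - (t - 1 / 2) ^ 2], so that tilting the density by an
    exponential gives a multiple of the density centred at [1 / 2]. *)
Lemma gauss_pdf_tilt t : expR t * phi t = expR (4^-1) * normal_pdf 2^-1 half_sd t.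
Proof.
rewrite normal_pdfE ?half_sd_neq0// /phi /normal_fun mulrCA [RHS]mulrCA -!expRD.
congr (_ * expR _); by rewrite half_sd_sqr -mulr_natr; field.
Qed.

(** Chernoff's bound, stated so as to serve both tails: [g] is to be [phi] times an exponential that
    is at least 1 on [D], and its integral over the whole line is known from the tilting
    identity. *)
Lemma gauss_pdf_tilt_integral (D : set R) (g : R -> R) (m y : R) : measurable D ->
  (forall t, g t = expR (- y) * (expR (4^-1) * normal_pdf m half_sd t)) ->
  (forall t, D t -> phi t <= g t) ->
  fine (\int[lebesgue_measure]_(t in D) (phi t)%:E) <= expR (4^-1) * expR (- y).
Proof.
move=> mD gE gD.
have g0 t : 0 <= g t by rewrite gE !mulr_ge0 ?expR_ge0// normal_pdf_ge0.
have mg : measurable_fun [set: R] (EFin \o g).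
  apply/measurable_EFinP; rewrite (funext gE).
  do 2 apply: measurable_funM => //.
  exact: measurable_normal_pdf.
have gI : (\int[lebesgue_measure]_t (g t)%:E = (expR (4^-1) * expR (- y))%:E)%E.
  under eq_integral do rewrite gE mulrA EFinM.
  rewrite ge0_integralZl//; last 2 first.
  - by apply/measurable_EFinP; exact: measurable_normal_pdf.
  - by move=> t _; rewrite lee_fin normal_pdf_ge0.
  by rewrite integral_normal_pdf mule1 mulrC.
rewrite -lee_fin fineK; last first.
  by apply: integrable_fin_num => //; exact: gauss_pdf_integrable.
rewrite -gI; apply: (@le_trans _ _ (\int[lebesgue_measure]_(t in D) (g t)%:E)%E).
  apply: ge0_le_integral => //.
  - by move=> t _; rewrite lee_fin gauss_pdf_ge0.
  - by have /measurable_int := gauss_pdf_integrable mD.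
  - exact: measurable_funTS.
by apply: ge0_subset_integral => //; move=> t _; rewrite lee_fin.
Qed.

Lemma gauss_cdf_tail y : 1 - Phi y <= expR (4^-1) * expR (- y).
Proof.
have -> : 1 - Phi y = fine (normal_prob 0 half_sd `]y, +oo[).
  have := @probability_setC _ _ R (normal_prob 0 half_sd) `]-oo, y] (measurable_itv _).
  by rewrite setCitvl => ->; rewrite fineB// fin_num_measure.
rewrite /normal_prob -gauss_pdfE.
apply: (@gauss_pdf_tilt_integral _ (fun t => expR (- y) * (expR t * phi t)) 2^-1) => //.
  by move=> t; rewrite gauss_pdf_tilt.
move=> t /=; rewrite in_itv/= andbT => yt.
rewrite mulrA -expRD ler_peMl ?gauss_pdf_ge0// -expR0 ler_expR; lra.
Qed.

Lemma gauss_pdf_tiltN t : expR (- t) * phi t = expR (4^-1) * normal_pdf (- 2^-1) half_sd t.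
Proof.
rewrite normal_pdfE ?half_sd_neq0// /phi /normal_fun mulrCA [RHS]mulrCA -!expRD.
congr (_ * expR _); by rewrite half_sd_sqr -mulr_natr; field.
Qed.

Lemma gauss_cdf_opp_tail y : Phi (- y) <= expR (4^-1) * expR (- y).
Proof.
rewrite /gauss_cdf /normal_prob -gauss_pdfE.
apply: (@gauss_pdf_tilt_integral _ (fun t => expR (- y) * (expR (- t) * phi t)) (- 2^-1)) => //.
  by move=> t; rewrite gauss_pdf_tiltN.
move=> t /=; rewrite in_itv/= => ty.
rewrite mulrA -expRD ler_peMl ?gauss_pdf_ge0// -expR0 ler_expR; lra.
Qed.

Lemma gauss_cdf_lipschitz x y : `|Phi x - Phi y| <= `|x - y|.
Proof.
rewrite -[leRHS]mul1r; apply: mean_value_bound (fun t => is_derive_gauss_cdf t) _.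
move=> t _; rewrite ger0_norm ?gauss_pdf_ge0//.
rewrite -[leRHS](mul1r 1) ler_pM ?normal_peak_ge0 ?expR_ge0 ?gauss_peak_le1//.
by rewrite expR_le1 oppr_le0 sqr_ge0.
Qed.

Lemma gauss_pdf'_bound y : `|phi' y| <= 2 * B * q y.
Proof.
rewrite /phi' 2!normrM normrN (ger0_norm (gauss_pdf_ge0 y)) (ger0_norm (ler0n _ 2)).
by have := @gauss_moment_bound y 1 isT; rewrite expr1; lra.
Qed.

Lemma gauss_pdf''_bound y : `|phi'' y| <= 6 * B * q y.
Proof.
rewrite /phi'' normrM (ger0_norm (gauss_pdf_ge0 _)).
have h2 := @gauss_moment_bound y 2 isT; have h0 := @gauss_moment_bound y 0 isT.
rewrite real_normK ?num_real// in h2; rewrite expr0 mul1r in h0.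
apply: (@le_trans _ _ ((4 * y ^+ 2 + 2) * phi y)); last lra.
rewrite ler_wpM2r ?gauss_pdf_ge0// ler_norml; have := sqr_ge0 y; lra.
Qed.

Lemma cauchy_weight_near y z : `|y - z| <= 1 -> q z <= 4 * q y.
Proof.
move=> yz; apply: le_trans (cauchy_weight_peetre y z) _.
rewrite ler_wpM2r ?(ltW (cauchy_weight_gt0 _))// -real_normK ?num_real//.
by have := normr_ge0 (y - z); nra.
Qed.

Lemma gauss_pdf'_shift y h : `|h| <= 1 ->
  `|phi' (y - h) - phi' y| <= 24 * B * q y * `|h|.
Proof.
move=> h1.
have := @mean_value_bound R phi' phi'' y (y - h) (24 * B * q y) is_derive_gauss_pdf'.
rewrite (_ : y - h - y = - h); last by ring.
rewrite normrN; apply => t ht; apply: le_trans (gauss_pdf''_bound _) _.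
suff : q t <= 4 * q y by lra.
by apply: cauchy_weight_near; rewrite distrC; apply: le_trans h1.
Qed.

(** Two applications of the mean value bound, to the remainder [R0] and to its derivative [R1],
    reduce this to the Lipschitz bound for [gauss_pdf'] near [y]; the restriction [|h| <= 1] keeps
    the weight anchored at [y]. *)
Lemma gauss_cdf_taylor y h : `|h| <= 1 ->
  `|Phi (y - h) - Phi y + phi y * h - 2^-1 * phi' y * h ^+ 2| <=
    24 * B * q y * `|h| ^+ 3.
Proof.
move=> h1.
pose R1 t := - phi (y - t) + phi y - phi' y * t.
pose R0 t := Phi (y - t) - Phi y + phi y * t - 2^-1 * phi' y * t ^+ 2.
have dsub (t : R) : is_derive t 1 (fun t : R => y - t) (- 1).
  have -> : (fun t0 : R => y - t0) = (cst y : R -> R) - id by [].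
  by apply: is_derive_eq; rewrite sub0r.
have dR1 (t : R) : is_derive t 1 R1 (phi' (y - t) - phi' y).
  have d := @is_derive1_comp _ phi (fun t => y - t) t _ _ (is_derive_gauss_pdf _) (dsub t).
  have -> : R1 = (fun t => - phi (y - t) + phi y - (phi' y *: t)) by [].
  apply: is_derive_eq; rewrite /GRing.scale/=; ring.
have dR0 (t : R) : is_derive t 1 R0 (R1 t).
  have d := @is_derive1_comp _ Phi (fun t => y - t) t _ _ (is_derive_gauss_cdf _) (dsub t).
  have -> : R0 = (fun t => Phi (y - t) - Phi y + (phi y *: t) - ((2^-1 * phi' y) *: (t * t))).
    by apply/funext => u; rewrite /R0 expr2.
  apply: is_derive_eq; rewrite /R1 /GRing.scale/=.
  lra.
have bR1 t : `|t| <= 1 -> `|R1 t| <= 24 * B * q y * `|t| ^+ 2.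
  move=> t1; have := @mean_value_bound R R1 _ 0 t (24 * B * q y * `|t|) dR1.
  have -> : R1 0 = 0 by rewrite /R1 subr0 mulr0 subr0 addNr.
  rewrite !subr0 expr2 mulrA; apply => s.
  rewrite subr0 => st; apply: le_trans (gauss_pdf'_shift _ (le_trans st t1)) _.
  by rewrite ler_wpM2l// !mulr_ge0// ltW// ?cauchy_weight_gt0 ?gauss_const_gt0.
have := @mean_value_bound R R0 _ 0 h (24 * B * q y * `|h| ^+ 2) dR0.
have -> : R0 0 = 0 by rewrite /R0 subr0 subrr mulr0 addr0 expr0n mulr0 subr0.
rewrite !subr0 (_ : 24 * B * q y * `|h| ^+ 3 = 24 * B * q y * `|h| ^+ 2 * `|h|); last by ring.
apply => s; rewrite subr0 => st.
apply: le_trans (bR1 _ (le_trans st h1)) _.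
rewrite ler_wpM2l ?mulr_ge0 ?(ltW (cauchy_weight_gt0 _)) ?(ltW gauss_const_gt0)//.
by rewrite lerXn2r ?nnegrE.
Qed.

Lemma scaled_gauss_bound y r k : (k <= 3)%N -> 2^-1 <= r ^+ 2 -> 0 <= r ->
  `|y| ^+ k * phi (y * r) <= 16 * B * q y.
Proof.
move=> k3 r2 r0.
have r12 : 2^-1 <= r by nra.
have yr : `|y| <= 2 * `|y * r|.
  by rewrite normrM (ger0_norm r0); have := normr_ge0 y; nra.
have qr : q (y * r) <= 2 * q y.
  rewrite /q ler_pdivlMr ?ltr_wpDr ?sqr_ge0// mulrC ler_pdivrMr ?ltr_wpDr ?sqr_ge0//.
  by rewrite exprMn; have := sqr_ge0 y; nra.
have h : `|y| ^+ k <= 8 * `|y * r| ^+ k.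
  apply: (@le_trans _ _ ((2 * `|y * r|) ^+ k)); first by rewrite lerXn2r ?nnegrE ?mulr_ge0.
  rewrite exprMn ler_wpM2r ?exprn_ge0//.
  by move: k k3 => [|[|[|[|//]]]] _; rewrite ?expr0 ?expr1; lra.
have := @gauss_moment_bound (y * r) k (leq_trans k3 (isT : (3 <= 4)%N)).
have := ler_wpM2r (gauss_pdf_ge0 (y * r)) h; lra.
Qed.

Lemma is_derive_scale (f : R -> R) (f' : R) y r : is_derive (y * r) 1 f f' ->
  is_derive r 1 (fun t => f (y * t)) (y * f').
Proof.
move=> df.
have dM : is_derive r 1 (fun t : R => y * t) y.
  have -> : (fun t : R => y * t) = (y \*: id) by [].
  by apply: is_derive_eq; rewrite /GRing.scale/= mulr1.
by have := @is_derive1_comp _ f (fun t => y * t) r _ _ df dM; rewrite mulrC.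
Qed.

(** First-order expansion in the scale: passing from variance [v] to [v + var_incr A] multiplies the
    standardised argument by a factor [r] slightly below 1. The bound [r ^+ 2 >= 1 / 2] keeps the
    weights at [y] and at [y * r] comparable. *)
Lemma gauss_cdf_scale y r : 2^-1 <= r ^+ 2 -> 0 <= r <= 1 ->
  `|Phi (y * r) - Phi y - (r - 1) * (y * phi y)| <= 64 * B * q y * (1 - r) ^+ 2.
Proof.
move=> r2 /andP[r0 r1].
pose R1 t := y * phi (y * t) - y * phi y.
pose R0 t := Phi (y * t) - Phi y - (t - 1) * (y * phi y).
have dR1 (t : R) : is_derive t 1 R1 (y * (y * phi' (y * t))).
  have d := is_derive_scale (is_derive_gauss_pdf (y * t)).
  have -> : R1 = (y \*: (fun t => phi (y * t))) - cst (y * phi y) by [].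
  by apply: is_derive_eq; rewrite subr0 /GRing.scale.
have dR0 (t : R) : is_derive t 1 R0 (R1 t).
  have d := is_derive_scale (is_derive_gauss_cdf (y * t)).
  have -> : R0 = (fun t => Phi (y * t) - cst (Phi y) t - ((y * phi y) *: (id t - cst 1 t))).
    by apply/funext => u; rewrite /R0 /GRing.scale/=; ring.
  by apply: is_derive_eq; rewrite /R1 /GRing.scale/=; ring.
have b2 t : `|t - 1| <= `|r - 1| -> `|y * (y * phi' (y * t))| <= 64 * B * q y.
  rewrite (distrC r) (@ger0_norm _ (1 - r)) ?subr_ge0// ler_norml => /andP[rt t2].
  have := @scaled_gauss_bound y t 3 isT _ _.
  have := gauss_pdf_ge0 (y * t).
  rewrite /phi'; move: (phi (y * t)) => p p0.
  rewrite !normrM normrN (ger0_norm (ler0n _ 2)) (ger0_norm p0).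
  rewrite (@ger0_norm _ t) => [b|]; last lra.
  have -> : `|y| * (`|y| * (2 * (`|y| * t) * p)) = 2 * t * (`|y| ^+ 3 * p) by ring.
  have b0 : 0 <= `|y| ^+ 3 * p by rewrite mulr_ge0 ?exprn_ge0.
  have {}b : `|y| ^+ 3 * p <= 16 * B * q y by apply: b; nra.
  have t22 : 0 <= t <= 2 by lra.
  have B0 := gauss_const_gt0; have q0 := cauchy_weight_gt0 y.
  by have := mulr_gt0 B0 q0; nra.
have B0 := gauss_const_gt0; have q0 := cauchy_weight_gt0 y.
have b1 t : `|t - 1| <= `|r - 1| -> `|R1 t| <= 64 * B * q y * `|r - 1|.
  move=> tr; have := @mean_value_bound R R1 _ 1 t (64 * B * q y) dR1.
  rewrite {2}/R1 mulr1 subrr subr0 => h; apply: le_trans (h _) _.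
    by move=> s st; apply: b2; apply: le_trans tr.
  by rewrite ler_wpM2l//; lra.
have := @mean_value_bound R R0 _ 1 r (64 * B * q y * `|r - 1|) dR0 b1.
rewrite {2}/R0 mulr1 !subrr mul0r subr0 subr0 -mulrA -expr2 real_normK ?num_real//.
by rewrite -(sqrrN (r - 1)) opprB.
Qed.

Lemma gauss_pdf'_scale y r : 2^-1 <= r ^+ 2 -> 0 <= r <= 1 ->
  `|r ^+ 2 * phi' (y * r) - phi' y| <= 1600 * B * q y * (1 - r).
Proof.
move=> r2 /andP[r0 r1].
pose R0 t := t ^+ 2 * phi' (y * t).
pose R1 t := 2 * t * phi' (y * t) + t ^+ 2 * (y * phi'' (y * t)).
have dR0 (t : R) : is_derive t 1 R0 (R1 t).
  have d := is_derive_scale (is_derive_gauss_pdf' (y * t)).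
  have -> : R0 = (id * id * (fun t : R => phi' (y * t))).
    by apply/funext => u; rewrite /R0 expr2.
  have d2 : is_derive t 1 (fun x : R => x * x) (2 * t).
    have -> : (fun x : R => x * x) = (id * id) by [].
    by apply: is_derive_eq; rewrite /GRing.scale/= mulr1 mulr_natl mulr2n.
  have := @is_deriveM _ _ _ _ t 1 _ _ d2 d.
  rewrite /R1; move: (phi' (y * t)) (phi'' (y * t)) => a b.
  by rewrite /GRing.scale/= (_ : t * t * (y * b) + a * (2 * t) = 2 * t * a + t ^+ 2 * (y * b)); last ring.
have := @mean_value_bound R R0 R1 1 r (1600 * B * q y) dR0.
rewrite {2}/R0 expr1n mul1r mulr1 -/(R0 r) (distrC r) (@ger0_norm _ (1 - r)) ?subr_ge0//.
apply => t; rewrite ler_norml => /andP[rt t2].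
have t0 : 0 <= t by lra.
have t22 : t <= 2 by lra.
have t2h : 2^-1 <= t ^+ 2 by nra.
have := @scaled_gauss_bound y t 3 isT t2h t0.
have := @scaled_gauss_bound y t 1 isT t2h t0.
have := gauss_pdf_ge0 (y * t).
rewrite expr1 /R1 /phi' /phi''; move: (phi (y * t)) => p p0 h1 h3.
rewrite (_ : _ + _ = - 6 * t ^+ 2 * (y * p) + 4 * t ^+ 4 * (y ^+ 3 * p)); last by ring.
apply: le_trans (ler_normD _ _) _.
have a1 : t ^+ 2 <= 4 by nra.
have a2 : t ^+ 4 <= 16 by rewrite (_ : 4 = (2 * 2))%N// exprM; have := sqr_ge0 t; nra.
have y1 : 0 <= `|y| * p by rewrite mulr_ge0.
have y3 : 0 <= `|y| ^+ 3 * p by rewrite mulr_ge0 ?exprn_ge0.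
have t20 := sqr_ge0 t; have t40 : 0 <= t ^+ 4 by rewrite exprn_ge0.
have B0 := gauss_const_gt0; have q0 := cauchy_weight_gt0 y.
have -> : `|- 6 * t ^+ 2 * (y * p)| = 6 * (t ^+ 2 * (`|y| * p)).
  by move: (t ^+ 2) t20 => T T0; rewrite !normrM normrN (ger0_norm T0) (ger0_norm p0) (ger0_norm (ler0n _ 6)) -!mulrA.
have -> : `|4 * t ^+ 4 * (y ^+ 3 * p)| = 4 * (t ^+ 4 * (`|y| ^+ 3 * p)).
  rewrite -normrX; move: (t ^+ 4) (y ^+ 3) t40 => T Y T0.
  by rewrite !normrM (ger0_norm T0) (ger0_norm p0) (ger0_norm (ler0n _ 4)) -!mulrA.
have := ler_pM t20 y1 a1 h1; have := ler_pM t40 y3 a2 h3.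
have := mulr_gt0 B0 q0; lra.
Qed.

End gauss.

(** * Real and imaginary parts *)

Section complex_parts.
Context (R : realType).
Implicit Types x y : R[i].
Local Notation Re := complex.Re.
Local Notation Im := complex.Im.

Lemma cReM x y : Re (x * y) = Re x * Re y - Im x * Im y.
Proof. by case: x y => [a b] [c d]. Qed.

Lemma cImM x y : Im (x * y) = Re x * Im y + Im x * Re y.
Proof. by case: x y => [a b] [c d]. Qed.

Lemma cReD x y : Re (x + y) = Re x + Re y.
Proof. by case: x y => [a b] [c d]. Qed.

Lemma cImD x y : Im (x + y) = Im x + Im y.
Proof. by case: x y => [a b] [c d]. Qed.

Lemma cReN x : Re (- x) = - Re x.
Proof. by case: x. Qed.

Lemma cImN x : Im (- x) = - Im x.
Proof. by case: x. Qed.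

Lemma cRe_conj x : Re (conjc x) = Re x.
Proof. by case: x. Qed.

Lemma cIm_conj x : Im (conjc x) = - Im x.
Proof. by case: x. Qed.

Lemma Re_real (r : R) : Re r%:C%C = r. Proof. by []. Qed.
Lemma Im_real (r : R) : Im r%:C%C = 0. Proof. by []. Qed.
Lemma Re_i : Re 'i%C = 0 :> R. Proof. by []. Qed.
Lemma Im_i : Im 'i%C = 1 :> R. Proof. by []. Qed.

Lemma cReZ (r : R) x : Re (r%:C%C * x) = r * Re x.
Proof. by rewrite cReM Re_real Im_real mul0r subr0. Qed.

Definition ReImE := (cReM, cImM, cReD, cImD, cReN, cImN, cRe_conj, cIm_conj, Re_real,
  Im_real, Re_i, Im_i, expr2).

Lemma sqr_normcE x : normc x ^+ 2 = Re x ^+ 2 + Im x ^+ 2.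
Proof. by case: x => a b /=; rewrite sqr_sqrtr// addr_ge0 ?sqr_ge0. Qed.

Lemma normc_ge0 x : 0 <= normc x.
Proof. by case: x => a b /=; rewrite sqrtr_ge0. Qed.

Lemma norm_Re_le x : `|Re x| <= normc x.
Proof.
rewrite -(@ler_pXn2r _ 2) ?nnegrE ?normc_ge0// sqr_normcE real_normK ?num_real//.
by rewrite lerDl sqr_ge0.
Qed.

Lemma normcX x n : normc (x ^+ n) = normc x ^+ n.
Proof.
by elim: n => [|n IH]; rewrite ?expr0 ?normc1// !exprS normcM IH.
Qed.

End complex_parts.

(** * One replacement step for the Gaussian distribution function *)

Definition step_const (R : realType) : R := 2000 * gauss_const R.

Lemma step_const_gt0 (R : realType) : 0 < step_const R.
Proof. by apply: mulr_gt0; [rewrite ltr0n|exact: gauss_const_gt0]. Qed.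

(** To be used with [h] the increment over [sqrt v], [rho = var_incr A / v], and [a], [b] the
    correctors over [v]. The difference consists of a term linear in [h], which is conditionally
    centred, of a [gauss_pdf'] term, which the choice of the corrector cancels in the mean, and of
    an error. The four error terms come with the factors 24, 24, 64 + 6 and 1600, all covered by
    [step_const]. *)
Lemma gauss_step_bound (R : realType) (y h r rho a b : R) : `|h| <= 1 -> 0 <= rho -> 0 <= r <= 1 ->
  r ^+ 2 * (1 + rho) = 1 -> rho <= 1 ->
  `|(gauss_cdf (y - h) + a * gauss_pdf' (y - h)) -
    (gauss_cdf (y * r) + b * r ^+ 2 * gauss_pdf' (y * r)) -
    (- gauss_pdf y * h + gauss_pdf' y * (2^-1 * (h ^+ 2 - rho / 2) + a - b))| <=
  step_const R * (`|h| ^+ 3 + `|a| * `|h| + rho ^+ 2 + `|b| * rho)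
    * cauchy_weight y.
Proof.
move=> h1 rho0 /andP[r0 r1] rrho rho1.
have r2h : 2^-1 <= r ^+ 2.
  by have := sqr_ge0 r; nra.
have t1 := gauss_cdf_taylor y h1.
have t2 := gauss_pdf'_shift y h1.
have r01 : 0 <= r <= 1 by rewrite r0.
have t3 := gauss_cdf_scale y r2h r01.
have t4 := gauss_pdf'_scale y r2h r01.
(* Differentiating in the scale gives a multiple of the second space derivative, as for the heat
   equation; this is why a gain of variance can compensate [h ^+ 2 / 2]. *)
have pE : y * gauss_pdf y = - 2^-1 * gauss_pdf' y by rewrite /gauss_pdf'; field.
rewrite pE in t3.
have t5 := gauss_pdf'_bound y.
have q0 := cauchy_weight_gt0 y; have B0 := gauss_const_gt0 R.
have Bq : 0 <= gauss_const R * cauchy_weight y by rewrite mulr_ge0// ltW.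
have r1r : 1 - r <= rho by nra.
have r1r2 : (1 - r) ^+ 2 <= rho ^+ 2 by rewrite lerXn2r ?nnegrE//; lra.
set p' := gauss_pdf' y in pE t1 t2 t3 t4 t5 *.
set q := cauchy_weight y in t1 t2 t3 t4 t5 q0 Bq *.
set B := gauss_const R in t1 t2 t3 t4 t5 B0 Bq *.
(* Since [r = (1 + rho) ^ (- 1 / 2)], the parts of [(r - 1) / 2] and [- rho / 4] linear in [rho]
   agree; the identity [e] exhibits the double zero at [r = 1]. *)
have e5 : `|(2^-1 * (r - 1) + rho / 4) * p'| <= 6 * rho ^+ 2 * (B * q).
  have e : 2^-1 * (r - 1) + rho / 4 = (1 - r) ^+ 2 * (1 + 2 * r) / (4 * r ^+ 2).
    have -> : rho = r ^- 2 - 1.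
      by apply: (@mulfI _ (r ^+ 2)); [rewrite gt_eqF//; lra|
         rewrite mulrBr mulfV ?gt_eqF//; [lra|lra]].
    field; rewrite gt_eqF//; nra.
  have e0 : 0 <= 2^-1 * (r - 1) + rho / 4.
    by rewrite e divr_ge0 ?mulr_ge0 ?sqr_ge0//; lra.
  have e1 : 2^-1 * (r - 1) + rho / 4 <= 3 * rho ^+ 2.
    rewrite e ler_pdivrMr; last by lra.
    have := sqr_ge0 (1 - r); have := sqr_ge0 rho; nra.
  rewrite normrM (ger0_norm e0).
  apply: le_trans (ler_pM e0 (normr_ge0 _) e1 t5) _; lra.
rewrite (_ : _ - _ = (gauss_cdf (y - h) - gauss_cdf y + gauss_pdf y * h - 2^-1 * p' * h ^+ 2)
   + a * (gauss_pdf' (y - h) - p')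
   - (gauss_cdf (y * r) - gauss_cdf y - (r - 1) * (- 2^-1 * p'))
   - b * (r ^+ 2 * gauss_pdf' (y * r) - p')
   + (2^-1 * (r - 1) + rho / 4) * p'); last first.
  by clear; move: (gauss_cdf _) (gauss_cdf _) (gauss_cdf _) (gauss_pdf' _) (gauss_pdf' _) (gauss_pdf y) p' => *; field.
apply: le_trans (ler_normD _ _) _; apply: le_trans (lerD (ler_normB _ _) e5) _.
apply: le_trans (lerD (lerD (ler_normB _ _) (lexx _)) (lexx _)) _.
apply: le_trans (lerD (lerD (lerD (ler_normD _ _) (lexx _)) (lexx _)) (lexx _)) _.
rewrite /step_const -/B !(normrM a) !(normrM b).
have u2 := ler_wpM2l (normr_ge0 a) t2.
have u4 := ler_wpM2l (normr_ge0 b) t4.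
have v3 := ler_wpM2r Bq r1r2.
have v4 : `|b| * (B * q) * (1 - r) <= `|b| * (B * q) * rho by rewrite ler_wpM2l// mulr_ge0.
have w1 : 0 <= `|h| ^+ 3 * (B * q) by rewrite mulr_ge0// exprn_ge0.
have w2 : 0 <= `|a| * `|h| * (B * q) by rewrite mulr_ge0// mulr_ge0.
have w3 : 0 <= rho ^+ 2 * (B * q) by rewrite mulr_ge0// exprn_ge0.
have w4 : 0 <= `|b| * rho * (B * q) by rewrite mulr_ge0// mulr_ge0.
lra.
Qed.

Section gauss_measurable.
Context (R : realType).

Lemma derivable_measurable (f f' : R -> R) :
  (forall t : R, is_derive t 1 f (f' t)) -> measurable_fun [set: R] f.
Proof.
move=> df; apply: continuous_measurable_fun => x.
apply: differentiable_continuous; apply/derivable1_diffP.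
by have [] := df x.
Qed.

Context d (T : measurableType d).
Implicit Types s : T -> R.

Lemma bm_standardize s (x r : R) : bounded_measurable s ->
  bounded_measurable (fun w => (x - s w) / r).
Proof.
move=> bs; apply: bounded_measurableM; last exact: bounded_measurable_cst.
by apply: bounded_measurableB => //; exact: bounded_measurable_cst.
Qed.

Lemma bm_gauss_cdf s : bounded_measurable s ->
  bounded_measurable (fun w => gauss_cdf (s w)).
Proof.
move=> [ms _]; apply: bounded_measurable_comp => //.
  by apply: derivable_measurable => t; exact: is_derive_gauss_cdf.
by exists 1 => t; rewrite ger0_norm ?gauss_cdf_ge0// gauss_cdf_le1.
Qed.

Lemma bm_gauss_pdf s : bounded_measurable s ->
  bounded_measurable (fun w => gauss_pdf (s w)).
Proof.
move=> [ms _]; apply: bounded_measurable_comp => //.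
  by apply: derivable_measurable => t; exact: is_derive_gauss_pdf.
exists (gauss_const R) => t; rewrite ger0_norm ?gauss_pdf_ge0//.
have := @gauss_moment_bound R t 0 isT; rewrite expr0 mul1r => /le_trans; apply.
by rewrite ler_piMr ?cauchy_weight_le1// ltW// gauss_const_gt0.
Qed.

Lemma bm_gauss_pdf' s : bounded_measurable s ->
  bounded_measurable (fun w => gauss_pdf' (s w)).
Proof.
move=> bs; apply: bounded_measurableM (bm_gauss_pdf bs).
by apply: bounded_measurableM => //; exact: bounded_measurable_cst.
Qed.

Lemma bm_cauchy_weight s : bounded_measurable s ->
  bounded_measurable (fun w => cauchy_weight (s w)).
Proof.
move=> [ms _]; apply: bounded_measurable_comp => //.
  apply: continuous_measurable_fun => x; apply: cvgV.
    by rewrite gt_eqF// ltr_wpDr ?sqr_ge0.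
  by apply: cvgD; [exact: cvg_cst|exact: exprn_continuous].
exists 1 => t; rewrite ger0_norm ?cauchy_weight_le1//.
exact/ltW/cauchy_weight_gt0.
Qed.

End gauss_measurable.

Definition bounded_measurableC d (T : measurableType d) (R : realType)
    (g : T -> R[i]) : Prop :=
  bounded_measurable (fun w => complex.Re (g w)) /\
  bounded_measurable (fun w => complex.Im (g w)).

Section bounded_measurableC.
Context d (T : measurableType d) (R : realType).
Implicit Types f g : T -> R[i].
Local Notation bmC := (@bounded_measurableC d T R).

Lemma bounded_measurableC_cst c : bmC (fun=> c).
Proof. by split; exact: bounded_measurable_cst. Qed.

Lemma bounded_measurableCM f g : bmC f -> bmC g -> bmC (fun w => f w * g w).
Proof.
move=> [fr fi] [gr gi]; split.
  under eq_fun do rewrite cReM.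
  by apply: bounded_measurableB; exact: bounded_measurableM.
under eq_fun do rewrite cImM.
by apply: bounded_measurableD; exact: bounded_measurableM.
Qed.

Lemma bounded_measurableCD f g : bmC f -> bmC g -> bmC (fun w => f w + g w).
Proof.
move=> [fr fi] [gr gi]; split.
  by under eq_fun do rewrite cReD; exact: bounded_measurableD.
by under eq_fun do rewrite cImD; exact: bounded_measurableD.
Qed.

Lemma bounded_measurableCN f : bmC f -> bmC (fun w => - f w).
Proof.
move=> [fr fi]; split.
  by under eq_fun do rewrite cReN; exact: bounded_measurableN.
by under eq_fun do rewrite cImN; exact: bounded_measurableN.
Qed.

Lemma bounded_measurableCB f g : bmC f -> bmC g -> bmC (fun w => f w - g w).
Proof. by move=> bf /bounded_measurableCN; exact: bounded_measurableCD. Qed.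

Lemma bounded_measurableCX f n : bmC f -> bmC (fun w => f w ^+ n).
Proof.
move=> bf; elim: n => [|n IH].
  by under eq_fun do rewrite expr0; exact: bounded_measurableC_cst.
by under eq_fun do rewrite exprS; exact: bounded_measurableCM.
Qed.

Lemma bounded_measurableC_conj f : bmC f -> bmC (fun w => conjc (f w)).
Proof.
move=> [fr fi]; split; first by under eq_fun do rewrite cRe_conj.
by under eq_fun do rewrite cIm_conj; exact: bounded_measurableN.
Qed.

Lemma bounded_measurableC_real (h : T -> R) :
  bounded_measurable h -> bmC (fun w => (h w)%:C%C).
Proof. by move=> bh; split => //=; exact: bounded_measurable_cst. Qed.

Lemma bounded_measurableC_precomp d' (U : measurableType d') (t : U -> T) f :
  measurable_fun [set: U] t -> bmC f ->
  bounded_measurableC (fun w => f (t w)).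
Proof.
by move=> mt [bR bI]; split; [exact: (bounded_measurable_precomp mt bR)|
  exact: (bounded_measurable_precomp mt bI)].
Qed.

End bounded_measurableC.

(** * Chains with contracting conditional means *)

(* [chain_cond1] and [chain_cond2] say that the conditional means of [z] and of
   [z ^ 2] given [S] are [lam * z \o S] and [mu * z \o S + lam ^ 2 * (z \o S) ^ 2]. *)
Record contracting_chain d (T : measurableType d) (R : realType)
    (P : probability T R) (S : T -> T) (z : T -> R[i]) (lam mu : R[i]) : Prop :=
  ContractingChain {
    chain_measurable : measurable_fun [set: T] S ;
    chain_bounded : bounded_measurableC z ;
    chain_unit : forall w, complex.Re (z w) ^+ 2 + complex.Im (z w) ^+ 2 = 1 ;
    chain_lam : normc lam < 1 ;
    chain_mu : normc mu <= 1 ;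
    chain_invariant : forall h : T -> R, bounded_measurable h ->
      expect P (fun w => h (S w)) = expect P h ;
    chain_mean : forall c, expect P (fun w => complex.Re (c * z w)) = 0 ;
    chain_mean2 : forall c, expect P (fun w => complex.Re (c * z w ^+ 2)) = 0 ;
    chain_cond1 : forall g : T -> R[i], bounded_measurableC g ->
      expect P (fun w => complex.Re (g (S w) * (z w - lam * z (S w)))) = 0 ;
    chain_cond2 : forall g : T -> R[i], bounded_measurableC g ->
      expect P (fun w => complex.Re
        (g (S w) * (z w ^+ 2 - mu * z (S w) - lam ^+ 2 * z (S w) ^+ 2))) = 0 }.

Section chain.
Context d (T : measurableType d) (R : realType) (P : probability T R)
  (S : T -> T) (z : T -> R[i]) (lam mu : R[i])
  (HC : contracting_chain P S z lam mu).
Local Notation Re := complex.Re.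
Local Notation Im := complex.Im.
Local Notation E := (expect P).
Local Notation bm := bounded_measurable.
Local Notation bmC := bounded_measurableC.

Let mS := chain_measurable HC.
Let bz := chain_bounded HC.

Definition increment (A : R[i]) (w : T) : R := Re (A * (z w - lam * z (S w))).

(** The mean of [|A (z - lam z \o S)| ^ 2]. The real part has half of it as variance, in accordance
    with the variance [1 / 2] of the limit law. *)
Definition var_incr (A : R[i]) : R := (1 - normc lam ^+ 2) * normc A ^+ 2.

(* A martingale in reversed time: [s] is evaluated at the end of the orbit
   [w, S w, .., S ^ k w], and [A 0] is the increment next to it. *)
Fixpoint walk (s : T -> R) (A : nat -> R[i]) (k : nat) (w : T) : R :=
  if k is k'.+1 then walk s A k' (S w) + increment (A k') w else s w.

Lemma normc_chain w : normc (z w) = 1.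
Proof.
apply/eqP; rewrite -(@eqrXn2 _ 2) ?normc_ge0// sqr_normcE (chain_unit HC).
by rewrite expr1n.
Qed.

Lemma bmC_zS : bmC (fun w => z (S w)).
Proof. exact: (bounded_measurableC_precomp mS bz). Qed.

Lemma bm_increment A : bm (increment A).
Proof.
have := bmC_zS => bzS.
by have [] : bmC (fun w => A * (z w - lam * z (S w))); first
  (apply: bounded_measurableCM; first exact: bounded_measurableC_cst;
   apply: bounded_measurableCB => //; apply: bounded_measurableCM => //;
   exact: bounded_measurableC_cst).
Qed.

Lemma bm_Rez c : bm (fun w => Re (c * z w)).
Proof.
by have [] : bmC (fun w => c * z w); first
  (apply: bounded_measurableCM => //; exact: bounded_measurableC_cst).
Qed.

Lemma bm_comp_S (h : T -> R) : bm h -> bm (fun w => h (S w)).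
Proof. exact: (bounded_measurable_precomp mS). Qed.

Lemma bm_walk s A k : bm s -> bm (walk s A k).
Proof.
move=> bs; elim: k => [//|k IH]; apply: bounded_measurableD.
  exact: bm_comp_S.
exact: bm_increment.
Qed.

Lemma increment_bound A w : `|increment A w| <= 2 * normc A.
Proof.
apply: le_trans (norm_Re_le _) _; rewrite normcM mulrC ler_wpM2r ?normc_ge0//.
apply: le_trans (le_normcD _ _) _; rewrite normcN normcM !normc_chain.
have := chain_lam HC; lra.
Qed.

Lemma var_incr_ge0 A : 0 <= var_incr A.
Proof.
rewrite mulr_ge0 ?sqr_ge0// subr_ge0 exprn_ile1 ?normc_ge0//.
exact/ltW/(chain_lam HC).
Qed.

Lemma var_incr_le A : var_incr A <= normc A ^+ 2.
Proof. by rewrite ler_piMl ?sqr_ge0// gerBl sqr_ge0. Qed.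

Lemma expect_increment h A : bm h -> E (fun w => h (S w) * increment A w) = 0.
Proof.
move=> bh; rewrite -[RHS](chain_cond1 HC (g := fun w => (h w)%:C%C * A)).
  by apply: eq_expect => w; rewrite /increment !ReImE; ring.
apply: bounded_measurableCM; first exact: bounded_measurableC_real.
exact: bounded_measurableC_cst.
Qed.

(** The conditional second moment given [S w], plus terms that integrate to zero against functions
    of [S w]. It rests on [(Re x) ^ 2 = (|x| ^ 2 + Re (x ^ 2)) / 2] with [x = A D] and
    [D = z w - lam Z]: because [|z| = 1], [|D| ^ 2] is affine in [D] and its conjugate, and [D ^ 2]
    is a combination of [Z], [D] and the expression of [chain_cond2]. *)
Lemma increment_sqrE A w : let Z := z (S w) in
  increment A w ^+ 2 = 2^-1 * (var_incr A + Re (A ^+ 2 * mu * Z)) +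
    (Re (2^-1%:C%C * A ^+ 2 * (z w ^+ 2 - mu * Z - lam ^+ 2 * Z ^+ 2)) -
     Re ((A ^+ 2 * lam * Z + (normc A ^+ 2)%:C%C * conjc (lam * Z)) *
         (z w - lam * Z))).
Proof.
move=> Z; set D := z w - lam * Z; set L := lam * Z.
have nz : normc (z w) ^+ 2 = 1 by rewrite normc_chain expr1n.
have nL : normc L ^+ 2 = normc lam ^+ 2 by rewrite normcM normc_chain mulr1.
have nB (x y : R[i]) :
    normc (x - y) ^+ 2 = normc x ^+ 2 - normc y ^+ 2 - 2 * Re (conjc y * (x - y)).
  by rewrite !sqr_normcE; case: x y => [p q] [u v] /=; rewrite !ReImE /=; ring.
have nD : normc D ^+ 2 = 1 - normc lam ^+ 2 - 2 * Re (conjc L * D).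
  by rewrite nB nz nL.
have sq : (Re (A * D)) ^+ 2 = 2^-1 * (normc A ^+ 2 * normc D ^+ 2 + Re ((A * D) ^+ 2)).
  rewrite -exprMn -normcM sqr_normcE; case: (A * D) => p q /=.
  by rewrite !ReImE /=; field.
have AD : (A * D) ^+ 2 = A ^+ 2 * mu * Z +
    A ^+ 2 * (z w ^+ 2 - mu * Z - lam ^+ 2 * Z ^+ 2) - 2 * (A ^+ 2 * L * D).
  by rewrite /D /L; ring.
have -> : A ^+ 2 * lam * Z = A ^+ 2 * L by rewrite /L mulrA.
rewrite /increment -/Z -/L -/D sq nD AD -(mulrA (2^-1)%:C%C) cReZ.
rewrite (_ : (_ + _) * D = A ^+ 2 * L * D + (normc A ^+ 2)%:C%C * (conjc L * D)); last by ring.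
rewrite !cReD cReN cReZ (_ : 2 = 2%:C%C) ?cReZ; last by rewrite rmorph_nat.
by rewrite /var_incr; field.
Qed.

Lemma expect_increment_sqr h A : bm h ->
  E (fun w => h (S w) * increment A w ^+ 2) =
  2^-1 * (var_incr A * E h + E (fun w => h w * Re (A ^+ 2 * mu * z w))).
Proof.
move=> bh.
pose g1 w := (h w)%:C%C * (2^-1%:C%C * A ^+ 2).
pose g2 w := (h w)%:C%C * (A ^+ 2 * lam * z w + (normc A ^+ 2)%:C%C * conjc (lam * z w)).
have bhC : bmC (fun w => (h w)%:C%C) by exact: bounded_measurableC_real.
have blz : bmC (fun w => lam * z w).
  by apply: bounded_measurableCM => //; exact: bounded_measurableC_cst.
have bg1 : bmC g1 by apply: bounded_measurableCM => //; exact: bounded_measurableC_cst.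
have bg2 : bmC g2.
  apply: bounded_measurableCM => //; apply: bounded_measurableCD.
    by apply: bounded_measurableCM => //; exact: bounded_measurableC_cst.
  apply: bounded_measurableCM; first exact: bounded_measurableC_cst.
  exact: bounded_measurableC_conj.
pose D1 w := z w - lam * z (S w).
pose D2 w := z w ^+ 2 - mu * z (S w) - lam ^+ 2 * z (S w) ^+ 2.
have bzS := bmC_zS.
have bD1 : bmC D1.
  by do ![apply: bounded_measurableCB|apply: bounded_measurableCM|
    exact: bounded_measurableC_cst|exact: bzS|exact: bz].
have bD2 : bmC D2.
  by do ![apply: bounded_measurableCB|apply: bounded_measurableCX|
    apply: bounded_measurableCM|exact: bounded_measurableC_cst|exact: bzS|exact: bz].
pose k w := h w * (2^-1 * (var_incr A + Re (A ^+ 2 * mu * z w))).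
have bRe : bm (fun w => Re (A ^+ 2 * mu * z w)) by exact: bm_Rez.
have bk : bm k.
  apply: bounded_measurableM => //; apply: bounded_measurableM.
    exact: bounded_measurable_cst.
  by apply: bounded_measurableD => //; exact: bounded_measurable_cst.
have e2 : bm (fun w => Re (g2 (S w) * D1 w)).
  by have [] := bounded_measurableCM (bounded_measurableC_precomp mS bg2) bD1.
have e1 : bm (fun w => Re (g1 (S w) * D2 w)).
  by have [] := bounded_measurableCM (bounded_measurableC_precomp mS bg1) bD2.
transitivity (E (fun w => k (S w) + (Re (g1 (S w) * D2 w) - Re (g2 (S w) * D1 w)))).
  apply: eq_expect => w; rewrite increment_sqrE /k /g1 /g2 /D1 /D2 -!(mulrA (h (S w))%:C%C) !cReZ.
  by rewrite -mulrBr -mulrDr.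
rewrite expectD//; last 2 first.
- exact: bm_comp_S.
- exact: bounded_measurableB.
rewrite expectB// (chain_cond1 HC bg2) (chain_cond2 HC bg1) subrr addr0.
rewrite (chain_invariant HC bk) -expectZ// -expectD; last 2 first.
- by apply: bounded_measurableM => //; exact: bounded_measurable_cst.
- exact: bounded_measurableM.
rewrite -expectZ; last first.
  by apply: bounded_measurableD; apply: bounded_measurableM => //; exact: bounded_measurable_cst.
by apply: eq_expect => w; rewrite /k; ring.
Qed.

Lemma measurable_iter_S k : measurable_fun [set: T] (iter k S).
Proof.
elim: k => [|k IH]; first exact: measurable_id.
exact: (measurableT_comp mS IH).
Qed.

Lemma expect_iter_S h k : bm h -> E (fun w => h (iter k S w)) = E h.
Proof.
move=> bh; elim: k => [//|k IH]; rewrite -[RHS]IH.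
rewrite -[RHS](chain_invariant HC (bounded_measurable_precomp (measurable_iter_S k) bh)).
by apply: eq_expect => w; rewrite iterSr.
Qed.

(** [Q] is evaluated at the end of the orbit, which lies in the past of the reversed martingale, so
    the cross terms vanish. The conditional variances are bounded crudely by [normc (A j) ^+ 2],
    because their [mu] part need not average out against [Q]. *)
Lemma expect_walk_sqr Q s A k : bm Q -> bm s -> (forall w, 0 <= Q w) ->
  E (fun w => Q (iter k S w) * (walk s A k w - s (iter k S w)) ^+ 2) <=
  E Q * \sum_(j < k) normc (A j) ^+ 2.
Proof.
move=> bQ bs Q0; elim: k => [|k IH].
  rewrite big_ord0 mulr0 (_ : (fun _ => _) = (fun=> 0)) ?expect_cst//.
  by apply/funext => w /=; rewrite subrr expr0n mulr0.
pose Qk w := Q (iter k S w); pose dk w := walk s A k w - s (iter k S w).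
have bQk : bm Qk by exact: (bounded_measurable_precomp (measurable_iter_S k)).
have bdk : bm dk.
  apply: bounded_measurableB; first exact: bm_walk.
  exact: (bounded_measurable_precomp (measurable_iter_S k)).
have bX := bm_increment (A k).
have b1 : bm (fun w => Qk w * dk w ^+ 2).
  by apply: bounded_measurableM => //; exact: bounded_measurableX.
have b2 : bm (fun w => 2 * (Qk w * dk w)).
  apply: bounded_measurableM; first exact: bounded_measurable_cst.
  exact: bounded_measurableM.
have b1S := bm_comp_S b1; have b2S := bm_comp_S b2; have bQkS := bm_comp_S bQk.
have -> : (fun w => Q (iter k.+1 S w) * (walk s A k.+1 w - s (iter k.+1 S w)) ^+ 2) =
   (fun w => Qk (S w) * dk (S w) ^+ 2 + (2 * (Qk (S w) * dk (S w)) * increment (A k) w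
      + Qk (S w) * increment (A k) w ^+ 2)).
  by apply/funext => w; rewrite /Qk /dk iterSr /=; ring.
have bX2 : bm (fun w => Qk (S w) * increment (A k) w ^+ 2).
  by apply: bounded_measurableM => //; exact: bounded_measurableX.
have b2X : bm (fun w => 2 * (Qk (S w) * dk (S w)) * increment (A k) w).
  exact: bounded_measurableM.
rewrite expectD//; last exact: bounded_measurableD.
rewrite expectD// (expect_increment _ b2) add0r (chain_invariant HC b1).
rewrite big_ord_recr mulrDr lerD// (expect_increment_sqr _ bQk).
have EQ : E Qk = E Q by exact: expect_iter_S.
have hRe : E (fun w => Qk w * Re (A k ^+ 2 * mu * z w)) <= normc (A k) ^+ 2 * E Q.
  rewrite -EQ -expectZ//; apply: le_expect.
  - by apply: bounded_measurableM => //; exact: bm_Rez.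
  - by apply: bounded_measurableM => //; exact: bounded_measurable_cst.
  move=> w; rewrite mulrC ler_wpM2r ?Q0//; apply: le_trans (ler_norm _) _.
  apply: le_trans (norm_Re_le _) _; rewrite 2!normcM normc_chain mulr1 normcX.
  by rewrite ler_piMr ?exprn_ge0 ?normc_ge0// (chain_mu HC).
have EQ0 : 0 <= E Q by exact: expect_ge0.
have := var_incr_le (A k); rewrite EQ => /(ler_wpM2r EQ0); lra.
Qed.

(** Without a weight the [mu] part does average out, by [chain_mean], and the variance is exact;
    [chain_mean2] plays the same part for the starting term. *)
Lemma expect_walk_var c A k :
  E (fun w => walk (fun w => Re (c * z w)) A k w ^+ 2) =
  2^-1 * (normc c ^+ 2 + \sum_(j < k) var_incr (A j)).
Proof.
elim: k => [|k IH].
  rewrite big_ord0 addr0 /=.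
  have -> : (fun w => Re (c * z w) ^+ 2) =
      (fun w => 2^-1 * (normc c ^+ 2 + Re (c ^+ 2 * z w ^+ 2))).
    apply/funext => w; rewrite -exprMn.
    have <- : normc (c * z w) = normc c by rewrite normcM normc_chain mulr1.
    rewrite sqr_normcE.
    by case: (c * z w) => p q; rewrite !ReImE /=; field.
  have b2 : bm (fun w => Re (c ^+ 2 * z w ^+ 2)).
    have [] : bmC (fun w => c ^+ 2 * z w ^+ 2) => //.
    by apply: bounded_measurableCM; [exact: bounded_measurableC_cst|exact: bounded_measurableCX].
  have b1 : bm (fun _ : T => normc c ^+ 2) by exact: bounded_measurable_cst.
  rewrite expectZ; last exact: bounded_measurableD.
  by rewrite expectD// expect_cst (chain_mean2 HC) addr0.
set s := fun w => Re (c * z w).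
have bs : bm s by exact: bm_Rez.
have bW := bm_walk A k bs; have bX := bm_increment (A k).
have bWS := bm_comp_S bW.
have b1 : bm (fun w => walk s A k w ^+ 2) by exact: bounded_measurableX.
have b2 : bm (fun w => 2 * walk s A k w).
  by apply: bounded_measurableM => //; exact: bounded_measurable_cst.
have c1 : bm (fun _ : T => 1 : R) by exact: bounded_measurable_cst.
have -> : (fun w => walk s A k.+1 w ^+ 2) = (fun w => walk s A k (S w) ^+ 2 +
    (2 * walk s A k (S w) * increment (A k) w + 1 * increment (A k) w ^+ 2)).
  by apply/funext => w /=; ring.
have bX2 : bm (fun w => 1 * increment (A k) w ^+ 2).
  by apply: bounded_measurableM => //; exact: bounded_measurableX.
have b2X : bm (fun w => 2 * walk s A k (S w) * increment (A k) w).
  by apply: bounded_measurableM => //; exact: (bm_comp_S b2).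
rewrite expectD//; [|exact: (bm_comp_S b1)|exact: bounded_measurableD].
rewrite expectD// (expect_increment _ b2) add0r (chain_invariant HC b1) IH.
rewrite (expect_increment_sqr _ c1) expect_cst.
under [X in _ + _ * (_ + E X)]eq_fun do rewrite mul1r.
by rewrite (chain_mean HC) big_ord_recr/=; ring.
Qed.

(* The second term is a corrector: it compensates the term [mu * z \o S] of the
   conditional variance of an increment, which does not average out. *)
Definition smoothed (x v : R) (B : R[i]) (s : T -> R) (w : T) : R :=
  let y := (x - s w) / Num.sqrt v in
  gauss_cdf y + Re (B * z w) / v * gauss_pdf' y.

Lemma bm_smoothed x v B s : bm s -> bm (smoothed x v B s).
Proof.
move=> bs; have by_ := bm_standardize x (Num.sqrt v) bs.
apply: bounded_measurableD; first exact: bm_gauss_cdf.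
apply: bounded_measurableM; last exact: bm_gauss_pdf'.
by apply: bounded_measurableM; [exact: bm_Rez|exact: bounded_measurable_cst].
Qed.

(** The drift of the corrector: [z] is replaced by its conditional mean [lam z \o S], and the result
    is moved from [S w] to [w] by invariance. *)
Lemma expect_Re_S h c : bm h ->
  E (fun w => h (S w) * Re (c * z w)) = E (fun w => h w * Re (lam * c * z w)).
Proof.
move=> bh.
have bL : bm (fun w => h w * Re (lam * c * z w)).
  by apply: bounded_measurableM => //; exact: bm_Rez.
have bc : bmC (fun w => (h w)%:C%C * c).
  apply: bounded_measurableCM; first exact: bounded_measurableC_real.
  exact: bounded_measurableC_cst.
rewrite -(chain_invariant HC bL) -[RHS]addr0 -(chain_cond1 HC bc) -expectD.
- by apply: eq_expect => w; rewrite !ReImE; ring.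
- exact: (bm_comp_S bL).
- have [] // := bounded_measurableCM (bounded_measurableC_precomp mS bc)
    (bounded_measurableCB bz (bounded_measurableCM (bounded_measurableC_cst T lam) bmC_zS)).
Qed.

(** The factor [1 / 4] in [B1] is the [1 / 2] of Taylor's formula times the [1 / 2] of the
    conditional variance. The factor 8 is the cube of the 2 in [increment_bound], and
    [(2 * normc A) ^+ 2 <= v] makes the standardised increment at most 1. *)
Lemma lindeberg_step s (x v : R) (A B B1 : R[i]) : 0 < v -> bm s -> var_incr A <= v ->
  (2 * normc A) ^+ 2 <= v ->
  B1 = lam * B + 4^-1%:C%C * (A ^+ 2 * mu) ->
  `|E (smoothed x v B (fun w => s (S w) + increment A w)) -
    E (smoothed x (v + var_incr A) B1 s)| <=
  8 * step_const R * ((normc A ^+ 3 + normc B * normc A) / Num.sqrt v ^+ 3 +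
     (var_incr A ^+ 2 + normc B1 * var_incr A) / v ^+ 2) *
  E (fun w => cauchy_weight ((x - s w) / Num.sqrt v)).
Proof.
move=> v0 bs vA Av B1E.
set tau := Num.sqrt v; set vs := var_incr A in vA *.
have tau0 : 0 < tau by rewrite sqrtr_gt0.
have tau2 : tau ^+ 2 = v by rewrite sqr_sqrtr// ltW.
have vs0 : 0 <= vs by exact: var_incr_ge0.
pose rho := vs / v; pose r := tau / Num.sqrt (v + vs).
have rho0 : 0 <= rho by rewrite divr_ge0// ltW.
have rho1 : rho <= 1 by rewrite ler_pdivrMr// mul1r.
have vvs0 : 0 < v + vs by lra.
have r01 : 0 <= r <= 1.
  rewrite divr_ge0 ?sqrtr_ge0//= ler_pdivrMr ?sqrtr_gt0// mul1r ler_wsqrtr//; lra.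
have r2 : r ^+ 2 * (1 + rho) = 1.
  rewrite expr_div_n tau2 sqr_sqrtr ?(ltW vvs0)// /rho; field.
  by rewrite !gt_eqF.
pose y w := (x - s w) / tau.
have by_ : bm y by exact: bm_standardize.
pose G1 w := - gauss_pdf (y w) / tau; pose G2 w := gauss_pdf' (y w).
have bG1 : bm G1.
  apply: bounded_measurableM; last exact: bounded_measurable_cst.
  by apply: bounded_measurableN; exact: bm_gauss_pdf.
have bG2 : bm G2 by exact: bm_gauss_pdf'.
pose s1 w := s (S w) + increment A w.
have bs1 : bm s1.
  by apply: bounded_measurableD; [exact: bm_comp_S|exact: bm_increment].
have bU1 := bm_smoothed x v B bs1.
have bU0 := bm_smoothed x (v + vs) B1 bs.
(* The leading part of the difference, the second smoothed function being taken at [S w]. Apart from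
   the increment and from [z w], all factors are functions of [S w], so that the conditional
   identities apply. *)
pose main w := G1 (S w) * increment A w +
  (((2 * v)^-1 * (G2 (S w) * increment A w ^+ 2) - (4 * v)^-1 * vs * G2 (S w)) +
   (v^-1 * (G2 (S w) * Re (B * z w)) - v^-1 * (G2 (S w) * Re (B1 * z (S w))))).
have bX := bm_increment A.
have bG1S := bm_comp_S bG1; have bG2S := bm_comp_S bG2.
have c1 (c : R) : bm (fun _ : T => c) by exact: bounded_measurable_cst.
have bm1 : bm (fun w => G1 (S w) * increment A w) by exact: bounded_measurableM.
have bX2 : bm (fun w => G2 (S w) * increment A w ^+ 2).
  by apply: bounded_measurableM => //; exact: bounded_measurableX.
have bm2 : bm (fun w => (2 * v)^-1 * (G2 (S w) * increment A w ^+ 2)) by exact: bounded_measurableM.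
have bm3 : bm (fun w => (4 * v)^-1 * vs * G2 (S w)) by exact: bounded_measurableM.
have bB : bm (fun w => G2 (S w) * Re (B * z w)).
  by apply: bounded_measurableM => //; exact: bm_Rez.
have bm4 : bm (fun w => v^-1 * (G2 (S w) * Re (B * z w))) by exact: bounded_measurableM.
have bB1' : bm (fun w => G2 w * Re (B1 * z w)).
  by apply: bounded_measurableM => //; exact: bm_Rez.
have bB1 := bm_comp_S bB1'.
have bm5 : bm (fun w => v^-1 * (G2 (S w) * Re (B1 * z (S w)))) by exact: bounded_measurableM.
have b23 := bounded_measurableB bm2 bm3; have b45 := bounded_measurableB bm4 bm5.
have b2345 := bounded_measurableD b23 b45.
have bmain : bm main by exact: bounded_measurableD bm1 b2345.
(* The constant parts of the variance cancel as [(2 v)^-1 / 2 = (4 v)^-1], and the recursion for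
   [B1] cancels the terms containing [z]. *)
have Emain : E main = 0.
  rewrite expectD// (expect_increment _ bG1) add0r expectD// expectB// expectB//.
  rewrite !expectZ// (expect_increment_sqr _ bG2) (expect_Re_S _ bG2).
  rewrite (chain_invariant HC bB1') (chain_invariant HC bG2).
  have bl : bm (fun w => G2 w * Re (lam * B * z w)).
    by apply: bounded_measurableM => //; exact: bm_Rez.
  have bmu : bm (fun w => G2 w * Re (A ^+ 2 * mu * z w)).
    by apply: bounded_measurableM => //; exact: bm_Rez.
  have -> : E (fun w => G2 w * Re (B1 * z w)) =
     E (fun w => G2 w * Re (lam * B * z w)) + 4^-1 * E (fun w => G2 w * Re (A ^+ 2 * mu * z w)).
    rewrite -expectZ// -expectD//; last exact: bounded_measurableM.
    apply: eq_expect => w; rewrite B1E mulrDl cReD mulrDr -(mulrA (4^-1)%:C%C) cReZ.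
    by ring.
  by rewrite -/vs; field; rewrite gt_eqF.
have bq : bm (fun w => cauchy_weight (y w)) by exact: bm_cauchy_weight.
set K := 8 * _ * _.
(* Invariance moves the second smoothed function to [S w], which allows a pointwise comparison;
   subtracting the centred [main] leaves the mean unchanged. *)
rewrite -(chain_invariant HC bU0) -expectB//; last exact: (bm_comp_S bU0).
have bU0S := bm_comp_S bU0.
have bdiff := bounded_measurableB bU1 bU0S.
have -> : E (fun w => smoothed x v B s1 w - smoothed x (v + vs) B1 s (S w)) =
   E (fun w => smoothed x v B s1 w - smoothed x (v + vs) B1 s (S w) - main w).
  by rewrite [RHS]expectB// Emain subr0.
rewrite -expectZ// -(chain_invariant HC (bounded_measurableM (c1 K) bq)).
apply: expect_norm_le.
- exact: bounded_measurableB.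
- exact: (bm_comp_S (bounded_measurableM (c1 K) bq)).
move=> w; set X := increment A w.
pose h := X / tau; pose a := Re (B * z w) / v; pose b := Re (B1 * z (S w)) / v.
have hX : `|h| <= 2 * normc A / tau.
  by rewrite normrM normfV (gtr0_norm tau0) ler_pM2r ?invr_gt0// increment_bound.
have A2tau : 2 * normc A <= tau.
  rewrite -(@ler_pXn2r _ 2) ?nnegrE ?tau2//; last exact: ltW.
  by rewrite mulr_ge0 ?normc_ge0.
have h1 : `|h| <= 1 by apply: le_trans hX _; rewrite ler_pdivrMr ?mul1r.
have := @gauss_step_bound R (y (S w)) h r rho a b h1 rho0 r01 r2 rho1.
have -> : y (S w) - h = (x - s1 w) / tau.
  by rewrite /y /h /s1 -/X; field; rewrite gt_eqF.
have -> : y (S w) * r = (x - s (S w)) / Num.sqrt (v + vs).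
  by rewrite /y /r; field; rewrite !gt_eqF// sqrtr_gt0.
have -> : b * r ^+ 2 = Re (B1 * z (S w)) / (v + vs).
  by rewrite /b /r expr_div_n tau2 sqr_sqrtr ?(ltW vvs0)//; field; rewrite !gt_eqF.
have -> : - gauss_pdf (y (S w)) * h + gauss_pdf' (y (S w)) * (2^-1 * (h ^+ 2 - rho / 2) + a - b) = main w.
  rewrite /main /G1 /G2 -/X /h /a /b /rho expr_div_n tau2.
  move: (gauss_pdf _) (gauss_pdf' _) (Re _) (Re _) => *.
  by field; rewrite !gt_eqF.
move=> /le_trans; apply; rewrite ler_wpM2r ?(ltW (cauchy_weight_gt0 _))//.
have -> : K = step_const R * (8 * ((normc A ^+ 3 + normc B * normc A) / tau ^+ 3 +
    (vs ^+ 2 + normc B1 * vs) / v ^+ 2)) by rewrite /K; ring.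
rewrite ler_pM2l ?step_const_gt0//.
have nRe (c : R[i]) u : `|Re (c * z u)| / v <= normc c / v.
  rewrite ler_pM2r ?invr_gt0//; apply: le_trans (norm_Re_le _) _.
  by rewrite normcM normc_chain mulr1.
have ha : `|a| <= normc B / v by rewrite /a normrM normfV (gtr0_norm v0).
have hb : `|b| <= normc B1 / v by rewrite /b normrM normfV (gtr0_norm v0).
have k1 : `|h| ^+ 3 <= (2 * normc A / tau) ^+ 3.
  by rewrite lerXn2r ?nnegrE// divr_ge0 ?mulr_ge0 ?normc_ge0// ltW.
have k2 := ler_pM (normr_ge0 a) (normr_ge0 h) ha hX.
have k4 := ler_wpM2r rho0 hb.
have nA := normc_ge0 A; have nB := normc_ge0 B; have nB1 := normc_ge0 B1.
rewrite -tau2 in k2 k4 *.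
have E1 : (2 * normc A / tau) ^+ 3 = 8 * (normc A ^+ 3 / tau ^+ 3).
  by field; rewrite gt_eqF.
have E2 : normc B / tau ^+ 2 * (2 * normc A / tau) = 2 * (normc B * normc A / tau ^+ 3).
  by field; rewrite gt_eqF.
have E3 : rho ^+ 2 = vs ^+ 2 / (tau ^+ 2) ^+ 2 by rewrite /rho -tau2 expr_div_n.
have E4 : normc B1 / tau ^+ 2 * rho = normc B1 * vs / (tau ^+ 2) ^+ 2.
  by rewrite /rho -tau2; field; rewrite gt_eqF.
rewrite E1 in k1; rewrite E2 in k2; rewrite E4 in k4; rewrite E3 !mulrDl.
have t3 : 0 <= tau ^- 3 by rewrite invr_ge0 exprn_ge0// ltW.
have t4 : 0 <= ((tau ^+ 2) ^+ 2)^-1 by rewrite invr_ge0 ?sqr_ge0.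
have j2 : 0 <= normc B * normc A / tau ^+ 3 by rewrite mulr_ge0// mulr_ge0.
have j3 : 0 <= vs ^+ 2 / (tau ^+ 2) ^+ 2 by rewrite mulr_ge0 ?sqr_ge0.
have j4 : 0 <= normc B1 * vs / (tau ^+ 2) ^+ 2 by rewrite mulr_ge0// mulr_ge0.
lra.
Qed.

End chain.

(** * Smoothing and unsmoothing in the Kolmogorov distance *)

Section smoothing.
Context d (T : measurableType d) (R : realType) (P : probability T R)
  (t : T -> R) (bt : bounded_measurable t) (D : R)
  (tD : forall x : R,
    `|fine (P [set w | t w <= x]) - gauss_cdf x| <= D).
Local Notation E := (expect P).
Local Notation bm := bounded_measurable.
Local Notation q := cauchy_weight.

Lemma measurable_le_set (x : R) : measurable [set w | t w <= x].
Proof.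
have [mt _] := bt.
have -> : [set w | t w <= x] = [set: T] `&` t @^-1` `]-oo, x].
  by rewrite setTI; apply/seteqP; split => w /=; rewrite in_itv.
by apply: mt => //; exact: measurable_itv.
Qed.

Lemma bm_le (x : R) : bm (fun w => (t w <= x)%R%:R : R).
Proof.
have -> : (fun w => (t w <= x)%R%:R) = \1_[set w | t w <= x] :> (T -> R).
  by apply/funext => w; rewrite indicE; congr (nat_of_bool _)%:R; apply/idP/idP; rewrite inE.
exact: bounded_measurable_indic (measurable_le_set x).
Qed.

Lemma expect_le (x : R) : E (fun w => (t w <= x)%R%:R) = fine (P [set w | t w <= x]).
Proof.
rewrite -expect_indic; last exact: measurable_le_set.
apply: eq_expect => w; rewrite indicE; congr (nat_of_bool _)%:R.
by apply/idP/idP; rewrite inE.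
Qed.

Lemma bm_interval (x r : R) : bm (fun w => (`|t w - x| <= r)%R%:R : R).
Proof.
have [mt _] := bt.
have mA : measurable [set w | `|t w - x| <= r].
  have -> : [set w | `|t w - x| <= r] = [set: T] `&` t @^-1` `[x - r, x + r].
    by rewrite setTI; apply/seteqP; split => w /=; rewrite in_itv/= ler_distl.
  by apply: mt => //; exact: measurable_itv.
have -> : (fun w => (`|t w - x| <= r)%R%:R) = \1_[set w | `|t w - x| <= r] :> (T -> R).
  by apply/funext => w; rewrite indicE; congr (nat_of_bool _)%:R; apply/idP/idP; rewrite inE.
exact: bounded_measurable_indic.
Qed.

(** The closed interval sits inside []x - 2 r, x + r]], whose probability is a difference of two
    values of the distribution function; hence [3 r], the Gaussian distribution function having
    Lipschitz constant 1, and an error [D] at each end. *)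
Lemma expect_interval (x r : R) : 0 < r ->
  E (fun w => (`|t w - x| <= r)%R%:R) <= 3 * r + 2 * D.
Proof.
move=> r0.
have h : E (fun w => (`|t w - x| <= r)%R%:R) <=
    E (fun w => (t w <= x + r)%R%:R - (t w <= x - 2 * r)%R%:R).
  apply: le_expect; first exact: bm_interval.
    by apply: bounded_measurableB; exact: bm_le.
  move=> w; rewrite ler_distl.
  have [h1|h1] := leP (t w) (x - 2 * r).
    have -> : t w <= x + r by lra.
    by rewrite (_ : x - r <= t w = false) /= ?subrr//; apply/negbTE; rewrite -ltNge; lra.
  by case: (leP (x - r) (t w)); case: (leP (t w) (x + r)); rewrite /= ?subr0.
apply: le_trans h _; rewrite expectB; [|exact: bm_le|exact: bm_le].
rewrite !expect_le.
have := tD (x + r); have := tD (x - 2 * r); rewrite !ler_distl => /andP[? ?] /andP[? ?].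
have := gauss_cdf_lipschitz (x + r) (x - 2 * r).
rewrite (_ : x + r - (x - 2 * r) = 3 * r); last by ring.
rewrite ler_norml (@ger0_norm _ (3 * r)) ?mulr_ge0// ?(ltW r0)// => /andP[_ ?]; lra.
Qed.

(** Beyond [|y| = 2 ^ J] the weight is at most [4 ^ - J]. The decomposition reduces the mean of the
    weight to probabilities of intervals. *)
Lemma cauchy_weight_dyadic (y : R) (J : nat) :
  q y <= \sum_(j < J) 4 * 4 ^- j * (`|y| <= 2 ^+ j)%R%:R + 4 * 4 ^- J.
Proof.
elim: J => [|J IH].
  by rewrite big_ord0 add0r expr0 invr1 mulr1; have := cauchy_weight_le1 y; lra.
have p0 : 0 < 4 ^- J :> R by rewrite invr_gt0 exprn_gt0.
have s0 : 0 <= \sum_(j < J) 4 * 4 ^- j * (`|y| <= 2 ^+ j)%R%:R :> R.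
  by apply: sumr_ge0 => j _; rewrite mulr_ge0// mulr_ge0// invr_ge0 exprn_ge0.
rewrite big_ord_recr /= exprS invfM (mulrA 4) mulfV// mul1r.
have [yJ|yJ] := leP `|y| (2 ^+ J); first by rewrite mulr1; lra.
rewrite mulr0 addr0.
suff : q y <= 4 ^- J by lra.
rewrite /q lef_pV2 ?posrE ?exprn_gt0// ?ltr_wpDr ?sqr_ge0//.
rewrite -(real_normK (num_real y)) (_ : 4 = 2 ^+ 2); last by ring.
rewrite exprAC; have : (2 ^+ J) ^+ 2 <= `|y| ^+ 2 by rewrite lerXn2r ?nnegrE ?exprn_ge0// ltW.
lra.
Qed.

(** The source of the self-bounding: a weight living at scale [tau] has a mean of order [tau], up to
    the unknown distance [D]. The dyadic pieces contribute [12 tau 2 ^ - j + 8 D 4 ^ - j] and [J] is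
    taken so large that the tail is at most [tau], whence [25 = 24 + 1] and [16]. *)
Lemma expect_cauchy_weight (x tau : R) : 0 < tau ->
  E (fun w => q ((x - t w) / tau)) <= 25 * tau + 16 * D.
Proof.
move=> tau0.
have D0 : 0 <= D by apply: le_trans (tD 0).
have [J hJ] : exists J : nat, 4 * 4 ^- J <= tau.
  have [J hJ] : exists J : nat, 4 / tau <= J%:R.
    exists (Num.Def.archi_bound (4 / tau)).
    by apply/ltW/archi_boundP; rewrite divr_ge0// ltW.
  exists J; rewrite ler_pdivrMr ?exprn_gt0// mulrC -ler_pdivrMr//.
  apply: le_trans hJ _; elim: J => [|J IH]; first by rewrite expr0.
  rewrite exprS -natr1; have : 1 <= 4 ^+ J :> R by rewrite exprn_ege1 ?ler1n.
  lra.
have bI j : bm (fun w => 4 * 4 ^- j * (`|(x - t w) / tau| <= 2 ^+ j)%R%:R : R).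
  apply: bounded_measurableM; first exact: bounded_measurable_cst.
  have -> : (fun w => (`|(x - t w) / tau| <= 2 ^+ j)%R%:R) =
     (fun w => (`|t w - x| <= 2 ^+ j * tau)%R%:R) :> (T -> R).
    by apply/funext => w; rewrite normrM normfV (gtr0_norm tau0) ler_pdivrMr// distrC.
  exact: bm_interval.
have bS : bm (fun w => \sum_(j < J) 4 * 4 ^- j * (`|(x - t w) / tau| <= 2 ^+ j)%R%:R : R).
  exact: bounded_measurable_sum.
have bc : bm (fun _ : T => 4 * 4 ^- J : R) by exact: bounded_measurable_cst.
have h : E (fun w => q ((x - t w) / tau)) <=
   E (fun w => \sum_(j < J) 4 * 4 ^- j * (`|(x - t w) / tau| <= 2 ^+ j)%R%:R + 4 * 4 ^- J).
  apply: le_expect.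
  - by apply: bm_cauchy_weight; exact: bm_standardize.
  - exact: bounded_measurableD.
  - by move=> w; exact: cauchy_weight_dyadic.
apply: le_trans h _; rewrite expectD// expect_cst expect_sum//.
suff : \sum_(j < J) E (fun w => 4 * 4 ^- j * (`|(x - t w) / tau| <= 2 ^+ j)%R%:R) <=
    24 * tau + 16 * D by lra.
apply: (@le_trans _ _ (\sum_(j < J) (12 * tau * 2 ^- j + 8 * D * 2 ^- j))).
  apply: ler_sum => j _.
  have -> : (fun w => 4 * 4 ^- j * (`|(x - t w) / tau| <= 2 ^+ j)%R%:R) =
     (fun w => 4 * 4 ^- j * (`|t w - x| <= 2 ^+ j * tau)%R%:R) :> (T -> R).
    by apply/funext => w; rewrite normrM normfV (gtr0_norm tau0) ler_pdivrMr// distrC.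
  rewrite expectZ; last exact: bm_interval.
  have p2 : 0 < 2 ^+ j :> R by rewrite exprn_gt0.
  have := @expect_interval x (2 ^+ j * tau) (mulr_gt0 p2 tau0).
  have -> : 4 ^- j = 2 ^- j * 2 ^- j :> R.
    by rewrite -invfM -exprMn (_ : 4 = 2 * 2)//; ring.
  set p := 2 ^- j; have pp : p * 2 ^+ j = 1 by rewrite mulVf ?gt_eqF.
  have p0 : 0 < p by rewrite invr_gt0.
  have p1 : p <= 1 by rewrite invf_le1// exprn_ege1// ler1n.
  have pD : p * (p * D) <= p * D by rewrite ler_piMl// mulr_ge0// ltW.
  move=> /(ler_wpM2l (ltW (mulr_gt0 p0 p0))).
  have -> : p * p * (3 * (2 ^+ j * tau) + 2 * D) = 3 * p * tau * (p * 2 ^+ j) + 2 * (p * (p * D)) by ring.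
  rewrite pp mulr1; lra.
rewrite big_split/= -!mulr_sumr.
have hs : \sum_(j < J) 2 ^- j <= 2 :> R.
  suff : \sum_(j < J) 2 ^- j = 2 - 2 * 2 ^- J :> R.
    have : 0 < 2 ^- J :> R by rewrite invr_gt0 exprn_gt0.
    by move=> p0 ->; lra.
  elim: J {hJ bS bc} => [|J IH]; first by rewrite big_ord0 expr0 invr1; ring.
  by rewrite big_ord_recr/= IH exprS invfM; field; rewrite gt_eqF// exprn_gt0.
have := ler_wpM2l (ltW (mulr_gt0 (ltr0n R 12) tau0)) hs.
have D8 : 0 <= 8 * D by rewrite mulr_ge0.
have := ler_wpM2l D8 hs; lra.
Qed.

(** The Gaussian tail at distance [kappa + |y|] splits into [expR (- kappa)], small by the choice of
    [kappa], and [expR (- |y|)], at most [4 q y]: the error of the sandwich is both small and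
    localised. *)
Lemma gauss_cdf_indic_bounds (kappa y K : R) :
  K = 4 * expR 4^-1 * expR (- kappa) * q y ->
  gauss_cdf (y - kappa) - K <= (0 <= y)%R%:R <= gauss_cdf (y + kappa) + K.
Proof.
move=> KE; have q0 := cauchy_weight_gt0 y.
have K0 : 0 <= K by rewrite KE mulr_ge0 ?(ltW q0)// mulr_ge0 ?expR_ge0// mulr_ge0 ?expR_ge0.
have e4 (a : R) : 0 <= a -> expR (- a) <= 4 * cauchy_weight a.
  move=> a0; rewrite expRN /cauchy_weight -ler_pdivrMl// -invfM lef_pV2 ?posrE ?mulr_gt0 ?expR_gt0 ?ltr_wpDr ?sqr_ge0//.
  have h : (1 + a / 2) ^+ 2 <= expR a.
    rewrite (_ : expR a = expR (a / 2) ^+ 2); last first.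
      by rewrite -expRM_natl; congr expR; field.
    by rewrite lerXn2r ?nnegrE ?expR_ge0 ?expR_ge1Dx//; lra.
  by have := sqr_ge0 a; rewrite mulrC; nra.
have c0 := gauss_cdf_ge0 (y + kappa); have c1 := gauss_cdf_le1 (y - kappa).
have e40 := expR_ge0 (4^-1 : R); have ek := expR_ge0 (- kappa).
have [y0|y0] := leP 0 y; rewrite /=.
  apply/andP; split; first lra.
  have := gauss_cdf_tail (y + kappa); rewrite opprD expRD.
  have := ler_wpM2l (mulr_ge0 e40 ek) (e4 _ y0).
  rewrite KE; lra.
apply/andP; split; last lra.
have := @gauss_cdf_opp_tail R (kappa - y); rewrite opprB expRD.
have := ler_wpM2l (mulr_ge0 e40 ek) (e4 (- y) _).
rewrite opprK (_ : cauchy_weight (- y) = q y); last by rewrite /q sqrrN.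
rewrite KE => h; have {}h := h (ltac:(lra)); lra.
Qed.

(** The threshold [1 / 64] turns the mean [25 eps + 16 D] of the weight into at most [eps + D / 4].
    The shift of the argument by [kappa eps] costs as much again by the Lipschitz bound. *)
Lemma unsmoothing (eps eta kappa : R) : 0 < eps -> 0 <= kappa ->
  4 * expR 4^-1 * expR (- kappa) <= 64^-1 ->
  (forall x : R, `|E (fun w => gauss_cdf ((x - t w) / eps)) - gauss_cdf x| <= eta) ->
  forall x : R, `|fine (P [set w | t w <= x]) - gauss_cdf x| <=
    eta + (kappa * eps + eps) + 4^-1 * D.
Proof.
move=> eps0 kappa0 hk heta x; set c := 4 * _ * _ in hk *.
have c0 : 0 <= c by rewrite /c !mulr_ge0 ?expR_ge0.
have D0 : 0 <= D by apply: le_trans (tD 0).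
rewrite -expect_le.
have bq : bm (fun w => c * q ((x - t w) / eps)).
  apply: bounded_measurableM; first exact: bounded_measurable_cst.
  by apply: bm_cauchy_weight; exact: bm_standardize.
have bG u : bm (fun w => gauss_cdf ((u - t w) / eps)).
  by apply: bm_gauss_cdf; exact: bm_standardize.
have Eq : E (fun w => c * q ((x - t w) / eps)) <= eps + 4^-1 * D.
  rewrite expectZ; last by apply: bm_cauchy_weight; exact: bm_standardize.
  have := expect_cauchy_weight x eps0 => h.
  have h0 : 0 <= E (fun w => q ((x - t w) / eps)).
    by apply: expect_ge0 => w; exact/ltW/cauchy_weight_gt0.
  have := ler_pM c0 h0 hk h; lra.
have pt (w : T) : gauss_cdf ((x - kappa * eps - t w) / eps) - c * q ((x - t w) / eps) <=
    (t w <= x)%R%:R <= gauss_cdf ((x + kappa * eps - t w) / eps) + c * q ((x - t w) / eps).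
  have := gauss_cdf_indic_bounds (kappa := kappa) (y := (x - t w) / eps) (erefl _).
  rewrite -/c pmulr_lge0 ?invr_gt0// subr_ge0.
  have -> : (x - t w) / eps - kappa = (x - kappa * eps - t w) / eps.
    by field; rewrite gt_eqF.
  have -> : (x - t w) / eps + kappa = (x + kappa * eps - t w) / eps.
    by field; rewrite gt_eqF.
  by [].
have up : E (fun w => (t w <= x)%R%:R) <=
    E (fun w => gauss_cdf ((x + kappa * eps - t w) / eps)) + E (fun w => c * q ((x - t w) / eps)).
  rewrite -expectD//; apply: le_expect => //; first exact: bm_le.
    exact: bounded_measurableD.
  by move=> w; have /andP[] := pt w.
have lo : E (fun w => gauss_cdf ((x - kappa * eps - t w) / eps)) - E (fun w => c * q ((x - t w) / eps))
   <= E (fun w => (t w <= x)%R%:R).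
  rewrite -expectB//; apply: le_expect => //; last first.
  - by move=> w; have /andP[] := pt w.
  - exact: bm_le.
  - exact: bounded_measurableB.
have ke : 0 <= kappa * eps by rewrite mulr_ge0// ltW.
have := heta (x + kappa * eps); have := heta (x - kappa * eps).
move: up lo Eq; move: (E _) (E _) (E _) (E _) => e1 e2 e3 e4 up lo Eq.
have := gauss_cdf_lipschitz (x + kappa * eps) x.
have := gauss_cdf_lipschitz (x - kappa * eps) x.
rewrite (_ : x + kappa * eps - x = kappa * eps); last by ring.
rewrite (_ : x - kappa * eps - x = - (kappa * eps)); last by ring.
rewrite normrN (ger0_norm ke) !ler_norml.
move: (gauss_cdf _) (gauss_cdf _) (gauss_cdf _) => g1 g2 g3.
move: (kappa * eps) ke => ke ke0 /andP[? ?] /andP[? ?] /andP[? ?] /andP[? ?].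
apply/andP; split; lra.
Qed.

End smoothing.

(** * Elementary inequalities for the summation of errors *)

Section real_bounds.
Context (R : realType).
Implicit Types (e a psi v : nat -> R) (l : R).

(** [e] is the discounted sum of the later [a j]. Shifting its index only helps because [psi] is
    nondecreasing, so [S1 <= Se = Sa + l S1] and [S1 <= Sa / (1 - l)]: the correctors cost no more
    than a constant factor. *)
Lemma geometric_weights e a psi l N : 0 <= l < 1 ->
  (forall i, 0 <= e i) -> (forall i, 0 <= psi i) ->
  (forall i, psi i <= psi i.+1) -> e N = 0 ->
  (forall i, (i < N)%N -> e i = a i + l * e i.+1) ->
  \sum_(0 <= i < N) (a i + e i.+1 + e i) * psi i <=
    (1 + 2 / (1 - l)) * \sum_(0 <= i < N) a i * psi i.
Proof.
move=> /andP[l0 l1] e0 p0 pm eN eE.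
set Sa := \sum_(0 <= i < N) a i * psi i.
set Se := \sum_(0 <= i < N) e i * psi i.
set S1 := \sum_(0 <= i < N) e i.+1 * psi i.
have SeE : Se = Sa + l * S1.
  rewrite /Se /Sa /S1 mulr_sumr -big_split /= !big_mkord; apply: eq_bigr => i _.
  by rewrite eE//; ring.
have S1e : S1 <= Se.
  apply: (@le_trans _ _ (\sum_(0 <= i < N) e i.+1 * psi i.+1)).
    by apply: ler_sum => i _; rewrite ler_wpM2l.
  rewrite -(big_add1 _ _ 0 N.+1 predT (fun i => e i * psi i)) /=.
  have := @big_nat_recr _ 0 +%R N 0 (fun i => e i * psi i) (leq0n N).
  rewrite eN mul0r /= addr0 -/Se => <-.
  rewrite [leRHS]big_nat_recl// -(big_add1 _ _ 0 N.+1 predT (fun i => e i * psi i)) /=.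
  by rewrite lerDr mulr_ge0.
have S1b : S1 <= Sa / (1 - l).
  by rewrite ler_pdivlMr; lra.
have -> : \sum_(0 <= i < N) (a i + e i.+1 + e i) * psi i = Sa + S1 + Se.
  by rewrite -!big_split/=; apply: eq_bigr => i _; ring.
have : l * S1 <= l * (Sa / (1 - l)) by rewrite ler_wpM2l.
have -> : (1 + 2 / (1 - l)) * Sa = Sa + Sa / (1 - l) + (Sa + l * (Sa / (1 - l))).
  by field; rewrite gt_eqF//; lra.
lra.
Qed.

(** Together with [sqrt_increment], a discrete form of the integrals of [1 / v] and of
    [v ^ (- 3 / 2)], with telescoping right sides. The condition [w <= 2 * w'] allows the integrand
    to be taken at the smaller end. *)
Lemma ln_increment (w' w : R) : 0 < w' -> w' <= w -> w <= 2 * w' ->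
  (w - w') / w' <= 2 * (ln w - ln w').
Proof.
move=> w0 ww w2.
have w1 : 0 < w by lra.
have : ln w' - ln w <= w' / w - 1.
  rewrite -ln_div ?posrE// (_ : w' / w = 1 + (w' / w - 1)); last by ring.
  rewrite [X in _ <= X](_ : _ = w' / w - 1); last by ring.
  apply: le_ln1Dx; rewrite ltrBrDl subrr; exact: divr_gt0.
have -> : w' / w - 1 = - ((w - w') / w) by field; rewrite gt_eqF.
have : (w - w') / w' <= 2 * ((w - w') / w); last lra.
rewrite mulrCA ler_wpM2l ?subr_ge0// ler_pdivlMr// mulrC ler_pdivrMr//.
Qed.

Lemma sqrt_increment (w' w : R) : 0 < w' -> w' <= w -> w <= 2 * w' ->
  (w - w') / Num.sqrt w' ^+ 3 <= 6 * ((Num.sqrt w')^-1 - (Num.sqrt w)^-1).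
Proof.
move=> w0 ww w2; have w1 : 0 < w by lra.
set p := Num.sqrt w'; set r := Num.sqrt w.
have p0 : 0 < p by rewrite sqrtr_gt0.
have r0 : 0 < r by rewrite sqrtr_gt0.
have p2 : w' = p ^+ 2 by rewrite sqr_sqrtr// ltW.
have r2 : w = r ^+ 2 by rewrite sqr_sqrtr// ltW.
have pr : p <= r by rewrite ler_wsqrtr.
have r2p : r <= 2 * p.
  by rewrite -(@ler_pXn2r _ 2) ?nnegrE ?mulr_ge0// ?(ltW p0) ?(ltW r0)// exprMn -r2 -p2; lra.
have -> : 6 * (p^-1 - r^-1) = (r - p) * (6 / (p * r)) by field; rewrite !gt_eqF.
have -> : (w - w') / p ^+ 3 = (r - p) * ((r + p) / p ^+ 3).
  by rewrite p2 r2; field; rewrite gt_eqF.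
rewrite ler_wpM2l ?subr_ge0// ler_pdivlMr ?mulr_gt0// mulrAC ler_pdivrMr ?exprn_gt0//.
have -> : (r + p) * (p * r) = p * (r * (r + p)) by ring.
have -> : 6 * p ^+ 3 = p * (6 * p ^+ 2) by ring.
rewrite ler_wpM2l ?(ltW p0)//; nra.
Qed.

(** Brings all errors to the common denominator [tau ^ 3]: since [vs <= a ^ 2 <= M tau], the terms
    over [tau ^ 4] trade one power of [tau] for a factor [M]. *)
Lemma lindeberg_error (a b e b1 e1 vs M tau : R) : 0 <= a <= M -> M <= tau ->
  0 < tau -> 0 <= b <= e -> 0 <= b1 <= e1 -> 0 <= vs <= a ^+ 2 ->
  (a ^+ 3 + b * a) / tau ^+ 3 + (vs ^+ 2 + b1 * vs) / (tau ^+ 2) ^+ 2 <=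
    2 * M * (a ^+ 2 + e + e1) / tau ^+ 3.
Proof.
move=> /andP[a0 aM] Mt t0 /andP[b0 be] /andP[b10 be1] /andP[v0 va].
have M0 : 0 <= M by lra.
have -> : (vs ^+ 2 + b1 * vs) / (tau ^+ 2) ^+ 2 = (vs ^+ 2 + b1 * vs) / tau / tau ^+ 3.
  by field; rewrite gt_eqF.
rewrite -mulrDl ler_pM2r ?invr_gt0 ?exprn_gt0//.
have h1 : a ^+ 3 + b * a <= M * (a ^+ 2 + e).
  have : b * a <= e * M by rewrite ler_pM.
  have : a ^+ 2 * a <= a ^+ 2 * M by rewrite ler_wpM2l ?sqr_ge0.
  by rewrite -exprSr; lra.
have vM : vs <= M * tau by nra.
have h2 : (vs ^+ 2 + b1 * vs) / tau <= M * (a ^+ 2 + e1).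
  rewrite ler_pdivrMr//.
  have : (vs + b1) * vs <= (a ^+ 2 + e1) * (M * tau).
    by rewrite ler_pM// ?addr_ge0// lerD.
  by rewrite expr2; lra.
have : 0 <= M * e1 by rewrite mulr_ge0//; lra.
have : 0 <= M * e by rewrite mulr_ge0//; lra.
have : 0 <= M * a ^+ 2 by rewrite mulr_ge0 ?sqr_ge0.
lra.
Qed.

(** For [D] the least upper bound of [f], finite because [f <= 1], the hypothesis yields
    [D <= D / 2 + r]. *)
Lemma halving_bound (f : R -> R) (r : R) : (forall x, 0 <= f x <= 1) ->
  (forall D, (forall x, f x <= D) -> forall x, f x <= 2^-1 * D + r) ->
  forall x, f x <= 2 * r.
Proof.
move=> f01 fD.
have hs : has_sup (range f).
  split; first by exists (f 0); exists 0.
  by exists 1 => _ [y _ <-]; have /andP[] := f01 y.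
have ub y : f y <= sup (range f) by apply: (sup_upper_bound hs); exists y.
have : sup (range f) <= 2^-1 * sup (range f) + r.
  apply: ge_sup => //; first by exists (f 0); exists 0.
  by move=> _ [y _ <-]; exact: fD.
by move=> h x; have := ub x; lra.
Qed.

Lemma gauss_cdf_dilate (x s : R) : `|s - 1| <= 2^-1 ->
  `|gauss_cdf (x * s) - gauss_cdf x| <= 2 * gauss_const R * `|s - 1|.
Proof.
move=> s1.
have d (t : R) := is_derive_scale (is_derive_gauss_cdf (x * t)).
have := @mean_value_bound R _ _ 1 s (2 * gauss_const R) d.
rewrite mulr1; apply => t ts.
have t2 : 2^-1 <= t.
  by have := le_trans ts s1; rewrite ler_norml => /andP[? ?]; lra.
rewrite normrM (ger0_norm (gauss_pdf_ge0 _)).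
have xt : `|x| <= 2 * `|x * t|.
  by rewrite normrM (@ger0_norm _ t); have := normr_ge0 x; nra.
have := @gauss_moment_bound R (x * t) 1 isT; rewrite expr1.
have := cauchy_weight_le1 (x * t); have B0 := gauss_const_gt0 R.
have := ler_wpM2r (gauss_pdf_ge0 (x * t)) xt.
move=> h1 h2 h3; have := ler_wpM2l (ltW B0) h2; lra.
Qed.

Lemma exists_smoothing_constant :
  exists2 kappa : R, 0 <= kappa & 4 * expR 4^-1 * expR (- kappa) <= 64^-1.
Proof.
have e0 : 0 < 4 * expR 4^-1 :> R by rewrite mulr_gt0 ?expR_gt0.
exists (64 * (4 * expR 4^-1)); first by rewrite mulr_ge0// ltW.
move: (4 * expR 4^-1) e0 => c c0; rewrite expRN ler_pdivrMr ?expR_gt0//.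
have := expR_ge1Dx (64 * c); lra.
Qed.

End real_bounds.

(** * Berry-Esseen bound for the walk *)

Section chain_berry_esseen.
Context d (T : measurableType d) (R : realType) (P : probability T R)
  (S : T -> T) (z : T -> R[i]) (lam mu : R[i])
  (HC : contracting_chain P S z lam mu).
Local Notation Re := complex.Re.
Local Notation E := (expect P).
Local Notation bm := bounded_measurable.
Local Notation q := cauchy_weight.
Local Notation walk := (walk S z lam).
Local Notation var_incr := (var_incr lam).
Implicit Types (s : T -> R) (A : nat -> R[i]).

Lemma walk_add s A i k :
  walk (walk s A i) (fun j => A (i + j)%N) k = walk s A (i + k).
Proof.
elim: k => [|k IH]; first by rewrite addn0.
by apply/funext => w; rewrite addnS /= IH.
Qed.

(* Conditionally on the past, the remaining displacement has second moment of
   order [tau ^ 2], so it cannot lower the weight by more than a constant factor: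
   Peetre's inequality and the tangent line of [t |-> 1 / (1 + t)] at [C]. *)
Lemma expect_weight_walk s A k (x tau C : R) : bm s -> 0 < tau -> 0 <= C ->
  \sum_(j < k) normc (A j) ^+ 2 <= C * tau ^+ 2 ->
  E (fun w => q ((x - s w) / tau)) <=
    2 * (1 + C) * E (fun w => q ((x - walk s A k w) / tau)).
Proof.
move=> bs tau0 C0 hC.
pose Q w := q ((x - s w) / tau).
have bQ : bm Q by apply: bm_cauchy_weight; exact: bm_standardize.
have Q0 w : 0 <= Q w by exact/ltW/cauchy_weight_gt0.
have bW : bm (walk s A k) by exact: (bm_walk HC).
have bq' : bm (fun w => q ((x - walk s A k w) / tau)).
  by apply: bm_cauchy_weight; exact: bm_standardize.
have EQ : E (fun w => Q (iter k S w)) = E Q by exact: (expect_iter_S HC).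
have mi := measurable_iter_S HC k.
have bQi : bm (fun w => Q (iter k S w)) by exact: (bounded_measurable_precomp mi bQ).
have bd : bm (fun w => walk s A k w - s (iter k S w)).
  by apply: bounded_measurableB => //; exact: (bounded_measurable_precomp mi bs).
have bQd : bm (fun w => Q (iter k S w) * (walk s A k w - s (iter k S w)) ^+ 2).
  by apply: bounded_measurableM => //; exact: bounded_measurableX.
have c1 (c : R) : bm (fun _ : T => c) by exact: bounded_measurable_cst.
have b1 : bm (fun w => (1 + 2 * C) * Q (iter k S w)) by exact: bounded_measurableM.
have b2 : bm (fun w => tau ^- 2 * (Q (iter k S w) * (walk s A k w - s (iter k S w)) ^+ 2)).
  exact: bounded_measurableM.
have b3 : bm (fun w => 2 * (1 + C) ^+ 2 * q ((x - walk s A k w) / tau)).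
  exact: bounded_measurableM.
have pt w : (1 + 2 * C) * Q (iter k S w) -
    tau ^- 2 * (Q (iter k S w) * (walk s A k w - s (iter k S w)) ^+ 2) <=
    2 * (1 + C) ^+ 2 * q ((x - walk s A k w) / tau).
  set y := (x - walk s A k w) / tau; set y0 := (x - s (iter k S w)) / tau.
  set dd := walk s A k w - s (iter k S w).
  have hd : tau ^- 2 * dd ^+ 2 = (y - y0) ^+ 2.
    by rewrite /y /y0 /dd; field; rewrite gt_eqF.
  have := cauchy_weight_peetre y y0; rewrite /Q -/y0.
  rewrite (mulrCA (tau ^- 2)) hd; have := cauchy_weight_gt0 y; have := cauchy_weight_gt0 y0.
  move: (q y) (q y0) ((y - y0) ^+ 2) (sqr_ge0 (y - y0)) => u u0 D2 D20 u00 uu0 h.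
  have [a0|a0] := leP (1 + 2 * C - D2) 0.
    have : (1 + 2 * C - D2) * u0 <= 0 by rewrite mulr_le0_ge0// ltW.
    have : 0 <= 2 * (1 + C) ^+ 2 * u.
      by rewrite mulr_ge0 ?(ltW uu0)// mulr_ge0 ?sqr_ge0.
    lra.
  have := ler_wpM2l (ltW a0) h.
  have hh : (1 + 2 * C - D2) * (1 + D2) <= (1 + C) ^+ 2.
    by have := sqr_ge0 (C - D2); lra.
  have := ler_wpM2r (ltW uu0) hh; lra.
have := le_expect P (bounded_measurableB b1 b2) b3 pt.
rewrite expectB// !expectZ// EQ.
have := expect_walk_sqr HC A k bQ bs Q0.
have EQ0 : 0 <= E Q by exact: expect_ge0.
set V := E (fun w => _ * _ ^+ 2); set Eq := E (fun w => q _).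
move=> hV hh.
have t0 : 0 < tau ^- 2 by rewrite invr_gt0 exprn_gt0.
have hV2 : tau ^- 2 * V <= C * E Q.
  apply: le_trans (ler_wpM2l (ltW t0) hV) _.
  rewrite mulrCA mulrC ler_wpM2r// mulrC ler_pdivrMr ?exprn_gt0//.
have hf : (1 + C) * E Q <= (1 + C) * (2 * (1 + C) * Eq) by lra.
by rewrite -(@ler_pM2l _ (1 + C))//; lra.
Qed.

Section fixed_sum.
Context (c : R[i]) (A : nat -> R[i]) (N : nat) (M eps : R).
Hypothesis M0 : 0 < M.
Hypothesis cM : normc c <= M.
Hypothesis AM : forall i, (i < N)%N -> normc (A i) <= M.
Hypothesis total_var : normc c ^+ 2 + \sum_(0 <= i < N) var_incr (A i) = 1.
Hypothesis Meps : 2 * M <= eps.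
Hypothesis eps_half : eps <= 2^-1.

Let l := normc lam.
Let l0 : 0 <= l. Proof. exact: normc_ge0. Qed.
Let l1 : l < 1. Proof. exact: chain_lam HC. Qed.
Let eps0 : 0 < eps. Proof. by have := M0; have := Meps; lra. Qed.

Let s i := walk (fun w => Re (c * z w)) A i.
Let bs i : bm (s i). Proof. exact/(bm_walk HC)/(bm_Rez HC). Qed.

(** [v i] is the smoothing [eps ^+ 2] plus the variance of the increments still to be added, so that
    [s i] smoothed at level [v i] always has total variance [1 + eps ^+ 2] in the units of
    [var_incr]. [B] solves the corrector recursion backwards from [B N = 0], and [e] dominates its
    modulus. *)
Let v i : R := eps ^+ 2 + \sum_(i <= j < N) var_incr (A j).
Let B i : R[i] := \sum_(i <= j < N) lam ^+ (j - i) * (4^-1%:C%C * (A j ^+ 2 * mu)).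
Let e i : R := \sum_(i <= j < N) l ^+ (j - i) * normc (A j) ^+ 2.

Let eps2 : 0 < eps ^+ 2. Proof. by rewrite exprn_gt0. Qed.

Let v_ge i : eps ^+ 2 <= v i.
Proof. by rewrite lerDl sumr_ge0// => j _; exact: (var_incr_ge0 HC). Qed.

Let v_gt0 i : 0 < v i. Proof. exact: lt_le_trans (v_ge i). Qed.

Let vE i : (i < N)%N -> v i = v i.+1 + var_incr (A i).
Proof. by move=> iN; rewrite /v big_ltn//; ring. Qed.

Let v_mono i : v i.+1 <= v i.
Proof.
have [iN|Ni] := ltnP i N; first by rewrite (vE iN) lerDl (var_incr_ge0 HC).
by rewrite /v !big_geq// (leq_trans Ni).
Qed.

Let e_ge0 i : 0 <= e i.
Proof.
by apply: sumr_ge0 => j _; rewrite mulr_ge0 ?exprn_ge0 ?normc_ge0//.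
Qed.

Let eE i : (i < N)%N -> e i = normc (A i) ^+ 2 + l * e i.+1.
Proof.
move=> iN; rewrite /e big_ltn// subnn expr0 mul1r mulr_sumr; congr (_ + _).
rewrite big_nat_cond [RHS]big_nat_cond; apply: eq_bigr => j /andP[/andP[ij _] _].
by rewrite mulrA -exprS subnSK.
Qed.

Let BE i : (i < N)%N -> B i = lam * B i.+1 + 4^-1%:C%C * (A i ^+ 2 * mu).
Proof.
move=> iN; rewrite /B big_ltn// subnn expr0 mul1r addrC mulr_sumr; congr (_ + _).
rewrite big_nat_cond [RHS]big_nat_cond; apply: eq_bigr => j /andP[/andP[ij _] _].
by rewrite [RHS]mulrA -exprS subnSK.
Qed.

Let normc4 (x : R[i]) : normc (4^-1%:C%C * x) <= normc x.
Proof.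
rewrite normcM (_ : normc 4^-1%:C%C = 4^-1); last first.
  by rewrite /normc /= expr0n addr0 sqrtr_sqr ger0_norm.
by have := normc_ge0 x; lra.
Qed.

Let B_le i : normc (B i) <= e i.
Proof.
have [Ni|iN] := leqP N i; first by rewrite /B /e !big_geq// normc0.
rewrite /B /e; elim/big_ind2: _ => [|x1 x2 y1 y2 h1 h2|j _].
- by rewrite normc0.
- by apply: le_trans (le_normcD _ _) _; exact: lerD.
rewrite normcM normcX ler_wpM2l ?exprn_ge0//; apply: le_trans (normc4 _) _.
by rewrite normcM normcX ler_piMr ?exprn_ge0 ?normc_ge0// (chain_mu HC).
Qed.

Let ratio0 : 0 < 1 - l ^+ 2.
Proof. by rewrite subr_gt0 expr_lt1. Qed.

Let A2E i : normc (A i) ^+ 2 = (1 - l ^+ 2)^-1 * var_incr (A i).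
Proof. by rewrite /var_incr mulrA mulVf ?mul1r// gt_eqF. Qed.

Let var_le i : (i < N)%N -> var_incr (A i) <= v i.+1.
Proof.
move=> iN; apply: le_trans (v_ge _); apply: le_trans (var_incr_le _ _) _.
rewrite lerXn2r ?nnegrE ?normc_ge0 ?(ltW eps0)//.
by have := AM iN; have := M0; have := Meps; lra.
Qed.

(** Exchanges the intermediate sum for the final one, the only one whose distance to the Gaussian
    law is bounded by [D]. The moduli of the increments to come have square sum at most
    [v i / (1 - l ^ 2)], and [v i <= 2 v i.+1]: hence the constant. *)
Let walk_weight (x : R) i : (i < N)%N ->
  E (fun w => q ((x - s i w) / Num.sqrt (v i.+1))) <=
  2 * (1 + 2 / (1 - l ^+ 2)) * E (fun w => q ((x - s N w) / Num.sqrt (v i.+1))).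
Proof.
move=> iN.
have -> : s N = walk (s i) (fun j => A (i + j)%N) (N - i) by rewrite walk_add subnKC// ltnW.
apply: expect_weight_walk => //; first by rewrite sqrtr_gt0.
  by rewrite divr_ge0// ltW.
rewrite sqr_sqrtr ?(ltW (v_gt0 _))//.
have -> : \sum_(j < N - i) normc (A (i + j)%N) ^+ 2 =
   (1 - l ^+ 2)^-1 * \sum_(i <= j < N) var_incr (A j).
  rewrite -(big_mkord predT (fun j => normc (A (i + j)%N) ^+ 2)) -[in RHS](add0n i) big_addn mulr_sumr.
  by apply: eq_bigr => j _; rewrite A2E addnC.
rewrite mulrAC mulrC ler_pM2r ?invr_gt0//.
have : \sum_(i <= j < N) var_incr (A j) <= v i by rewrite lerDr ltW.
by have := vE iN; have := var_le iN; lra.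
Qed.

(** The last factor is [(25 tau + 16 D) / tau ^ 3] with [tau ^ 2 = v i.+1]: localisation gains the
    power of [tau] that leaves only [1 / v], up to [D]. The factor [32 = 8 * 2 * 2] collects those
    of [lindeberg_step], [lindeberg_error] and [walk_weight]. *)
Let step (x D : R) i : (i < N)%N ->
  (forall y, `|fine (P [set w | s N w <= y]) - gauss_cdf y| <= D) ->
  `|E (smoothed z x (v i.+1) (B i.+1) (s i.+1)) - E (smoothed z x (v i) (B i) (s i))| <=
  32 * step_const R * (1 + 2 / (1 - l ^+ 2)) * M *
   ((normc (A i) ^+ 2 + e i.+1 + e i) *
     (25 / v i.+1 + 16 * D / Num.sqrt (v i.+1) ^+ 3)).
Proof.
move=> iN sD.
have epsE : eps <= Num.sqrt (v i.+1).
  by rewrite -[leLHS](@ger0_norm _ eps) ?(ltW eps0)// -sqrtr_sqr ler_wsqrtr.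
have sq0 : 0 < Num.sqrt (v i.+1) by rewrite sqrtr_gt0.
have Av : (2 * normc (A i)) ^+ 2 <= v i.+1.
  apply: le_trans (v_ge _); rewrite lerXn2r ?nnegrE ?(ltW eps0) ?mulr_ge0 ?normc_ge0//.
  by have := AM iN; have := Meps; lra.
have := lindeberg_step HC x (v_gt0 i.+1) (bs i) (var_le iN) Av (BE iN).
rewrite -vE// => /le_trans; apply.
have sqE : Num.sqrt (v i.+1) ^+ 2 = v i.+1 by rewrite sqr_sqrtr// ltW.
have hW := walk_weight x iN.
have hC := @expect_cauchy_weight _ _ _ P (s N) (bs N) D sD x _ sq0.
set tau := Num.sqrt (v i.+1) in epsE sq0 sqE hW hC *.
have c2 : 0 <= 2 * (1 + 2 / (1 - l ^+ 2)).
  by rewrite mulr_ge0// addr_ge0// divr_ge0// ltW.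
have {hC}hW := le_trans hW (ler_wpM2l c2 hC).
have hE : (normc (A i) ^+ 3 + normc (B i.+1) * normc (A i)) / tau ^+ 3 +
    (var_incr (A i) ^+ 2 + normc (B i) * var_incr (A i)) / v i.+1 ^+ 2 <=
    2 * M * (normc (A i) ^+ 2 + e i.+1 + e i) / tau ^+ 3.
  rewrite -sqE; apply: lindeberg_error => //.
  - by rewrite normc_ge0 AM.
  - by have := M0; have := Meps; lra.
  - by rewrite normc_ge0 B_le.
  - by rewrite normc_ge0 B_le.
  - by rewrite (var_incr_ge0 HC) var_incr_le.
have E0 : 0 <= E (fun w => q ((x - s i w) / tau)).
  by apply: expect_ge0 => w; exact/ltW/cauchy_weight_gt0.
have n0 : 0 <= (normc (A i) ^+ 3 + normc (B i.+1) * normc (A i)) / tau ^+ 3 +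
    (var_incr (A i) ^+ 2 + normc (B i) * var_incr (A i)) / v i.+1 ^+ 2.
  have nA := normc_ge0 (A i); have nB := normc_ge0 (B i.+1); have nB' := normc_ge0 (B i).
  have va := var_incr_ge0 HC (A i); have t3 := exprn_ge0 3 (ltW sq0).
  have v2 := exprn_ge0 2 (ltW (v_gt0 i.+1)).
  apply: addr_ge0; apply: divr_ge0 => //; apply: addr_ge0; rewrite ?exprn_ge0//; exact: mulr_ge0.
rewrite -mulrA; apply: le_trans (ler_wpM2l _ (ler_pM n0 E0 hE hW)) _.
  by rewrite mulr_ge0// ltW// step_const_gt0.
rewrite -sqE le_eqVlt; apply/orP; left; apply/eqP.
by field; rewrite !gt_eqF.
Qed.

Let e_le k : (k <= N)%N -> e (N - k)%N <= M ^+ 2 / (1 - l).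
Proof.
have l10 : 0 < 1 - l by rewrite subr_gt0.
elim: k => [_|k IH kN].
  by rewrite subn0 /e big_geq// divr_ge0 ?sqr_ge0// ltW.
have kN' : (N - k.+1 < N)%N by rewrite ltn_subrL/= (leq_trans _ kN).
rewrite eE// subnSK//; have {}IH := ler_wpM2l l0 (IH (ltnW kN)).
have : normc (A (N - k.+1)%N) ^+ 2 <= M ^+ 2.
  by rewrite lerXn2r ?nnegrE ?normc_ge0 ?(ltW M0) ?AM.
have -> : M ^+ 2 / (1 - l) = M ^+ 2 + l * (M ^+ 2 / (1 - l)).
  by field; rewrite gt_eqF.
lra.
Qed.

(** [v 0 = 1 + eps ^ 2 - normc c ^ 2] is within [eps / 2] of 1, the variable [Re (c z)] is at most
    [M], and the coefficient of the corrector is at most [M ^ 2 / (1 - l)]: three perturbations of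
    [gauss_cdf x], each [O(eps)]. *)
Let initial_error (x : R) :
  `|E (smoothed z x (v 0) (B 0) (s 0)) - gauss_cdf x| <=
    (1 + 2 * gauss_const R + 4 * gauss_const R / (1 - l)) * eps.
Proof.
have l10 : 0 < 1 - l by rewrite subr_gt0.
have G0 := gauss_const_gt0 R.
have M0' := M0; have Meps' := Meps; have eps_half' := eps_half.
have c0 := normc_ge0 c; have cM' := cM.
have v0E : v 0%N = eps ^+ 2 + (1 - normc c ^+ 2).
  by rewrite /v -total_var; ring.
have c2 : normc c ^+ 2 <= eps ^+ 2 by rewrite lerXn2r ?nnegrE//; lra.
have e2 : eps ^+ 2 <= 2^-1 * eps by rewrite expr2 ler_wpM2r// ltW.
have c20 := sqr_ge0 (normc c).
have v0h : 2^-1 <= v 0%N by rewrite v0E; lra.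
have v1 : `|v 0%N - 1| <= 2^-1 * eps by rewrite v0E ler_norml; lra.
set r := Num.sqrt (v 0%N).
have r0 : 0 < r by rewrite sqrtr_gt0.
have r2 : r ^+ 2 = v 0%N by rewrite sqr_sqrtr// ltW.
have rh : 2^-1 <= r by nra.
have s1 : `|r^-1 - 1| <= `|v 0%N - 1|.
  have -> : r^-1 - 1 = (1 - v 0%N) / (r * (1 + r)).
    by rewrite -r2; field; rewrite !gt_eqF//; lra.
  have rr : 1 <= r * (1 + r) by nra.
  rewrite normrM normfV (@ger0_norm _ (r * (1 + r))) ?(le_trans ler01)// distrC.
  rewrite ler_pdivrMr; last by lra.
  by rewrite ler_peMr.
have s12 : `|r^-1 - 1| <= 2^-1 by apply: le_trans s1 _; lra.
have eb : e 0%N <= M ^+ 2 / (1 - l) by have := e_le (leqnn N); rewrite subnn.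
have c1 (k : R) : bm (fun _ : T => k) by exact: bounded_measurable_cst.
have bsm : bm (smoothed z x (v 0) (B 0) (s 0)) by exact: (bm_smoothed HC).
rewrite -[X in `|_ - X|](expect_cst P) -expectB// -[leRHS](expect_cst P).
apply: expect_norm_le => //; first exact: bounded_measurableB.
move=> w; rewrite /smoothed -/r /s /=.
set t := Re (c * z w); set b := Re (B 0%N * z w).
have ht : `|t| <= M.
  by apply: le_trans (norm_Re_le _) _; rewrite normcM (normc_chain HC) mulr1.
have hb : `|b| <= e 0%N.
  by apply: le_trans (norm_Re_le _) _; rewrite normcM (normc_chain HC) mulr1 B_le.
have h1 := gauss_cdf_lipschitz ((x - t) / r) (x * r^-1).
have h2 := gauss_cdf_dilate x s12.
have h3 := gauss_pdf'_bound ((x - t) / r).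
have q1 := cauchy_weight_le1 ((x - t) / r).
rewrite (_ : _ - _ = (gauss_cdf ((x - t) / r) - gauss_cdf (x * r^-1)) +
  (gauss_cdf (x * r^-1) - gauss_cdf x) + b / v 0%N * gauss_pdf' ((x - t) / r)); last by ring.
apply: le_trans (ler_normD _ _) _; apply: le_trans (lerD (ler_normD _ _) (lexx _)) _.
have k1 : `|gauss_cdf ((x - t) / r) - gauss_cdf (x * r^-1)| <= eps.
  apply: le_trans h1 _; rewrite -mulrBl (_ : x - t - x = - t); last by ring.
  rewrite normrM normrN normfV (gtr0_norm r0) ler_pdivrMr//.
  by apply: le_trans ht _; nra.
have k2 : `|gauss_cdf (x * r^-1) - gauss_cdf x| <= 2 * gauss_const R * eps.
  by apply: le_trans h2 _; rewrite ler_wpM2l ?mulr_ge0 ?(ltW G0)//; have := eps0; lra.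
have k3 : `|b / v 0%N * gauss_pdf' ((x - t) / r)| <= 4 * gauss_const R / (1 - l) * eps.
  rewrite normrM normrM normfV (gtr0_norm (v_gt0 _)).
  have p1 : `|gauss_pdf' ((x - t) / r)| <= 2 * gauss_const R.
    by apply: le_trans h3 _; rewrite ler_piMr// mulr_ge0// ltW.
  have p2 : `|b| / v 0%N <= 2 * (eps / (1 - l)).
    rewrite ler_pdivrMr//; apply: le_trans hb _; apply: le_trans eb _.
    have : M ^+ 2 / (1 - l) <= eps / (1 - l) by rewrite ler_pM2r ?invr_gt0//; nra.
    have : 0 <= eps / (1 - l) by rewrite divr_ge0// ltW.
    nra.
  apply: le_trans (ler_pM _ (normr_ge0 _) p2 p1) _; first by rewrite divr_ge0// ltW.
  by rewrite le_eqVlt; apply/orP; left; apply/eqP; ring.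
have -> : (1 + 2 * gauss_const R + 4 * gauss_const R / (1 - l)) * eps =
  eps + 2 * gauss_const R * eps + 4 * gauss_const R / (1 - l) * eps by ring.
by apply: lerD k3; exact: lerD.
Qed.

Lemma smoothed_error (x D : R) :
  (forall y, `|fine (P [set w | s N w <= y]) - gauss_cdf y| <= D) ->
  `|E (fun w => gauss_cdf ((x - s N w) / eps)) - gauss_cdf x| <=
  (1 + 2 * gauss_const R + 4 * gauss_const R / (1 - l)) * eps +
  32 * step_const R * (1 + 2 / (1 - l ^+ 2)) * M *
   ((1 + 2 / (1 - l)) * ((1 - l ^+ 2)^-1 *
     (100 * ln (1 + M^-1) + 96 * D / eps))).
Proof.
move=> sD.
have D0 : 0 <= D by apply: le_trans (sD 0).
set K := 32 * _ * _ * M.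
have tel : `|E (smoothed z x (v N) (B N) (s N)) - E (smoothed z x (v 0) (B 0) (s 0))| <=
   K * \sum_(0 <= i < N) ((normc (A i) ^+ 2 + e i.+1 + e i) *
     (25 / v i.+1 + 16 * D / Num.sqrt (v i.+1) ^+ 3)).
  rewrite -(telescope_sumr (fun i => E (smoothed z x (v i) (B i) (s i))))//.
  apply: le_trans (ler_norm_sum _ _ _) _; rewrite mulr_sumr.
  by rewrite !big_mkord; apply: ler_sum => i _; exact: step.
have K0 : 0 <= K.
  apply: mulr_ge0; last exact: ltW.
  apply: mulr_ge0; last by rewrite addr_ge0// divr_ge0// ltW.
  by apply: mulr_ge0 => //; exact/ltW/step_const_gt0.
have psi0 i : 0 <= 25 / v i.+1 + 16 * D / Num.sqrt (v i.+1) ^+ 3.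
  by rewrite addr_ge0// divr_ge0 ?mulr_ge0 ?exprn_ge0 ?sqrtr_ge0// ltW.
have psim i : 25 / v i.+1 + 16 * D / Num.sqrt (v i.+1) ^+ 3 <=
    25 / v i.+2 + 16 * D / Num.sqrt (v i.+2) ^+ 3.
  apply: lerD; rewrite ler_wpM2l ?mulr_ge0// lef_pV2 ?posrE ?exprn_gt0 ?sqrtr_gt0//.
  by rewrite lerXn2r ?nnegrE ?sqrtr_ge0// ler_wsqrtr.
have eN : e N = 0 by rewrite /e big_geq.
have l01 : 0 <= l < 1 by rewrite l0 l1.
have := geometric_weights l01 e_ge0 psi0 psim eN (fun i => eE (i := i)).
set SA := \sum_(0 <= i < N) normc (A i) ^+ 2 * _ => hG.
(* The two discrete integrals, with [50 = 25 * 2] and [96 = 16 * 6]. *)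
have hSA : SA <= (1 - l ^+ 2)^-1 * (50 * (ln (v 0) - ln (v N)) +
     96 * D * ((Num.sqrt (v N))^-1 - (Num.sqrt (v 0))^-1)).
  have -> : 50 * (ln (v 0) - ln (v N)) +
     96 * D * ((Num.sqrt (v N))^-1 - (Num.sqrt (v 0))^-1) =
     \sum_(0 <= i < N) (50 * (ln (v i) - ln (v i.+1)) +
       96 * D * ((Num.sqrt (v i.+1))^-1 - (Num.sqrt (v i))^-1)).
    rewrite big_split/= -!mulr_sumr (telescope_sumr (fun i => (Num.sqrt (v i))^-1))//.
    congr (50 * _ + _); rewrite -[LHS]opprB -(telescope_sumr (fun i => ln (v i)))// -sumrN.
    by apply: eq_bigr => i _; rewrite opprB.
  rewrite /SA mulr_sumr !big_mkord; apply: ler_sum => i _.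
  rewrite A2E -(mulrA ((1 - l ^+ 2)^-1)); apply: ler_wpM2l.
    by rewrite invr_ge0 ltW.
  have iN := ltn_ord i; have hv := vE iN; have hv2 := var_le iN; have v1 := v_gt0 i.+1.
  have vv : v i.+1 <= v i by exact: v_mono.
  have v2 : v i <= 2 * v i.+1 by lra.
  have := ln_increment v1 vv v2; have := sqrt_increment v1 vv v2.
  have -> : var_incr (A i) = v i - v i.+1 by rewrite hv; ring.
  move=> /(ler_wpM2l (mulr_ge0 (ler0n R 16) D0)).
  set a := _ / Num.sqrt _ ^+ 3; set b := (v i - v i.+1) / v i.+1 => h1 h2.
  have -> : (v i - v i.+1) * (25 / v i.+1 + 16 * D / Num.sqrt (v i.+1) ^+ 3) =
      25 * b + 16 * D * a by rewrite /a /b mulrDr; congr (_ + _); rewrite mulrCA.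
  lra.
have {}hSA : SA <= (1 - l ^+ 2)^-1 * (100 * ln (1 + M^-1) + 96 * D / eps).
  apply: le_trans hSA _; rewrite ler_wpM2l ?invr_ge0 ?(ltW ratio0)//.
  have vN : v N = eps ^+ 2 by rewrite /v big_geq// addr0.
  have v0E : v 0%N = eps ^+ 2 + (1 - normc c ^+ 2).
    by rewrite /v -total_var; ring.
  have Mi0 : 0 < M^-1 by rewrite invr_gt0.
  apply: lerD; last first.
    rewrite vN sqrtr_sqr (ger0_norm (ltW eps0)); apply: ler_wpM2l; first by rewrite mulr_ge0.
    by rewrite gerBl invr_ge0 sqrtr_ge0.
  (* [v 0 <= 2] and [v N = eps ^ 2], while [eps / M >= 2]; hence [v 0 / v N <= (1 + 1 / M) ^ 2], and
     the square accounts for [100 = 2 * 50]. *)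
  have -> : 100 * ln (1 + M^-1) = 50 * (ln (1 + M^-1) + ln (1 + M^-1)) by lra.
  rewrite ler_wpM2l// -lnM ?posrE ?addr_gt0// -ln_div ?posrE//.
  have p1 : 0 < v 0%N / v N by rewrite divr_gt0.
  have p2 : 0 < (1 + M^-1) * (1 + M^-1) by rewrite mulr_gt0// addr_gt0.
  rewrite ler_ln ?posrE// vN ler_pdivrMr//.
  have hM : M^-1 * eps >= 2 by rewrite mulrC ler_pdivlMr.
  have e14 : eps ^+ 2 <= 4^-1 by have := eps_half; have := eps0; nra.
  have : v 0%N <= 2 by rewrite v0E; have := sqr_ge0 (normc c); lra.
  have -> : (1 + M^-1) * (1 + M^-1) * eps ^+ 2 = (eps + M^-1 * eps) ^+ 2 by ring.
  have := eps0; nra.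
have final0 : `|E (smoothed z x (v 0) (B 0) (s 0)) - gauss_cdf x| <=
    (1 + 2 * gauss_const R + 4 * gauss_const R / (1 - l)) * eps.
  exact: initial_error.
have -> : (fun w => gauss_cdf ((x - s N w) / eps)) = smoothed z x (v N) (B N) (s N).
  apply/funext => w; rewrite /smoothed /v /B !big_geq// addr0 sqrtr_sqr.
  by rewrite (ger0_norm (ltW eps0)) mul0r /= mul0r mul0r addr0.
have b := ler_wpM2l K0 (le_trans hG (ler_wpM2l _ hSA)).
have {}b := b (ltac:(by rewrite addr_ge0// divr_ge0// subr_ge0 ltW)).
apply: le_trans (ler_distD (E (smoothed z x (v 0) (B 0) (s 0))) _ _) _.
rewrite addrC; apply: lerD => //.
exact: le_trans tel b.
Qed.

End fixed_sum.

Theorem chain_berry_esseen : exists2 K : R, 0 < K &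
  forall (c : R[i]) (A : nat -> R[i]) (N : nat) (M : R), 0 < M -> normc c <= M ->
    (forall i, (i < N)%N -> normc (A i) <= M) ->
    normc c ^+ 2 + \sum_(0 <= i < N) var_incr (A i) = 1 ->
    forall x : R,
    `|fine (P [set w | walk (fun w => Re (c * z w)) A N w <= x]) - gauss_cdf x| <=
      K * (M * (1 + ln (1 + M^-1))).
Proof.
have [kappa kappa0 hkappa] := exists_smoothing_constant R.
have l0 := normc_ge0 lam; have l1 := chain_lam HC.
pose l := normc lam; rewrite -/l in l0 l1.
have l10 : 0 < 1 - l by rewrite subr_gt0.
have l20 : 0 < 1 - l ^+ 2 by rewrite subr_gt0 expr_lt1.
have G0 := gauss_const_gt0 R.
have [K1 K1E] : exists K1, K1 = 1 + 2 * gauss_const R + 4 * gauss_const R / (1 - l).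
  by eexists.
have [K2 K2E] : exists K2, K2 =
    32 * step_const R * (1 + 2 / (1 - l ^+ 2)) * (1 + 2 / (1 - l)) / (1 - l ^+ 2).
  by eexists.
have K10 : 0 < K1.
  by rewrite K1E addr_gt0// ?divr_gt0 ?mulr_gt0// addr_gt0// mulr_gt0.
have K20 : 0 < K2.
  have h1 : 0 < 1 + 2 / (1 - l) by rewrite addr_gt0// divr_gt0.
  have h2 : 0 < 1 + 2 / (1 - l ^+ 2) by rewrite addr_gt0// divr_gt0.
  rewrite K2E; apply: divr_gt0 => //; apply: mulr_gt0 => //; apply: mulr_gt0 => //.
  by apply: mulr_gt0 => //; exact: step_const_gt0.
(* The smoothing scale will be [eps = K3 M]. As [384 = 4 * 96], the coefficient [96 K2 / K3] of [D]
   is at most [1 / 4]; with the [1 / 4] of [unsmoothing] this makes [1 / 2]. *)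
have [K3 K3E] : exists K3, K3 = 2 + 384 * K2 by eexists.
have K30 : 2 < K3 by rewrite K3E; lra.
have [K4 K4E] : exists K4, K4 = (K1 + kappa + 1) * K3 by eexists.
have K40 : 0 < K4 by rewrite K4E mulr_gt0//; lra.
exists (2 * (K4 + 100 * K2) + 2 * K3) => [|c A N M M0 cM AM tv x].
  by have := mulr_gt0 (ltr0n R 100) K20; lra.
have L0 : 0 <= ln (1 + M^-1) by rewrite ln_ge0// lerDl invr_ge0 ltW.
set L := ln _ in L0 *.
set s := walk _ _ _; pose f (y : R) : R := `|fine (P [set w | s w <= y]) - gauss_cdf y|.
have bs : bm s by exact/(bm_walk HC)/(bm_Rez HC).
have f01 y : 0 <= f y <= 1.
  rewrite normr_ge0 /=.
  have h0 := gauss_cdf_ge0 y; have h1 := gauss_cdf_le1 y.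
  have p0 : 0 <= fine (P [set w | s w <= y]) by rewrite fine_ge0.
  have p1 : fine (P [set w | s w <= y]) <= 1.
    have mA := measurable_le_set bs y.
    by rewrite -lee_fin fineK ?fin_num_measure// probability_le1.
  rewrite ler_norml; lra.
rewrite -/(f x).
have ML0 : 0 <= M * L by rewrite mulr_ge0// ltW.
(* If [K3 M > 1 / 2], the trivial bound 1 for the distance is already below [2 K3 M]. *)
have [eh|eh] := leP (K3 * M) 2^-1; last first.
  have /andP[_ fx1] := f01 x; apply: le_trans fx1 _.
  have a1 : 0 <= (K4 + 100 * K2) * (M * (1 + L)).
    rewrite mulr_ge0//; first by have := mulr_gt0 (ltr0n R 100) K20; lra.
    by rewrite mulr_ge0 ?(ltW M0)// addr_ge0.
  have a2 : 0 <= K3 * (M * L) by rewrite mulr_ge0//; lra.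
  lra.
have eps0 : 0 < K3 * M by rewrite mulr_gt0//; lra.
have Meps : 2 * M <= K3 * M by rewrite ler_pM2r// ltW.
(* Bolthausen's argument: the smoothing error is at most half of a uniform
   bound [D] of the distance, plus terms of the claimed order. *)
have main (D : R) : (forall y, f y <= D) -> forall y, f y <= 2^-1 * D + (K4 * M + 100 * K2 * (M * L)).
  move=> fD y.
  have D0 : 0 <= D by have /andP[f0 _] := f01 0; exact: le_trans f0 (fD 0).
  have eta := fun x => smoothed_error M0 cM AM tv Meps eh x fD.
  have := unsmoothing bs fD eps0 kappa0 hkappa eta y.
  rewrite -/(f y) => /le_trans; apply.
  rewrite -/l -K1E -/L.
  have -> : 32 * step_const R * (1 + 2 / (1 - l ^+ 2)) * M *
   ((1 + 2 / (1 - l)) * ((1 - l ^+ 2)^-1 * (100 * L + 96 * D / (K3 * M)))) =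
    100 * K2 * (M * L) + 96 * K2 * D / K3.
    by rewrite K2E; field; rewrite !gt_eqF//; lra.
  have hK : 96 * K2 * D / K3 <= 4^-1 * D.
    rewrite ler_pdivrMr; last lra.
    have : 0 <= K2 * D by rewrite mulr_ge0// ltW.
    by rewrite K3E; lra.
  rewrite K4E; lra.
have := halving_bound f01 main x.
have a1 : 0 <= K4 * (M * L) by rewrite mulr_ge0// ltW.
have a2 : 0 <= K2 * M by rewrite mulr_ge0// ltW.
have a3 : 0 <= K3 * M by rewrite ltW.
have a4 : 0 <= K3 * (M * L) by rewrite mulr_ge0//; lra.
lra.
Qed.

End chain_berry_esseen.

(** * Goursat's theorem and circle means *)

Section segment_integral.
Context (R : realType).
Implicit Types f : R -> R.
Local Notation mu := lebesgue_measure.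

Definition segment_integral f (a b : R) : R := \int[mu]_(x in `[a, b]) f x.

Definition continuous_on_segment f (a b : R) :=
  forall x, a <= x <= b -> {for x, continuous f}.

Lemma segment_integrable f a b : continuous_on_segment f a b ->
  mu.-integrable `[a, b] (EFin \o f).
Proof.
move=> cf; apply: continuous_compact_integrable; first exact: segment_compact.
apply: continuous_in_subspaceT => x; rewrite inE/= in_itv/= => xab.
exact: cf.
Qed.

Lemma segment_integral_cat f a m b : a <= m -> m <= b ->
  continuous_on_segment f a b ->
  segment_integral f a b = segment_integral f a m + segment_integral f m b.
Proof.
move=> am mb cf.
have cf2 : continuous_on_segment f m b.
  by move=> x /andP[mx xb]; apply: cf; rewrite xb (le_trans am).
have := @Rintegral_itvB R f (BLeft a) (BRight b) m (segment_integrable cf).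
rewrite !bnd_simp => /(_ am mb); rewrite /segment_integral.
rewrite (Rintegral_itv_obnd_cbnd (r := m)); last first.
  apply: integrableS (segment_integrable cf2) => //.
  exact: subset_itv_oc_cc.
by move=> <-; rewrite addrC subrK.
Qed.

Lemma segment_integralB f g a b : continuous_on_segment f a b ->
  continuous_on_segment g a b ->
  segment_integral (fun x => f x - g x) a b =
  segment_integral f a b - segment_integral g a b.
Proof.
by move=> cf cg; rewrite /segment_integral RintegralB//; exact: segment_integrable.
Qed.

Lemma segment_integral_approx f (a b k e : R) : a <= b ->
  continuous_on_segment f a b ->
  (forall x, a <= x <= b -> `|f x - k| <= e) ->
  `|segment_integral f a b - k * (b - a)| <= e * (b - a).
Proof.
move=> ab cf fk.
have icst (r : R) : mu.-integrable `[a, b] (EFin \o cst r).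
  by apply: segment_integrable => x _; exact: cvg_cst.
have Icst (r : R) : \int[mu]_(x in `[a, b]) r = r * (b - a).
  rewrite Rintegral_cst//; have := @lebesgue_measure_itv R `[a, b]; rewrite /= => ->.
  rewrite lte_fin.
  by have [//|ba] := ltP a b; rewrite (le_anti (introT andP (conj ab ba))) subrr.
have iB : mu.-integrable `[a, b] (EFin \o (fun x => f x - k)).
  apply: segment_integrable => x xab; apply: cvgB; first exact: cf.
  exact: cvg_cst.
rewrite -Icst -Icst /segment_integral -RintegralB; [|by []|exact: segment_integrable|exact: icst].
apply: le_trans (le_normr_Rintegral _ _) _ => //.
apply: le_Rintegral; [by []| |exact: icst|].
  apply: segment_integrable => x xab; apply: cvg_norm; apply: cvgB; first exact: cf.
  exact: cvg_cst.
by move=> x /=; rewrite in_itv/=; exact: fk.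
Qed.

End segment_integral.

Section goursat.
Context (R : realType).
Implicit Types u v : R -> R -> R.

(* Complex differentiability of [u + i v] at [x + i y], with derivative
   [p + i q]. *)
Definition complex_differentiable u v (x y : R) : Prop :=
  exists p q : R, forall e : R, 0 < e -> exists2 d : R, 0 < d &
    forall h k : R, `|h| <= d -> `|k| <= d ->
      `|u (x + h) (y + k) - u x y - (p * h - q * k)| <= e * (`|h| + `|k|) /\
      `|v (x + h) (y + k) - v x y - (q * h + p * k)| <= e * (`|h| + `|k|).

(* Real part of the integral of [(u + i v) d(x + i y)] along the boundary of
   [[a, b] x [c, d]]. *)
Definition rectangle_integral u v (a b c d : R) : R :=
  (segment_integral (u^~ c) a b - segment_integral (u^~ d) a b) -
  (segment_integral (v b) c d - segment_integral (v a) c d).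

Lemma lipschitz_at_continuous (f : R -> R) (x L d : R) : 0 < d ->
  (forall h, `|h| <= d -> `|f (x + h) - f x| <= L * `|h|) -> {for x, continuous f}.
Proof.
move=> d0 fL.
have L0 : 0 <= L.
  have := fL d; rewrite ger0_norm ?(ltW d0)// => /(_ (lexx _)) h.
  by have := le_trans (normr_ge0 _) h; rewrite pmulr_lge0.
apply/cvgrPdist_le => e e0.
have L10 : 0 < L + 1 by rewrite ltr_wpDl.
apply/nbhs_ballP; exists (Num.min d (e / (L + 1))) => /=.
  by rewrite lt_min d0 divr_gt0.
move=> t; rewrite /ball/= lt_min distrC => /andP[/ltW td].
rewrite ltr_pdivlMr// => /ltW te; rewrite distrC.
have := fL _ td; rewrite subrKC => /le_trans; apply.
by apply: le_trans te; rewrite mulrC ler_wpM2l// lerDl.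
Qed.

Lemma complex_differentiable_continuous u v x y : complex_differentiable u v x y ->
  [/\ {for x, continuous (u^~ y)}, {for y, continuous (u x)},
      {for x, continuous (v^~ y)} & {for y, continuous (v x)}].
Proof.
move=> [p [q H]]; have [d d0 hd] := H 1 ltr01.
have tri (a b c : R) : `|a - b| <= c -> `|a| <= `|b| + c.
  by move=> abc; rewrite -[a](subrK b) addrC (le_trans (ler_normD _ _))// lerD.
have d00 : `|0 : R| <= d by rewrite normr0 ltW.
split; apply: (@lipschitz_at_continuous _ _ (`|p| + `|q| + 1) d) => // h hh.
- have [] := hd h 0 hh d00; rewrite ?(addr0, mulr0, subr0, sub0r, add0r, normr0, mul1r) => /tri h1 _.
  by apply: le_trans h1 _; rewrite normrM; have := normr_ge0 q; have := normr_ge0 h; nra.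
- have [] := hd 0 h d00 hh; rewrite ?(addr0, mulr0, subr0, sub0r, add0r, normr0, mul1r) => /tri h1 _.
  by apply: le_trans h1 _; rewrite normrN normrM; have := normr_ge0 p; have := normr_ge0 h; nra.
- have [] := hd h 0 hh d00; rewrite ?(addr0, mulr0, subr0, sub0r, add0r, normr0, mul1r) => _ /tri h1.
  by apply: le_trans h1 _; rewrite normrM; have := normr_ge0 p; have := normr_ge0 h; nra.
- have [] := hd 0 h d00 hh; rewrite ?(addr0, mulr0, subr0, sub0r, add0r, normr0, mul1r) => _ /tri h1.
  by apply: le_trans h1 _; rewrite normrM; have := normr_ge0 q; have := normr_ge0 h; nra.
Qed.

Context (u v : R -> R -> R).
Hypothesis uv_diff : forall x y : R, x < 0 -> complex_differentiable u v x y.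
Local Notation I := (rectangle_integral u v).

Let cux (a b y : R) : b < 0 -> continuous_on_segment (u^~ y) a b.
Proof.
move=> b0 x /andP[_ xb].
by have [] := complex_differentiable_continuous (uv_diff y (le_lt_trans xb b0)).
Qed.

Let cvy (x c d : R) : x < 0 -> continuous_on_segment (v x) c d.
Proof. by move=> x0 y _; have [] := complex_differentiable_continuous (uv_diff y x0). Qed.

Lemma rectangle_integral_catl a m b c d : a <= m -> m <= b -> b < 0 ->
  I a b c d = I a m c d + I m b c d.
Proof.
move=> am mb b0; rewrite /rectangle_integral.
rewrite (segment_integral_cat am mb (cux (y := c) b0)) (segment_integral_cat am mb (cux (y := d) b0)).
ring.
Qed.

Lemma rectangle_integral_catr a b c m d : a <= b -> c <= m -> m <= d -> b < 0 ->
  I a b c d = I a b c m + I a b m d.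
Proof.
move=> ab cm md b0; rewrite /rectangle_integral.
rewrite (segment_integral_cat cm md (cvy b0)).
rewrite (segment_integral_cat cm md (cvy (le_lt_trans ab b0))).
ring.
Qed.

(** The affine part of [u + i v] contributes zero, because both pairs of sides yield
    [q (b - a) (d - c)]. What is left is the remainder, at most [e] times the half perimeter,
    integrated over the sides. *)
Lemma rectangle_integral_local x y (e : R) : x < 0 -> 0 < e ->
  exists2 r : R, 0 < r & forall a b c d, a <= x <= b -> c <= y <= d ->
    b < 0 -> b - a <= r -> d - c <= r ->
    `|I a b c d| <= e * (b - a + (d - c)) ^+ 2.
Proof.
move=> x0 e0; have [p [q H]] := uv_diff y x0.
have e20 : 0 < e / 2 by rewrite divr_gt0.
have [r r0 hr] := H _ e20; exists r => // a b c d /andP[ax xb] /andP[cy yd] b0 bar dcr.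
have ab : a <= b by exact: le_trans xb.
have cd : c <= d by exact: le_trans yd.
have near1 s t : a <= s <= b -> c <= t <= d ->
    `|u s t - u x y - (p * (s - x) - q * (t - y))| <= e / 2 * (b - a + (d - c)) /\
    `|v s t - v x y - (q * (s - x) + p * (t - y))| <= e / 2 * (b - a + (d - c)).
  move=> /andP[as_ sb] /andP[ct td].
  have hs : `|s - x| <= b - a by rewrite ler_norml; lra.
  have ht : `|t - y| <= d - c by rewrite ler_norml; lra.
  have [] := hr (s - x) (t - y) (le_trans hs bar) (le_trans ht dcr).
  rewrite !subrKC => h1 h2.
  by split; [apply: le_trans h1 _|apply: le_trans h2 _]; rewrite ler_pM2l// lerD.
have aab : a <= a <= b by rewrite lexx.
have bab : a <= b <= b by rewrite lexx ab.
have ccd : c <= c <= d by rewrite lexx.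
have dcd : c <= d <= d by rewrite lexx cd.
set w := b - a + (d - c).
have h1 : `|segment_integral (fun s => u s c - u s d) a b - q * (d - c) * (b - a)| <= e * w * (b - a).
  apply: segment_integral_approx => //.
    by move=> s sab; apply: cvgB; exact: (cux b0 sab).
  move=> s sab; have [h _] := near1 _ _ sab ccd; have [h' _] := near1 _ _ sab dcd.
  rewrite (_ : _ - _ = (u s c - u x y - (p * (s - x) - q * (c - y))) -
     (u s d - u x y - (p * (s - x) - q * (d - y)))); last by ring.
  apply: le_trans (ler_normB _ _) _; rewrite -/w in h h'; lra.
have h2 : `|segment_integral (fun t => v b t - v a t) c d - q * (b - a) * (d - c)| <= e * w * (d - c).
  apply: segment_integral_approx => //.
    move=> t tcd; apply: cvgB; first exact: (cvy b0 tcd).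
    exact: (cvy (le_lt_trans ab b0) tcd).
  move=> t tcd; have [_ h] := near1 _ _ bab tcd; have [_ h'] := near1 _ _ aab tcd.
  rewrite (_ : _ - _ = (v b t - v x y - (q * (b - x) + p * (t - y))) -
     (v a t - v x y - (q * (a - x) + p * (t - y)))); last by ring.
  apply: le_trans (ler_normB _ _) _; rewrite -/w in h h'; lra.
rewrite segment_integralB in h1; [|exact: cux|exact: cux].
rewrite segment_integralB in h2; [|exact: cvy|by apply: cvy; exact: le_lt_trans b0].
rewrite /rectangle_integral; move: h1 h2.
set U := segment_integral _ a b - _; set V := segment_integral _ c d - _ => h1 h2.
rewrite (_ : U - V = (U - q * (d - c) * (b - a)) - (V - q * (b - a) * (d - c))); last by ring.
apply: le_trans (ler_normB _ _) _; apply: le_trans (lerD h1 h2) _.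
by rewrite -mulrDr -/w -mulrA -expr2.
Qed.

(** Goursat's quartering argument, which asks for differentiability at each point and not for a
    continuous derivative. The half-plane [x < 0] is the one that the exponential maps onto the
    punctured disc. *)
Theorem rectangle_integral_eq0 a b c d : a < b -> b < 0 -> c < d -> I a b c d = 0.
Proof.
move=> ab b0 cd; apply/eqP/negPn/negP => I0.
set w := b - a; set h := d - c.
have w0 : 0 < w by rewrite subr_gt0.
have h0 : 0 < h by rewrite subr_gt0.
pose kappa := `|I a b c d|.
have k0 : 0 < kappa by rewrite normr_gt0.
(* A rectangle is recorded by its lower left corner. At stage [n] its sides are [w / 2 ^ n] and
   [h / 2 ^ n], and its integral has kept the share [kappa / 4 ^ n]. *)
pose bad n (P : R * R) := [/\ a <= P.1, P.1 + w / 2 ^+ n <= b &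
  kappa / 4 ^+ n <= `|I P.1 (P.1 + w / 2 ^+ n) P.2 (P.2 + h / 2 ^+ n)|].
pose child n (P Q : R * R) :=
  (P.1 <= Q.1 /\ Q.1 + w / 2 ^+ n.+1 <= P.1 + w / 2 ^+ n) /\
  (P.2 <= Q.2 /\ Q.2 + h / 2 ^+ n.+1 <= P.2 + h / 2 ^+ n).
have half (r : R) n : 0 < r -> r / 2 ^+ n = r / 2 ^+ n.+1 + r / 2 ^+ n.+1 /\ 0 < r / 2 ^+ n.+1.
  move=> r0; split; last by rewrite divr_gt0// exprn_gt0.
  by rewrite exprS; field; rewrite gt_eqF// exprn_gt0.
have next n P : bad n P -> exists Q, child n P Q /\ bad n.+1 Q.
  move=> [aP Pb kP].
  have [wE w'0] := half w n w0; have [hE h'0] := half h n h0.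
  set w' := w / 2 ^+ n.+1 in wE w'0; set h' := h / 2 ^+ n.+1 in hE h'0.
  apply: contrapT => noQ.
  have small Q : child n P Q -> `|I Q.1 (Q.1 + w') Q.2 (Q.2 + h')| < kappa / 4 ^+ n.+1.
    move=> cQ; rewrite ltNge; apply/negP => hQ; apply: noQ; exists Q; split => //.
    case: cQ => [[P1 P2] _]; split => //; first exact: le_trans aP P1.
    exact: le_trans P2 Pb.
  have s1 := small (P.1, P.2); have s2 := small (P.1 + w', P.2).
  have s3 := small (P.1, P.2 + h'); have s4 := small (P.1 + w', P.2 + h').
  rewrite /child /= -/w' -/h' wE hE in s1 s2 s3 s4.
  have e1 (r t : R) : 0 < t -> r <= r + t by move=> t0; rewrite lerDl ltW.
  have e2 (r t : R) : 0 < t -> r + t <= r + (t + t) by move=> t0; rewrite addrA e1.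
  have e3 (r t : R) : r + t + t <= r + (t + t) by rewrite addrA.
  have {}s1 := s1 (conj (conj (lexx _) (e2 _ _ w'0)) (conj (lexx _) (e2 _ _ h'0))).
  have {}s2 := s2 (conj (conj (e1 _ _ w'0) (e3 _ _)) (conj (lexx _) (e2 _ _ h'0))).
  have {}s3 := s3 (conj (conj (lexx _) (e2 _ _ w'0)) (conj (e1 _ _ h'0) (e3 _ _))).
  have {}s4 := s4 (conj (conj (e1 _ _ w'0) (e3 _ _)) (conj (e1 _ _ h'0) (e3 _ _))).
  have Pb0 : P.1 + w / 2 ^+ n < 0 by exact: le_lt_trans Pb b0.
  move: kP; rewrite wE hE addrA addrA.
  rewrite (@rectangle_integral_catl P.1 (P.1 + w')); [|lra|lra|lra].
  rewrite (@rectangle_integral_catr P.1 _ P.2 (P.2 + h')); [|lra|lra|lra|lra].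
  rewrite (@rectangle_integral_catr (P.1 + w') _ P.2 (P.2 + h')); [|lra|lra|lra|lra].
  have -> : kappa / 4 ^+ n = 4 * (kappa / 4 ^+ n.+1).
    by rewrite exprS; field; rewrite gt_eqF// exprn_gt0.
  move=> kP; have := le_trans kP (ler_normD _ _).
  have := ler_normD (I P.1 (P.1 + w') P.2 (P.2 + h')) (I P.1 (P.1 + w') (P.2 + h') (P.2 + h' + h')).
  have := ler_normD (I (P.1 + w') (P.1 + w' + w') P.2 (P.2 + h')) (I (P.1 + w') (P.1 + w' + w') (P.2 + h') (P.2 + h' + h')).
  lra.
pose nxt n P := xget P [set Q | child n P Q /\ bad n.+1 Q].
have nxtP n P : bad n P -> child n P (nxt n P) /\ bad n.+1 (nxt n P).
  move=> bP; rewrite /nxt; case: xgetP => [Q' _ //|noQ].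
  by have [Q' hQ'] := next _ _ bP; case: (noQ Q').
pose Q := fix Q n : R * R := if n is n'.+1 then nxt n' (Q n') else (a, c).
have badQ n : bad n (Q n).
  elim: n => [|n IH].
    rewrite /bad /= !expr0 !divr1; split => //; rewrite /w ?subrKC//.
  by have [] := nxtP _ _ IH.
have childQ n : child n (Q n) (Q n.+1) by have [] := nxtP _ _ (badQ n).
(* Left ends increase and right ends decrease, so the supremum of the left ends lies in all the
   intervals. Used for each coordinate separately. *)
have nested (f : R * R -> R) (r : R) : (forall n, f (Q n) <= f (Q n.+1) /\
    f (Q n.+1) + r / 2 ^+ n.+1 <= f (Q n) + r / 2 ^+ n) -> 0 < r ->
    exists z : R, forall n, f (Q n) <= z <= f (Q n) + r / 2 ^+ n.
  move=> fQ r0.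
  have p0 n : 0 < r / 2 ^+ n by rewrite divr_gt0// exprn_gt0.
  have up n k : f (Q n) <= f (Q (n + k)%N).
    by elim: k => [|k IH]; rewrite ?addn0// addnS; have [h1 _] := fQ (n + k)%N; exact: le_trans h1.
  have dn n k : f (Q (n + k)%N) + r / 2 ^+ (n + k) <= f (Q n) + r / 2 ^+ n.
    by elim: k => [|k IH]; rewrite ?addn0// addnS; have [_ h1] := fQ (n + k)%N; exact: le_trans IH.
  have le n m : f (Q m) <= f (Q n) + r / 2 ^+ n.
    have [nm|/ltnW mn] := leqP n m.
      by have := dn n (m - n)%N; rewrite subnKC//; have := p0 m; lra.
    by have := up m (n - m)%N; rewrite subnKC//; have := p0 n; lra.
  have hs : has_sup (range (fun n => f (Q n))).
    split; first by exists (f (Q 0%N)); exists 0%N.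
    by exists (f (Q 0%N) + r / 2 ^+ 0) => _ [m _ <-]; exact: le.
  exists (sup (range (fun n => f (Q n)))) => n; apply/andP; split.
    by apply: (sup_upper_bound hs); exists n.
  by apply: ge_sup => [|_ [m _ <-]]; [exists (f (Q 0%N)); exists 0%N|exact: le].
have [x hx] := nested fst w (fun n => (childQ n).1) w0.
have [y hy] := nested snd h (fun n => (childQ n).2) h0.
have x0 : x < 0.
  have /andP[_ xb] := hx 0%N; apply: le_lt_trans xb _.
  by have [_ bb _] := badQ 0%N; exact: le_lt_trans bb b0.
(* Chosen so that the local estimate gives at most half of [kappa / 4 ^ n] on the [n]-th rectangle,
   against [bad]. *)
have e0 : 0 < kappa / (2 * (w + h) ^+ 2).
  by rewrite divr_gt0// mulr_gt0// exprn_gt0// addr_gt0.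
have [r r0 hr] := rectangle_integral_local y x0 e0.
have [n hn] : exists n, (w + h) / 2 ^+ n <= r.
  exists (Num.Def.archi_bound ((w + h) / r)).
  set m := Num.Def.archi_bound _.
  rewrite ler_pdivrMr ?exprn_gt0// mulrC -ler_pdivrMr//.
  apply: (@le_trans _ _ m%:R).
    by apply: ltW; apply: archi_boundP; apply: ltW; exact: divr_gt0 (addr_gt0 w0 h0) r0.
  elim: m => [|m IH]; first by rewrite expr0.
  rewrite exprS -natr1; have : 1 <= 2 ^+ m :> R by rewrite exprn_ege1 ?ler1n.
  lra.
have [aQ Qb kQ] := badQ n.
have p2 : 0 < 2 ^+ n :> R by rewrite exprn_gt0.
have ww : w / 2 ^+ n <= r by apply: le_trans hn; rewrite ler_pM2r ?invr_gt0// lerDl ltW.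
have hh : h / 2 ^+ n <= r by apply: le_trans hn; rewrite ler_pM2r ?invr_gt0// lerDr ltW.
have := hr _ _ _ _ (hx n) (hy n) (le_lt_trans Qb b0).
have e1 : (Q n).1 + w / 2 ^+ n - (Q n).1 = w / 2 ^+ n by ring.
have e2 : (Q n).2 + h / 2 ^+ n - (Q n).2 = h / 2 ^+ n by ring.
rewrite e1 e2 => /(_ ww hh) hI.
have := le_trans kQ hI.
have -> : kappa / (2 * (w + h) ^+ 2) * (w / 2 ^+ n + h / 2 ^+ n) ^+ 2 = 2^-1 * (kappa / 4 ^+ n).
  have -> : 4 ^+ n = 2 ^+ n * 2 ^+ n :> R by rewrite -exprMn; congr (_ ^+ _); ring.
  by field; rewrite !gt_eqF// addr_gt0.
have : 0 < kappa / 4 ^+ n by rewrite divr_gt0// exprn_gt0.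
lra.
Qed.

End goursat.

Lemma derive_littleo (K : numFieldType) (f : K^o -> K^o) (x : K^o) :
  derivable f x 1 -> forall e : K, 0 < e -> exists2 d : K, 0 < d &
    forall h : K, `|h| < d -> `|f (x + h) - f x - 'D_1 f x * h| <= e * `|h|.
Proof.
move=> df e e0.
have : (fun h : K^o => h^-1 *: ((f \o shift x) (h *: 1) - f x)) @ 0^' --> 'D_1 f x by exact: df.
move=> /cvgrPdist_le /(_ _ e0); rewrite /nbhs/= /dnbhs /within /= => /nbhs_ballP[d /= d0 hd].
exists d => // h hh.
have [->|h0] := eqVneq h 0.
  by rewrite addr0 subrr mulr0 subr0 normr0 mulr0.
have := hd h; rewrite /ball /= sub0r normrN => /(_ hh h0).
rewrite /GRing.scale/= mulr1 (addrC h) distrC => hle.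
have -> : f (x + h) - f x - 'D_1 f x * h = (h^-1 * (f (x + h) - f x) - 'D_1 f x) * h.
  by rewrite mulrBl mulrAC mulVf// mul1r.
by rewrite normrM ler_wpM2r.
Qed.

(** * The exponential chart of the punctured disc *)

Section complex_derivative.
Context (R : realType).
Implicit Types (f g : R[i]^o -> R[i]^o) (z : R[i]).
Local Notation Re := complex.Re.
Local Notation Im := complex.Im.

Lemma complex_normE z : `|z| = (normc z)%:C%C.
Proof. by rewrite normc_def; case: z. Qed.

Lemma complex_gt0E (d : R[i]) : 0 < d -> d = (Re d)%:C%C /\ 0 < Re d.
Proof.
move=> d0; have d2 : d = (Re d)%:C%C by apply/esym/RRe_real; exact: gtr0_real.
by split=> //; rewrite -ltcR -d2.
Qed.

Lemma derivable_normc g (z : R[i]^o) : derivable g z 1 -> forall e : R, 0 < e ->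
  exists2 d : R, 0 < d & forall h : R[i], normc h < d ->
    normc (g (z + h) - g z - 'D_1 g z * h) <= e * normc h.
Proof.
move=> dg e e0.
have e0' : 0 < e%:C%C :> R[i] by rewrite ltcR.
have [d d0 hd] := derive_littleo dg e0'.
have [dE Rd] := complex_gt0E d0.
exists (Re d) => // h hh.
have : `|h| < d by rewrite complex_normE dE ltcR.
by move=> /hd; rewrite !complex_normE -rmorphM lecR.
Qed.

(** The map [exp (2 pi (x + i y))], scaled to have period 1 in [y] like [circle_exp]. *)
Definition cexp (x y : R) : R[i] := (expR (2 * pi * x))%:C%C * circle_exp y.

Lemma circle_expD (s t : R) : circle_exp (s + t) = circle_exp s * circle_exp t :> R[i].
Proof.
by rewrite /circle_exp mulrDr cosD sinD; apply/eqP; rewrite eq_complex /=;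
  apply/andP; split; apply/eqP; rewrite ?ReM //= addrC.
Qed.

Lemma cexpD x y h k : cexp (x + h) (y + k) = cexp x y * cexp h k.
Proof.
rewrite /cexp circle_expD mulrDr expRD rmorphM /=; ring.
Qed.

Lemma normc_circle_exp (y : R) : normc (circle_exp y) = 1.
Proof. by rewrite /= cos2Dsin2 sqrtr1. Qed.

Lemma normc_cexp x y : normc (cexp x y) = expR (2 * pi * x).
Proof.
rewrite normcM normc_circle_exp mulr1 /= expr0n addr0 sqrtr_sqr.
by rewrite ger0_norm ?expR_ge0.
Qed.

Lemma normc_le_norms z : normc z <= `|Re z| + `|Im z|.
Proof.
rewrite -(@ler_pXn2r _ 2) ?nnegrE ?normc_ge0 ?addr_ge0// sqr_normcE.
rewrite -(real_normK (num_real (Re z))) -(real_normK (num_real (Im z))).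
by have := normr_ge0 (Re z); have := normr_ge0 (Im z); nra.
Qed.

Lemma norm_Im_le z : `|Im z| <= normc z.
Proof.
rewrite -(@ler_pXn2r _ 2) ?nnegrE ?normc_ge0// sqr_normcE real_normK ?num_real//.
by rewrite lerDr sqr_ge0.
Qed.

Lemma is_derive_littleo (f : R -> R) (a x : R) : is_derive x 1 f a ->
  forall e : R, 0 < e -> exists2 d : R, 0 < d &
    forall h, `|h| < d -> `|f (x + h) - f x - a * h| <= e * `|h|.
Proof.
move=> [df <-]; exact: (@derive_littleo R f x df).
Qed.

Lemma cexp_littleo (e : R) : 0 < e -> exists2 d : R, 0 < d & forall h k : R,
  `|h| < d -> `|k| < d ->
  normc (cexp h k - 1 - (2 * pi)%:C%C * (h +i* k)%C) <= e * (`|h| + `|k|).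
Proof.
move=> e0; have pi0 := pi_gt0 R.
have dM : is_derive (0 : R) 1 (fun t : R => 2 * pi * t) (2 * pi).
  have -> : (fun t : R => 2 * pi * t) = ((2 * pi) \*: id) by [].
  by apply: is_derive_eq; rewrite /GRing.scale/= mulr1.
have d1 : is_derive (0 : R) 1 (fun t : R => expR (2 * pi * t)) (2 * pi).
  have := @is_derive1_comp _ expR _ 0 _ _ (is_derive_expR _) dM.
  by rewrite mulr0 expR0 mul1r.
have d2 : is_derive (0 : R) 1 (fun t : R => cos (2 * pi * t)) 0.
  have := @is_derive1_comp _ (@cos R) _ 0 _ _ (is_derive_cos _) dM.
  by rewrite mulr0 sin0 oppr0 mul0r.
have d3 : is_derive (0 : R) 1 (fun t : R => sin (2 * pi * t)) (2 * pi).
  have := @is_derive1_comp _ (@sin R) _ 0 _ _ (is_derive_sin _) dM.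
  by rewrite mulr0 cos0 mul1r.
have e4 : 0 < Num.min 1 (e / 4) by rewrite lt_min ltr01 divr_gt0.
have [r1 r10 h1] := is_derive_littleo d1 e4.
have [r2 r20 h2] := is_derive_littleo d2 e4.
have [r3 r30 h3] := is_derive_littleo d3 e4.
set e' := Num.min _ _ in e4 h1 h2 h3.
have [e'1 e'4] : e' <= 1 /\ e' <= e / 4 by rewrite !ge_min !lexx orbT.
pose C : R := 2 * pi + 1.
have C0 : 0 < C by rewrite addr_gt0// mulr_gt0.
pose d := Num.min (Num.min r1 (Num.min r2 r3)) (Num.min C^-1 (e / (4 * C ^+ 2))).
exists d; first by rewrite !lt_min r10 r20 r30 invr_gt0 C0 divr_gt0// mulr_gt0// exprn_gt0.
move=> h k; rewrite !lt_min.
move=> /andP[/andP[/h1 a1 _] /andP[hC hC2]] /andP[/andP[_ /andP[/h2 a2 /h3 a3]] _].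
rewrite !add0r !mulr0 ?expR0 ?cos0 ?sin0 ?mul0r ?subr0 in a1 a2 a3.
have nh := normr_ge0 h; have nk := normr_ge0 k.
have b1 : `|expR (2 * pi * h) - 1| <= C * `|h|.
  rewrite -[X in `|X|](subrK (2 * pi * h)); apply: le_trans (ler_normD _ _) _.
  by rewrite normrM (@ger0_norm _ (2 * pi)) ?mulr_ge0 ?pi_ge0// /C; nra.
have b3 : `|sin (2 * pi * k)| <= C * `|k|.
  rewrite -[X in `|X|](subrK (2 * pi * k)); apply: le_trans (ler_normD _ _) _.
  by rewrite normrM (@ger0_norm _ (2 * pi)) ?mulr_ge0 ?pi_ge0// /C; nra.
have b12 : expR (2 * pi * h) <= 2.
  have : C * `|h| <= 1 by rewrite mulrC -ler_pdivlMr// mul1r ltW.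
  by move: b1; rewrite ler_norml => /andP[_ ?] ?; lra.
have b4 : C * `|h| * (C * `|k|) <= e / 4 * `|k|.
  have : `|h| * (4 * C ^+ 2) <= e by rewrite -ler_pdivlMr ?mulr_gt0 ?exprn_gt0// ltW.
  by move=> /(ler_wpM2r nk); lra.
apply: le_trans (normc_le_norms _) _.
rewrite /cexp /circle_exp /= !mul0r !subr0 !addr0 ?add0r.
have -> : expR (2 * pi * h) * cos (2 * pi * k) - 1 - 2 * pi * h =
   (expR (2 * pi * h) - 1 - 2 * pi * h) + expR (2 * pi * h) * (cos (2 * pi * k) - 1) by ring.
have -> : expR (2 * pi * h) * sin (2 * pi * k) - 2 * pi * k =
   (expR (2 * pi * h) - 1) * sin (2 * pi * k) + (sin (2 * pi * k) - 2 * pi * k) by ring.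
apply: le_trans (lerD (ler_normD _ _) (ler_normD _ _)) _.
rewrite !normrM (ger0_norm (expR_ge0 _)).
have c1 := ler_pM (expR_ge0 _) (normr_ge0 _) b12 a2.
have c2 := ler_pM (normr_ge0 _) (normr_ge0 _) b1 b3.
rewrite ?subr0 in a2 c1; have c3 := ler_wpM2r nh e'4; have c4 := ler_wpM2r nk e'4.
have c5 := mulr_ge0 (ltW e0) nh.
lra.
Qed.

(** Chain rule. As [cexp] turns sums into products, its increment is [Z * D] with
    [D = cexp h k - 1], and only the expansion of [cexp] at the origin is needed. *)
Lemma complex_differentiable_cexp g (x y : R) :
  derivable g (cexp x y : R[i]^o) 1 ->
  complex_differentiable (fun s t => Re (g (cexp s t))) (fun s t => Im (g (cexp s t))) x y.
Proof.
move=> dg; have pi0 := pi_gt0 R.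
set Z : R[i]^o := cexp x y in dg *; set L := 'D_1 g Z.
set rho := normc Z.
have rho0 : 0 < rho by rewrite /rho normc_cexp expR_gt0.
pose W := L * Z * (2 * pi)%:C%C.
exists (Re W), (Im W) => e e0.
pose C : R := 2 * pi + 1.
have C0 : 0 < C by rewrite addr_gt0// mulr_gt0.
have C1 : 1 <= C by rewrite lerDr mulr_ge0// ltW.
have e10 : 0 < e / (2 * rho * C) by rewrite divr_gt0// !mulr_gt0.
have [d1 d10 h1] := derivable_normc dg e10.
have L0 := normc_ge0 L.
have L10 : 0 < normc L + 1 by rewrite ltr_wpDl.
have e20 : 0 < Num.min 1 (e / (2 * rho * (normc L + 1))).
  by rewrite lt_min ltr01 divr_gt0// !mulr_gt0.
have [d2 d20 h2] := cexp_littleo e20.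
set e2 := Num.min _ _ in e20 h2.
have [e21 e2e] : e2 <= 1 /\ e2 <= e / (2 * rho * (normc L + 1)).
  by rewrite !ge_min !lexx orbT.
pose d := Num.min (d2 / 2) (d1 / (4 * rho * C)).
exists d; first by rewrite lt_min !divr_gt0// !mulr_gt0.
move=> h k; rewrite !le_min => /andP[hd2 hd1] /andP[kd2 kd1].
have nh := normr_ge0 h; have nk := normr_ge0 k.
have hh : `|h| < d2 by lra.
have kk : `|k| < d2 by lra.
have a2 := h2 h k hh kk.
set D := cexp h k - 1 in a2; set hk := (h +i* k)%C in a2.
have nhk : normc hk <= `|h| + `|k| by exact: normc_le_norms.
have nhk0 := normc_ge0 hk.
have n2pi : normc ((2 * pi : R)%:C%C) = 2 * pi.
  by rewrite /= expr0n addr0 sqrtr_sqr ger0_norm// mulr_ge0// ltW.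
have aD : normc D <= C * (`|h| + `|k|).
  rewrite -[D](subrK ((2 * pi)%:C%C * hk)); apply: le_trans (le_normcD _ _) _.
  rewrite normcM n2pi.
  have : 2 * pi * normc hk <= 2 * pi * (`|h| + `|k|) by rewrite ler_wpM2l// mulr_ge0// ltW.
  have : e2 * (`|h| + `|k|) <= 1 * (`|h| + `|k|) by rewrite ler_wpM2r// addr_ge0.
  by rewrite /C; lra.
have nZD : normc (Z * D) <= rho * C * (`|h| + `|k|).
  by rewrite normcM -mulrA ler_wpM2l// ltW.
have ZDd : normc (Z * D) < d1.
  apply: le_lt_trans nZD _.
  have q : 0 < rho * C by rewrite mulr_gt0.
  have i1 : `|h| * (4 * rho * C) <= d1 by rewrite -ler_pdivlMr// !mulr_gt0.
  have i2 : `|k| * (4 * rho * C) <= d1 by rewrite -ler_pdivlMr// !mulr_gt0.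
  by lra.
have a1 := h1 (Z * D) ZDd.
have EZ : cexp (x + h) (y + k) = Z + Z * D by rewrite cexpD /D mulrBr mulr1 subrKC.
have main : normc (g (cexp (x + h) (y + k)) - g Z - W * hk) <= e * (`|h| + `|k|).
  rewrite EZ (_ : _ - W * hk = (g (Z + Z * D) - g Z - L * (Z * D)) +
      L * Z * (D - (2 * pi)%:C%C * hk)); last by rewrite /W; ring.
  apply: le_trans (le_normcD _ _) _; rewrite [normc (L * Z * _)]normcM [normc (L * Z)]normcM -/rho.
  have k1 : normc (g (Z + Z * D) - g Z - L * (Z * D)) <= e / 2 * (`|h| + `|k|).
    apply: le_trans a1 _; apply: le_trans (ler_wpM2l (ltW e10) nZD) _.
    by rewrite le_eqVlt; apply/orP; left; apply/eqP; field; rewrite !gt_eqF.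
  have k2 : normc L * rho * normc (D - (2 * pi)%:C%C * hk) <= e / 2 * (`|h| + `|k|).
    apply: le_trans (ler_wpM2l _ a2) _; first by rewrite mulr_ge0// ltW.
    rewrite mulrA ler_wpM2r ?addr_ge0//.
    apply: le_trans (ler_wpM2l _ e2e) _; first by rewrite mulr_ge0// ltW.
    have -> : normc L * rho * (e / (2 * rho * (normc L + 1))) = e / 2 * (normc L / (normc L + 1)).
      by field; rewrite !gt_eqF.
    by rewrite ler_piMr ?divr_ge0 ?(ltW e0)// ler_pdivrMr// mul1r lerDl.
  by lra.
have RW (a b c : R[i]) : Re (a - b - c) = Re a - Re b - Re c.
  by case: a b c => [? ?] [? ?] [? ?].
have IW (a b c : R[i]) : Im (a - b - c) = Im a - Im b - Im c.
  by case: a b c => [? ?] [? ?] [? ?].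
split; apply: le_trans main.
- have := norm_Re_le (g (cexp (x + h) (y + k)) - g Z - W * hk).
  by rewrite RW cReM.
- have := norm_Im_le (g (cexp (x + h) (y + k)) - g Z - W * hk).
  by rewrite IW cImM (addrC (Im W * _)).
Qed.

Lemma circle_exp0 : circle_exp 0 = 1 :> R[i].
Proof. by rewrite /circle_exp mulr0 cos0 sin0. Qed.

Lemma circle_exp1 : circle_exp 1 = 1 :> R[i].
Proof. by rewrite /circle_exp mulr1 mulr_natl cos2pi sin2pi. Qed.

(** The origin is left out so as to admit the quotients [f ^ j / z ^ k]. *)
Definition punctured_disc_derivable g :=
  forall z : R[i]^o, 0 < normc z < 1 -> derivable g z 1.

(* The chart [cexp] maps vertical segments of length [1] onto circles, and the
   integrals along the horizontal sides of the rectangle cancel by periodicity. *)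
Lemma circle_integral_constant g (r s : R) : punctured_disc_derivable g ->
  0 < r < 1 -> 0 < s < 1 ->
  segment_integral (fun t => Im (g (r%:C%C * circle_exp t))) 0 1 =
  segment_integral (fun t => Im (g (s%:C%C * circle_exp t))) 0 1.
Proof.
move=> dg; wlog rs : r s / r < s => [hw|] /andP[r0 r1] /andP[s0 s1].
  have [rs|sr|->//] := ltgtP r s; first by apply: hw; rewrite // ?r0 ?s0.
  by apply/esym; apply: hw; rewrite // ?r0 ?s0.
have pi0 := pi_gt0 R.
have p2 : 0 < 2 * pi :> R by rewrite mulr_gt0.
pose lg t : R := ln t / (2 * pi).
have lgE t : 0 < t -> expR (2 * pi * lg t) = t.
  by move=> t0; rewrite /lg mulrC divfK ?gt_eqF// lnK.
have lgs : lg s < 0 by rewrite /lg pmulr_llt0 ?invr_gt0// ln_lt0// s0.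
have lgrs : lg r < lg s by rewrite /lg ltr_pM2r ?invr_gt0// ltr_ln.
have D x y : x < 0 -> complex_differentiable (fun s t => Re (g (cexp s t)))
   (fun s t => Im (g (cexp s t))) x y.
  move=> x0; apply: complex_differentiable_cexp; apply: dg.
  rewrite normc_cexp expR_gt0/= -[ltRHS]expR0 ltr_expR.
  by rewrite pmulr_rlt0.
have := rectangle_integral_eq0 D lgrs lgs ltr01.
rewrite /rectangle_integral.
have -> : (fun x => Re (g (cexp x 0))) = (fun x => Re (g (cexp x 1))).
  by apply/funext => x; rewrite /cexp circle_exp0 circle_exp1.
rewrite subrr sub0r opprB => /eqP; rewrite subr_eq0 => /eqP.
rewrite /cexp !lgE//.
Qed.

End complex_derivative.

(** * The circle as a measurable space *)

Definition circle_val (R : realType) (w : circle R) : R[i] := val w.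

Section circle_topology.
Context (R : realType).
Implicit Types (U : set R[i]^o).
Local Notation Re := complex.Re.
Local Notation Im := complex.Im.

Lemma open_normcP U : open U <-> forall z, U z ->
  exists2 e : R, 0 < e & forall y, normc (y - z) < e -> U y.
Proof.
rewrite openE; split=> oU z Uz.
  have := oU z Uz; rewrite /interior => /nbhs_ballP[e /= e0 he].
  have [eE Re0] := complex_gt0E e0; exists (Re e) => // y yz.
  by apply: he; rewrite /ball /= distrC complex_normE eE ltcR.
have [e e0 he] := oU z Uz; rewrite /interior; apply/nbhs_ballP; exists e%:C%C.
  by rewrite /= ltcR.
by move=> y; rewrite /ball /= distrC complex_normE ltcR; exact: he.
Qed.

Lemma normc_circle (w : circle R) : normc (circle_val w) = 1.
Proof. have /eqP := valP w; rewrite complex_normE => h; exact: (congr1 (@complex.Re R) h). Qed.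

Lemma normcB_lt_trans (x y z : R[i]) (e : R) : normc (x - y) < e - normc (y - z) ->
  normc (x - z) < e.
Proof.
move=> h; rewrite -(subrKA y); apply: le_lt_trans (le_normcD _ _) _; lra.
Qed.

Lemma circle_measurable_open (A : set (circle R)) :
  (forall w, A w -> exists2 e : R, 0 < e &
     forall v, normc (circle_val v - circle_val w) < e -> A v) ->
  measurable A.
Proof.
move=> oA; pose U : set R[i]^o := [set y | exists w, exists2 e : R,
  forall v, normc (circle_val v - circle_val w) < e -> A v & normc (y - circle_val w) < e].
have oU : open U.
  apply/open_normcP => y [w [e hA yw]]; exists (e - normc (y - circle_val w)); first by rewrite subr_gt0.
  move=> x xy; exists w, e => //; exact: (@normcB_lt_trans x y).
apply: sub_sigma_algebra; exists U => //.
apply/seteqP; split=> w /=.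
  by move=> [v [e hA yw]]; exact: hA.
by move=> Aw; have [e e0 he] := oA w Aw; exists w, e => //; rewrite subrr normc0.
Qed.

Lemma circle_measurable_closed (A : set (circle R)) :
  (forall w, ~ A w -> exists2 e : R, 0 < e &
     forall v, normc (circle_val v - circle_val w) < e -> ~ A v) ->
  measurable A.
Proof. by move=> cA; rewrite -(setCK A); apply: measurableC; exact: circle_measurable_open. Qed.

Lemma bounded_measurable_circle (h : circle R -> R) (K : R) : (forall w, `|h w| <= K) ->
  (forall w (e : R), 0 < e -> exists2 d : R, 0 < d &
     forall v, normc (circle_val v - circle_val w) < d -> `|h v - h w| <= e) ->
  bounded_measurable h.
Proof.
move=> hK ch; split; last by exists K.
apply: (measurability _ (RGenOInfty.measurableE R)) => // _ [_ [x ->] <-]; rewrite setTI.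
apply: circle_measurable_open => w /=; rewrite in_itv/= andbT => xw.
have e0 : 0 < (h w - x) / 2 by rewrite divr_gt0// subr_gt0.
have [d d0 hd] := ch w _ e0; exists d => // v /hd.
by rewrite in_itv/= andbT ler_norml => /andP[]; lra.
Qed.

Lemma bounded_measurableC_circle (h : circle R -> R[i]) (K : R) : (forall w, normc (h w) <= K) ->
  (forall w (e : R), 0 < e -> exists2 d : R, 0 < d &
     forall v, normc (circle_val v - circle_val w) < d -> normc (h v - h w) <= e) ->
  bounded_measurableC h.
Proof.
move=> hK ch; split; apply: (@bounded_measurable_circle _ K).
- by move=> w; apply: le_trans (hK w); exact: norm_Re_le.
- move=> w e e0; have [d d0 hd] := ch w e e0; exists d => // v /hd.
  by apply: le_trans; rewrite -cReN -cReD; exact: norm_Re_le.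
- by move=> w; apply: le_trans (hK w); exact: norm_Im_le.
- move=> w e e0; have [d d0 hd] := ch w e e0; exists d => // v /hd.
  by apply: le_trans; rewrite -cImN -cImD; exact: norm_Im_le.
Qed.

Lemma bounded_measurableC_val : bounded_measurableC (@circle_val R).
Proof.
apply: (@bounded_measurableC_circle _ 1) => [w|w e e0]; first by rewrite normc_circle.
by exists e => // v /ltW.
Qed.

Let rational_disc (i : rat * rat * nat) : R[i] * R :=
  ((ratr i.1.1 +i* ratr i.1.2)%C, i.2.+1%:R^-1).

(** Second countability of the plane, by the discs with rational centre and radius [1 / (m + 1)]
    that lie in [U]. It reduces measurability of maps into the circle, and of open subsets of it, to
    discs, which are described by real functions. *)
Lemma open_countable_discs U : open U -> exists F : nat -> R[i] * R,
  forall z, U z <-> exists n, normc (z - (F n).1) < (F n).2.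
Proof.
move=> /open_normcP oU.
pose G i := rational_disc i.
(* The default [(0, 0)] stands for an empty disc, its radius being 0. *)
pose F n := if unpickle n is Some i then
  if `[< forall y : R[i], normc (y - (G i).1) < (G i).2 -> U y >] then G i else (0, 0) else (0, 0).
exists F => z; split; last first.
  move=> [n]; rewrite /F; case: unpickle => [i|]; last by rewrite /= subr0 ltNge normc_ge0.
  by case: asboolP => [hU /hU//|_]; rewrite /= subr0 ltNge normc_ge0.
move=> Uz; have [e e0 he] := oU z Uz.
pose m := Num.truncn (2 / e).
have mE : m.+1%:R^-1 <= e / 2 :> R.
  rewrite -[leRHS]invrK lef_pV2 ?posrE ?invr_gt0 ?divr_gt0 ?ltr0n// invf_div.
  by rewrite ltW// truncnS_gt.
set r : R := m.+1%:R^-1 in mE.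
have r0 : 0 < r by rewrite invr_gt0 ltr0n.
have rat_near (x : R) : exists q : rat, `|x - ratr q| < r / 2.
  have [|q] := @rat_in_itvoo R (x - r / 2) (x + r / 2); first by lra.
  by rewrite in_itv/= => /andP[h1 h2]; exists q; rewrite ltr_norml; lra.
have [a ha] := rat_near (Re z); have [b hb] := rat_near (Im z).
have zG : normc (z - (G (a, b, m)).1) < r.
  apply: le_lt_trans (normc_le_norms _) _.
  by rewrite cReD cImD cReN cImN /=; lra.
exists (pickle (a, b, m)); rewrite /F pickleK; case: asboolP => //.
case=> y yG; apply: he; rewrite -(subrKA (G (a, b, m)).1).
apply: le_lt_trans (le_normcD _ _) _; rewrite -(normcN ((G (a, b, m)).1 - z)) opprB.
rewrite /= -/r in yG zG *; lra.
Qed.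

Lemma measurable_normc_lt d (T : measurableType d) (g : T -> R[i]) (q : R[i]) (r : R) :
  bounded_measurableC g -> measurable [set w | normc (g w - q) < r].
Proof.
move=> bg; have [r0|r0] := leP r 0.
  rewrite (_ : [set _ | _] = set0)//; apply/seteqP; split=> // w /=.
  by rewrite ltNge (le_trans r0)// normc_ge0.
have [bR bI] : bounded_measurableC (fun w => g w - q).
  by apply: bounded_measurableCB => //; exact: bounded_measurableC_cst.
have [mphi _] := bounded_measurableD (bounded_measurableX 2 bR) (bounded_measurableX 2 bI).
rewrite (_ : [set _ | _] = (fun w => Re (g w - q) ^+ 2 + Im (g w - q) ^+ 2) @^-1` `]-oo, r ^+ 2[).
  by rewrite -[X in measurable X]setTI; apply: mphi.
by apply/seteqP; split=> w /=; rewrite in_itv/= -sqr_normcE ltr_pXn2r ?nnegrE ?normc_ge0// ltW.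
Qed.

Lemma measurable_to_circle d (T : measurableType d) (t : T -> circle R) :
  bounded_measurableC (fun w => circle_val (t w)) -> measurable_fun [set: T] t.
Proof.
move=> bt; apply: (@measurability _ _ _ _ _ _ (@circle_open R)) => //.
move=> _ [_ [U oU <-] <-]; rewrite setTI.
have [F UF] := open_countable_discs oU.
rewrite (_ : _ @^-1` _ = \bigcup_n [set w | normc (circle_val (t w) - (F n).1) < (F n).2]).
  by apply: bigcupT_measurable => n; exact: measurable_normc_lt.
apply/seteqP; split=> w /=; first by move=> /UF[n hn]; exists n.
by move=> [n _ hn]; apply/UF; exists n.
Qed.

End circle_topology.

Lemma cvg_subr_cvg0 (R : realType) (u : nat -> R) (l : R) :
  l - u n @[n --> \oo] --> 0 -> u n @[n --> \oo] --> l.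
Proof.
move=> h; have -> : u = (fun n => l - (l - u n)) by apply/funext => n; rewrite subKr.
by rewrite -[X in _ --> X](subr0 l); apply: cvgB => //; exact: cvg_cst.
Qed.

(** * Functions with given Fourier coefficients *)

(** Approximation by simple functions as an induction principle. Bounded limits suffice: after an
    affine change to values in [[0, 1]], the partial sums of the binary expansion stay in
    [[0, 1]]. *)
Lemma bounded_measurable_ind d (T : measurableType d) (R : realType) (V : (T -> R) -> Prop) :
  (forall (f g : T -> R), V f -> V g -> V (fun w => f w + g w)) ->
  (forall (c : R) f, V f -> V (fun w => c * f w)) ->
  (forall (f_ : nat -> T -> R) f K, (forall n, V (f_ n)) -> (forall n w, `|f_ n w| <= K) ->
     (forall w, f_ n w @[n --> \oo] --> f w) -> V f) ->
  (forall A, measurable A -> V (\1_A)) ->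
  forall h, bounded_measurable h -> V h.
Proof.
move=> VD VZ Vlim V1.
have Vunit (h : T -> R) : measurable_fun [set: T] h -> (forall w, 0 <= h w <= 1) -> V h.
  move=> mh h01.
  (* Greedy binary expansion of [h]. *)
  pose s := fix s n := if n is m.+1 then
     (fun w => s m w + 2^-1 ^+ m.+1 * \1_[set v | 2^-1 ^+ m.+1 <= h v - s m v] w) else (fun=> 0 : R).
  have sS m w : s m.+1 w = s m w + 2^-1 ^+ m.+1 * \1_[set v | 2^-1 ^+ m.+1 <= h v - s m v] w by [].
  have ms m : measurable_fun [set: T] (s m) /\
      measurable [set v | 2^-1 ^+ m.+1 <= h v - s m v].
    have mA (u : T -> R) (r : R) : measurable_fun [set: T] u -> measurable [set v | r <= h v - u v].
      move=> mu; rewrite (_ : [set _ | _] = (fun v => h v - u v) @^-1` `[r, +oo[).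
        by rewrite -[X in measurable X]setTI; apply: (measurable_funB mh mu).
      by apply/seteqP; split => v /=; rewrite in_itv/= andbT.
    elim: m => [|m [IH IA]]; first by split; [exact: measurable_cst|apply: mA; exact: measurable_cst].
    have mS : measurable_fun [set: T] (s m.+1).
      apply: measurable_funD => //; apply: measurable_funM => //.
    by split => //; exact: mA.
  have bs m w : 0 <= h w - s m w <= 2^-1 ^+ m.
    elim: m => [|m /andP[IH1 IH2]]; first by rewrite /= subr0 expr0.
    rewrite sS indicE; set q := 2^-1 ^+ m.+1 in IH2 *.
    have qE : 2^-1 ^+ m = q + q by rewrite /q exprS; lra.
    case: (boolP (w \in _)) => [/set_mem /= hq|/negP hq].
      by rewrite mulr1; apply/andP; split; lra.
    have hq' : h w - s m w < q by rewrite ltNge; apply/negP => /= hh; apply: hq; rewrite inE.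
    by rewrite mulr0 addr0 IH1 ltW.
  apply: (Vlim s h 1).
  - elim=> [|m IH].
      have -> : s 0%N = (fun w => 0 * \1_(set0 : set T) w) by apply/funext => w; rewrite mul0r.
      by apply/VZ/V1.
    apply: VD => //; apply/VZ/V1; exact: (ms m).2.
  - move=> m w; have := bs m w; have := h01 w.
    have s0 : 0 <= s m w.
      by elim: m => [//|m IH]; rewrite sS addr_ge0// mulr_ge0// ?exprn_ge0// indicE ler0n.
    by rewrite ger0_norm// => /andP[? ?] /andP[? ?]; lra.
  - move=> w; have c0 : (2^-1 : R) ^+ n @[n --> \oo] --> 0.
      by apply: cvg_expr; rewrite gtr0_norm; lra.
    have cB : h w - s n w @[n --> \oo] --> 0.
      apply: (squeeze_cvgr _ (cvg_cst 0) c0); apply: nearW => n; exact: bs.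
    exact: cvg_subr_cvg0.
move=> h [mh [K hK]].
pose L : R := `|K| + 1; have L0 : 0 < L by rewrite ltr_wpDl.
pose g w : R := (2 * L)^-1 * h w + 2^-1.
have bg w : 0 <= g w <= 1.
  have : `|(2 * L)^-1 * h w| <= 2^-1.
    rewrite normrM gtr0_norm ?invr_gt0 ?mulr_gt0// invfM -mulrA ler_piMr// mulrC ler_pdivrMr// mul1r.
    by apply: le_trans (hK w) _; rewrite /L; have := ler_norm K; lra.
  by rewrite ler_norml /g => /andP[? ?]; apply/andP; split; lra.
have mg : measurable_fun [set: T] g by apply: measurable_funD => //; exact: measurable_funM.
have -> : h = (fun w => 2 * L * g w + (- L) * \1_[set: T] w).
  by apply/funext => w; rewrite /g indicE in_setT /=; field; rewrite gt_eqF.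
by apply: VD; apply: VZ; [exact: Vunit|exact: V1].
Qed.

Section multipliers.
Context (R : realType) d (T : measurableType d) (P : probability T R).
Context (z1 z2 : T -> circle R) (mz1 : measurable_fun [set: T] z1)
  (mz2 : measurable_fun [set: T] z2).
Local Notation Re := complex.Re.
Local Notation Im := complex.Im.
Local Notation E := (expect P).
Local Notation bmC := bounded_measurableC.
Local Notation cval := (@circle_val R).
Implicit Types (rho : T -> R[i]).

Definition monomial (a b : nat) (w : circle R) : R[i] := cval w ^+ a * conjc (cval w) ^+ b.

Lemma bounded_measurableC_monomial a b : bmC (monomial a b).
Proof.
apply: bounded_measurableCM; apply: bounded_measurableCX; first exact: bounded_measurableC_val.
exact: (bounded_measurableC_conj (@bounded_measurableC_val R)).
Qed.

(** As [c] ranges over the complex numbers, equality of these real parts is equality of the complex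
    moments. The weights are part of the relation because a multiplier acts by changing them. *)
Definition same_moments rho1 rho2 := [/\ bmC rho1, bmC rho2 & forall c a b,
  E (fun w => Re (c * (monomial a b (z1 w) * rho1 w))) =
  E (fun w => Re (c * (monomial a b (z2 w) * rho2 w)))].

(* Multipliers are obviously closed under products; being also closed under
   bounded pointwise limits, they contain all bounded measurable functions. *)
Definition multiplier (p : circle R -> R[i]) := bmC p /\
  forall rho1 rho2, same_moments rho1 rho2 ->
    same_moments (fun w => p (z1 w) * rho1 w) (fun w => p (z2 w) * rho2 w).

Let bm_test rho (z : T -> circle R) (c : R[i]) a b : measurable_fun [set: T] z -> bmC rho ->
  bounded_measurable (fun w => Re (c * (monomial a b (z w) * rho w))).
Proof.
move=> mz br.
have bmz := bounded_measurableC_precomp mz (bounded_measurableC_monomial a b).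
have bc : bmC (fun _ : T => c) by exact: bounded_measurableC_cst.
exact: (bounded_measurableCM bc (bounded_measurableCM bmz br)).1.
Qed.

Lemma multiplier_cst c : multiplier (fun=> c).
Proof.
split=> [|rho1 rho2 [b1 b2 h]]; first exact: bounded_measurableC_cst.
split; try (by apply: bounded_measurableCM => //; exact: bounded_measurableC_cst).
move=> c' a b; have D (z : T -> circle R) rho w :
    c' * (monomial a b (z w) * (c * rho w)) = c' * c * (monomial a b (z w) * rho w) by ring.
by under eq_expect do rewrite D; under [RHS]eq_expect do rewrite D; exact: h.
Qed.

Let bmCp p (z : T -> circle R) rho : measurable_fun [set: T] z -> bmC p -> bmC rho ->
  bmC (fun w => p (z w) * rho w).
Proof.
move=> mz bp br; apply: bounded_measurableCM => //; exact: (bounded_measurableC_precomp mz bp).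
Qed.

Lemma multiplierM p q : multiplier p -> multiplier q -> multiplier (fun w => p w * q w).
Proof.
move=> [bp hp] [bq hq]; split; first exact: bounded_measurableCM.
move=> rho1 rho2 /hq /hp.
by under eq_fun do rewrite mulrA; under [X in same_moments _ X]eq_fun do rewrite mulrA.
Qed.

Lemma multiplierD p q : multiplier p -> multiplier q -> multiplier (fun w => p w + q w).
Proof.
move=> [bp hp] [bq hq]; split; first exact: bounded_measurableCD.
move=> rho1 rho2 rr; have [b1 b2 _] := rr;
have bpq := bounded_measurableCD bp bq.
split; [exact: (bmCp mz1 bpq b1)|exact: (bmCp mz2 bpq b2)|].
move=> c a b; have [p1 p2 Hp] := hp _ _ rr; have [q1 q2 Hq] := hq _ _ rr.
have D (z : T -> circle R) rho w : Re (c * (monomial a b (z w) * ((p (z w) + q (z w)) * rho w))) =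
  Re (c * (monomial a b (z w) * (p (z w) * rho w))) +
  Re (c * (monomial a b (z w) * (q (z w) * rho w))).
  by rewrite -cReD; congr Re; ring.
under eq_expect do rewrite D; under [RHS]eq_expect do rewrite D.
by rewrite !expectD ?Hp ?Hq//; exact: bm_test.
Qed.

Lemma multiplier_val : multiplier cval.
Proof.
split=> [|rho1 rho2 [b1 b2 h]]; first exact: bounded_measurableC_val.
have bv := @bounded_measurableC_val R.
split; [exact: (bmCp mz1 bv b1)|exact: (bmCp mz2 bv b2)|].
move=> c a b; have D (z : T -> circle R) rho w :
    c * (monomial a b (z w) * (cval (z w) * rho w)) = c * (monomial a.+1 b (z w) * rho w).
  by rewrite /monomial exprS; ring.
by under eq_expect do rewrite D; under [RHS]eq_expect do rewrite D.
Qed.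

Lemma multiplier_conj_val : multiplier (fun w => conjc (cval w)).
Proof.
have bc := bounded_measurableC_conj (@bounded_measurableC_val R).
split=> [//|rho1 rho2 [b1 b2 h]].
split; [exact: (bmCp mz1 bc b1)|exact: (bmCp mz2 bc b2)|].
move=> c a b; have D (z : T -> circle R) rho w :
    c * (monomial a b (z w) * (conjc (cval (z w)) * rho w)) = c * (monomial a b.+1 (z w) * rho w).
  by rewrite /monomial [in RHS]exprS; ring.
by under eq_expect do rewrite D; under [RHS]eq_expect do rewrite D.
Qed.

Definition real_multiplier (p : circle R -> R) := multiplier (fun w => (p w)%:C%C).

Lemma real_multiplier_bm p : real_multiplier p -> bounded_measurable p.
Proof. by move=> [[]]. Qed.

Lemma real_multiplier_cst r : real_multiplier (fun=> r).
Proof. exact: multiplier_cst. Qed.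

Lemma real_multiplierM p q : real_multiplier p -> real_multiplier q ->
  real_multiplier (fun w => p w * q w).
Proof.
by move=> hp hq; rewrite /real_multiplier; under eq_fun do rewrite rmorphM; exact: multiplierM.
Qed.

Lemma real_multiplierD p q : real_multiplier p -> real_multiplier q ->
  real_multiplier (fun w => p w + q w).
Proof.
by move=> hp hq; rewrite /real_multiplier; under eq_fun do rewrite rmorphD; exact: multiplierD.
Qed.

Lemma real_multiplierZ r p : real_multiplier p -> real_multiplier (fun w => r * p w).
Proof. by move=> hp; apply: real_multiplierM => //; exact: real_multiplier_cst. Qed.

Lemma real_multiplierB p q : real_multiplier p -> real_multiplier q ->
  real_multiplier (fun w => p w - q w).
Proof.
move=> hp hq; under eq_fun do rewrite -mulN1r; apply: real_multiplierD => //.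
exact: real_multiplierZ.
Qed.

Lemma real_multiplierX p n : real_multiplier p -> real_multiplier (fun w => p w ^+ n).
Proof.
move=> hp; elim: n => [|n IH].
  by under eq_fun do rewrite expr0; exact: real_multiplier_cst.
by under eq_fun do rewrite exprS; exact: real_multiplierM.
Qed.

Lemma real_multiplier_lim (p_ : nat -> circle R -> R) p K :
  (forall n, real_multiplier (p_ n)) -> (forall n w, `|p_ n w| <= K) ->
  (forall w, p_ n w @[n --> \oo] --> p w) -> real_multiplier p.
Proof.
move=> hp pK pcvg.
have bp : bounded_measurable p.
  split.
    by apply: (measurable_fun_cvg _ (fun w _ => pcvg w)) => n; exact: (real_multiplier_bm (hp n)).1.
  exists K => w; rewrite leNgt; apply/negP => Kp.
  have /cvgrPdist_lt /(_ (`|p w| - K)) := pcvg w; rewrite subr_gt0 => /(_ Kp) [n _ /(_ n (leqnn _))] /=.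
  by have := pK n w; have := lerB_dist (p w) (p_ n w); lra.
have bpC := bounded_measurableC_real bp.
split=> // rho1 rho2 rr; have [b1 b2 _] := rr;
split; [exact: (bmCp mz1 bpC b1)|exact: (bmCp mz2 bpC b2)|].
move=> c a b.
pose F (z : T -> circle R) rho w := Re (c * (monomial a b (z w) * rho w)).
have L (q : circle R -> R) (z : T -> circle R) rho w :
  Re (c * (monomial a b (z w) * ((q (z w))%:C%C * rho w))) = q (z w) * F z rho w.
  by rewrite /F -cReZ; congr Re; ring.
have lim (z : T -> circle R) rho : measurable_fun [set: T] z -> bmC rho ->
   E (fun w => p_ n (z w) * F z rho w) @[n --> \oo] --> E (fun w => p (z w) * F z rho w).
  move=> mz br; have bF : bounded_measurable (F z rho) by exact: bm_test.
  have [K' hK'] := bF.2.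
  apply: (@expect_dominated_convergence _ _ _ P (fun n w => p_ n (z w) * F z rho w) _ (K * K')).
  - by move=> n; apply: (bounded_measurableM _ bF).1; exact: (bounded_measurable_precomp mz (real_multiplier_bm (hp n))).
  - by apply: bounded_measurableM => //; exact: (bounded_measurable_precomp mz bp).
  - by move=> n w; rewrite normrM ler_pM.
  - by apply: aeW => w; apply: cvgMl; exact: pcvg.
under eq_expect do rewrite L; under [RHS]eq_expect do rewrite L.
have l1 := lim z1 rho1 mz1 b1; have l2 := lim z2 rho2 mz2 b2.
apply: (cvg_unique _ l1) => //.
apply: cvg_trans l2; apply: near_eq_cvg; apply: nearW => n.
have [_ _ /(_ c a b)] := (hp n).2 _ _ rr.
under eq_expect do rewrite L; under [X in _ = X -> _]eq_expect do rewrite L.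
by move=> ->.
Qed.

(* Increases to [|x|] when [|x| <= 1]. *)
Let abs_approx := fix s n (x : R) : R :=
  if n is m.+1 then s m x + (x ^+ 2 - s m x ^+ 2) / 2 else 0.

Lemma abs_approx_bounds n x : `|x| <= 1 ->
  0 <= abs_approx n x /\ 0 <= `|x| - abs_approx n x <= (1 - `|x| / 2) ^+ n * `|x|.
Proof.
move=> x1; elim: n => [|n [s0 /andP[s1 s2]]].
  by rewrite /= subr0 expr0 mul1r normr_ge0 lexx.
have E1 : `|x| - abs_approx n.+1 x = (`|x| - abs_approx n x) * (1 - (`|x| + abs_approx n x) / 2).
  by rewrite /= -(real_normK (num_real x)); field.
have n0 := normr_ge0 x.
split; last first.
  rewrite E1; set t := abs_approx n x in s0 s1 s2 *; apply/andP; split.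
    by apply: mulr_ge0 => //; lra.
  rewrite exprS -mulrA mulrC; apply: ler_pM => //; lra.
rewrite /= -(real_normK (num_real x)); set t := abs_approx n x in s0 s1 s2 *.
by nra.
Qed.

Lemma real_multiplier_norm p : real_multiplier p -> (forall w, `|p w| <= 1) ->
  real_multiplier (fun w => `|p w|).
Proof.
move=> hp p1; apply: (@real_multiplier_lim (fun n w => abs_approx n (p w)) _ 1).
- elim=> [|n IH]; first exact: real_multiplier_cst.
  apply: real_multiplierD => //; under eq_fun do rewrite mulrC; apply: real_multiplierZ.
  by apply: real_multiplierB; exact: real_multiplierX.
- by move=> n w; have [h0 /andP[h1 _]] := abs_approx_bounds n (p1 w);
    rewrite ger0_norm//; have := p1 w; lra.
move=> w; have [->|pw0] := eqVneq (p w) 0.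
  rewrite normr0; apply: cvg_near_cst; apply: nearW => n.
  have n01 : `|0 : R| <= 1 by rewrite normr0 ler01.
  have [h0 /andP[h1 _]] := abs_approx_bounds n n01.
  by move: h1; rewrite normr0; lra.
have pw : 0 < `|p w| by rewrite normr_gt0.
have c0 : (1 - `|p w| / 2) ^+ n * `|p w| @[n --> \oo] --> 0.
  rewrite -[X in _ --> X](mul0r `|p w|); apply: cvgMl.
  by apply: cvg_expr; have := p1 w; rewrite ltr_norml; lra.
have cB : `|p w| - abs_approx n (p w) @[n --> \oo] --> 0.
  apply: (squeeze_cvgr _ (cvg_cst 0) c0); apply: nearW => n.
  exact: (abs_approx_bounds n (p1 w)).2.
exact: cvg_subr_cvg0.
Qed.

(** The passage from functions to sets: [q] is the positive part of [p], and [1 - (1 - q) ^ n] tends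
    to the indicator of [q > 0]. *)
Lemma real_multiplier_pos p : real_multiplier p -> (forall w, `|p w| <= 1) ->
  real_multiplier (\1_[set w | 0 < p w]).
Proof.
move=> hp p1; pose q w := (p w + `|p w|) / 2.
have hq : real_multiplier q.
  rewrite /q; under eq_fun do rewrite mulrC; apply/real_multiplierZ/real_multiplierD => //.
  exact: real_multiplier_norm.
have q01 w : 0 <= q w <= 1.
  have := p1 w; have := ler_norm (p w); have := lerNnormlW (lexx `|p w|).
  by rewrite /q => *; apply/andP; split; lra.
apply: (@real_multiplier_lim (fun n w => 1 - (1 - q w) ^+ n) _ 1).
- move=> n; apply: real_multiplierB; first exact: real_multiplier_cst.
  by apply/real_multiplierX/real_multiplierB => //; exact: real_multiplier_cst.
- move=> n w; have /andP[q0 q1] := q01 w.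
  have h1 : 0 <= (1 - q w) ^+ n by rewrite exprn_ge0// subr_ge0.
  have h2 : (1 - q w) ^+ n <= 1 by rewrite exprn_ile1// ?subr_ge0// gerBl.
  by rewrite ger0_norm; lra.
move=> w; rewrite indicE; have /andP[q0 q1] := q01 w.
case: (boolP (w \in _)) => [/set_mem /= pw|/negP pw].
  have qw : q w = p w by rewrite /q gtr0_norm//; lra.
  rewrite -[X in _ --> X]subr0; apply: cvgB; first exact: cvg_cst.
  by apply: cvg_expr; rewrite qw ltr_norml; have := p1 w; rewrite ler_norml; lra.
have pw' : p w <= 0 by rewrite leNgt; apply/negP => h; apply: pw; rewrite inE.
have qw : q w = 0 by rewrite /q ler0_norm//; lra.
by apply: cvg_near_cst; apply: nearW => n; rewrite qw subr0 expr1n subrr.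
Qed.

(** [r ^ 2 - |w - c| ^ 2] is a polynomial in [w] and its conjugate, positive exactly on the disc;
    dividing by a bound brings its modulus below 1. *)
Lemma real_multiplier_disc (c : R[i]) (r : R) :
  real_multiplier (\1_[set w | normc (cval w - c) < r]).
Proof.
have [r0|r0] := leP r 0.
  rewrite (_ : [set _ | _] = set0).
    have -> : \1_(set0 : set (circle R)) = (fun=> 0 : R) by apply/funext => w; rewrite indic0.
    exact: real_multiplier_cst.
  by apply/seteqP; split=> // w /=; rewrite ltNge (le_trans r0)// normc_ge0.
pose p (w : circle R) := r ^+ 2 - normc (cval w - c) ^+ 2.
have hp : real_multiplier p.
  rewrite /real_multiplier.
  have -> : (fun w => (p w)%:C%C) = (fun w => (r ^+ 2)%:C%C +
     (-1) * ((cval w + - c) * (conjc (cval w) + - conjc c))).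
    apply/funext => w; rewrite /p sqr_normcE; case: (cval w) => x y; case: (c) => u v.
    by apply/eqP; rewrite eq_complex; apply/andP; split; apply/eqP; rewrite /= ?ReImE/=; ring.
  apply: multiplierD; first exact: multiplier_cst.
  apply: multiplierM; first exact: multiplier_cst.
  by apply: multiplierM; apply: multiplierD; rewrite ?multiplier_cst//;
    [exact: multiplier_val|exact: multiplier_cst|exact: multiplier_conj_val|exact: multiplier_cst].
have [_ [K hK]] := real_multiplier_bm hp.
have L0 : 0 < `|K| + 1 by rewrite ltr_wpDl.
have := @real_multiplier_pos _ (real_multiplierZ (`|K| + 1)^-1 hp).
rewrite (_ : [set w | 0 < (`|K| + 1)^-1 * p w] = [set w | normc (cval w - c) < r]).
  apply=> w; rewrite normrM gtr0_norm ?invr_gt0// mulrC ler_pdivrMr// mul1r.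
  by apply: le_trans (hK w) _; have := ler_norm K; lra.
by apply/seteqP; split=> w /=; rewrite pmulr_rgt0 ?invr_gt0// subr_gt0 ltr_pXn2r ?nnegrE ?normc_ge0// ltW.
Qed.

(** The indicator is the limit of [1 - prod (1 - 1_(A_ i))], which does not ask for disjoint sets:
    stability under products replaces a pi-lambda argument. *)
Lemma real_multiplier_bigcup (A_ : nat -> set (circle R)) :
  (forall n, real_multiplier (\1_(A_ n))) -> real_multiplier (\1_(\bigcup_n A_ n)).
Proof.
move=> hA.
apply: (@real_multiplier_lim (fun n w => 1 - \prod_(i < n) (1 - \1_(A_ i) w)) _ 1).
- move=> n; apply: real_multiplierB; first exact: real_multiplier_cst.
  elim: n => [|n IH]; first by under eq_fun do rewrite big_ord0; exact: real_multiplier_cst.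
  under eq_fun do rewrite big_ord_recr; apply: real_multiplierM => //.
  by apply: real_multiplierB => //; exact: real_multiplier_cst.
- move=> n w; have : 0 <= \prod_(i < n) (1 - \1_(A_ i) w : R) <= 1.
    elim: n => [|n /andP[h1 h2]]; first by rewrite big_ord0 ler01 lexx.
    rewrite big_ord_recr /= indicE; case: (_ \in _); rewrite ?subrr ?mulr0 ?ler01 ?lexx//.
    by rewrite subr0 mulr1 h1.
  by move=> /andP[h1 h2]; rewrite ger0_norm; lra.
move=> w; rewrite indicE; case: (boolP (w \in _)) => [/set_mem [n _ /= Aw]|/negP Aw].
  apply: cvg_near_cst; exists n.+1 => // m /= nm.
  by rewrite (bigD1 (Ordinal nm))//= indicE mem_set// subrr mul0r subr0.
apply: cvg_near_cst; apply: nearW => n; rewrite big1 ?subrr// => i _.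
rewrite indicE; case: (boolP (w \in _)) => [/set_mem Aw'|]; last by rewrite subr0.
by exfalso; apply: Aw; rewrite inE; exists i.
Qed.

Lemma real_multiplier_indic A : measurable A -> real_multiplier (\1_A).
Proof.
move=> mA; pose G : set (set (circle R)) := [set B | real_multiplier (\1_B)].
suff : <<s @circle_open R >> `<=` G by apply; exact: mA.
apply: smallest_sub.
  split.
  - have -> : G set0 = real_multiplier (fun=> 0) by rewrite /G/=; congr real_multiplier; apply/funext => w; rewrite indic0.
    exact: real_multiplier_cst.
  - move=> B hB; rewrite setTD /G /=.
    have -> : \1_(~` B) = (fun w => 1 - \1_B w) :> (circle R -> R).
      by apply/funext => w; rewrite !indicE in_setC; case: (w \in B); rewrite /= ?subrr ?subr0.
    by apply: real_multiplierB => //; exact: real_multiplier_cst.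
  - by move=> F hF; exact: real_multiplier_bigcup.
move=> _ [U oU <-]; rewrite /G /=.
have [F UF] := open_countable_discs oU.
rewrite (_ : _ @^-1` _ = \bigcup_n [set w | normc (cval w - (F n).1) < (F n).2]).
  by apply: real_multiplier_bigcup => n; exact: real_multiplier_disc.
apply/seteqP; split=> w /=; first by move=> /UF[n hn]; exists n.
by move=> [n _ hn]; apply/UF; exists n.
Qed.

Lemma real_multiplier_of_bm p : bounded_measurable p -> real_multiplier p.
Proof.
apply: bounded_measurable_ind => [||f_ f K|].
- exact: real_multiplierD.
- exact: real_multiplierZ.
- exact: real_multiplier_lim.
- exact: real_multiplier_indic.
Qed.

(** Carries equalities of Fourier coefficients over to all bounded measurable test functions. With
    equal maps and [rho2 = 0] it says that [rho1] has conditional mean zero; with both weights equal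
    to 1, that the two maps have the same law. *)
Lemma expect_eq_of_moments rho1 rho2 g : same_moments rho1 rho2 -> bmC g ->
  E (fun w => Re (g (z1 w) * rho1 w)) = E (fun w => Re (g (z2 w) * rho2 w)).
Proof.
move=> rr [/real_multiplier_of_bm gR /real_multiplier_of_bm gI].
have [_ /(_ _ _ rr)[_ _ /(_ 1 0%N 0%N)]] := multiplierD gR (multiplierM (multiplier_cst 'i%C) gI).
have D (z : T -> circle R) rho w : 1 * (monomial 0 0 (z w) * (((Re (g (z w)))%:C%C + 'i%C * (Im (g (z w)))%:C%C) * rho w)) = g (z w) * rho w.
  rewrite /monomial !expr0 !mul1r; congr (_ * _).
  by rewrite [RHS]complexE.
by under eq_expect do rewrite D; under [X in _ = X -> _]eq_expect do rewrite D.
Qed.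

End multipliers.

(** * Complex expectations and circle means *)

Section has_mean.
Context d (T : measurableType d) (R : realType) (P : probability T R).
Local Notation Re := complex.Re.
Local Notation Im := complex.Im.
Local Notation E := (expect P).
Local Notation bmC := bounded_measurableC.
Implicit Types (G H : T -> R[i]) (L M : R[i]).

(** Complex expectations are handled through real integrals: testing all multiples [c] recovers the
    real and the imaginary part. *)
Definition has_mean G L :=
  bmC G /\ forall c : R[i], E (fun w => Re (c * G w)) = Re (c * L).

Let bm_ReZ (c : R[i]) G : bmC G -> bounded_measurable (fun w => Re (c * G w)).
Proof.
move=> bG; have bc : bmC (fun _ : T => c) by exact: bounded_measurableC_cst.
exact: (bounded_measurableCM bc bG).1.
Qed.

Lemma exists_mean G : bmC G -> exists L, has_mean G L.
Proof.
move=> bG; have [bR bI] := bG.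
exists (E (fun w => Re (G w)) +i* E (fun w => Im (G w)))%C; split => // c.
under eq_expect do rewrite cReM.
rewrite expectB; [|exact: bounded_measurableM (bounded_measurable_cst _ _) bR|
  exact: bounded_measurableM (bounded_measurable_cst _ _) bI].
by rewrite !expectZ// cReM.
Qed.

Lemma has_mean_cst c : has_mean (fun=> c) c.
Proof. by split=> [|c']; [exact: bounded_measurableC_cst|rewrite expect_cst]. Qed.

Lemma has_meanD G H L M : has_mean G L -> has_mean H M ->
  has_mean (fun w => G w + H w) (L + M).
Proof.
move=> [bG hG] [bH hH]; split=> [|c]; first exact: bounded_measurableCD.
under eq_expect do rewrite mulrDr cReD.
by rewrite expectD ?hG ?hH ?mulrDr ?cReD//; exact: bm_ReZ.
Qed.

Lemma has_meanZ c G L : has_mean G L -> has_mean (fun w => c * G w) (c * L).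
Proof.
move=> [bG hG]; split=> [|c'].
  by apply: bounded_measurableCM bG; exact: bounded_measurableC_cst.
by under eq_expect do rewrite mulrA; rewrite hG mulrA.
Qed.

Lemma has_meanB G H L M : has_mean G L -> has_mean H M ->
  has_mean (fun w => G w - H w) (L - M).
Proof.
move=> hG /(has_meanZ (-1)) hH; rewrite -mulN1r.
by under eq_fun do rewrite -mulN1r; exact: has_meanD.
Qed.

Lemma has_mean_conj G L : has_mean G L -> has_mean (fun w => conjc (G w)) (conjc L).
Proof.
move=> [bG hG]; split=> [|c]; first exact: bounded_measurableC_conj.
have D x : Re (c * conjc x) = Re (conjc c * x) by case: c x => [? ?] [? ?] /=; ring.
by under eq_expect do rewrite D; rewrite hG D.
Qed.

Lemma has_mean_le G L K : 0 <= K -> has_mean G L -> (forall w, normc (G w) <= K) ->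
  normc L <= K.
Proof.
move=> K0 [bG hG] GK.
have h : normc L ^+ 2 <= normc L * K.
  rewrite sqr_normcE (_ : _ + _ = Re (conjc L * L)); last by case: (L) => ? ? /=; ring.
  rewrite -hG; apply: le_trans (ler_norm _) _.
  rewrite -[leRHS](expect_cst P); apply: expect_norm_le; first exact: bm_ReZ.
    exact: bounded_measurable_cst.
  move=> w; apply: le_trans (norm_Re_le _) _; rewrite normcM.
  have -> : normc (conjc L) = normc L by case: (L) => a b /=; rewrite sqrrN.
  by rewrite ler_wpM2l// normc_ge0.
have [L0|L0] := eqVneq (normc L) 0; first by rewrite L0.
by move: h; rewrite expr2 ler_pM2l// lt_neqAle eq_sym L0 normc_ge0.
Qed.

Lemma eq_has_mean G H L : G =1 H -> has_mean G L -> has_mean H L.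
Proof. by move=> /funext ->. Qed.

Lemma has_mean_Re G L : has_mean G L -> E (fun w => Re (G w)) = Re L.
Proof. by move=> [_ /(_ 1)]; rewrite mul1r => <-; apply: eq_expect => w; rewrite mul1r. Qed.

Lemma has_mean_lim (G_ : nat -> T -> R[i]) G (L_ : nat -> R[i]) L K :
  (forall n, has_mean (G_ n) (L_ n)) -> (forall n w, normc (G_ n w) <= K) -> bmC G ->
  {ae P, forall w, normc (G_ n w - G w) @[n --> \oo] --> 0} ->
  normc (L_ n - L) @[n --> \oo] --> 0 -> has_mean G L.
Proof.
move=> hG GK bG aG cL; split=> // c.
have Rcvg (u : nat -> R[i]) v : normc (u n - v) @[n --> \oo] --> 0 ->
    Re (c * u n) @[n --> \oo] --> Re (c * v).
  move=> uv; apply: cvg_subr_cvg0; apply: norm_cvg0.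
  have c0 : normc c * normc (u n - v) @[n --> \oo] --> 0.
    by rewrite -[X in _ --> X](mulr0 (normc c)); apply: cvgMr.
  apply: (squeeze_cvgr _ (cvg_cst 0) c0); apply: nearW => n; rewrite normr_ge0/=.
  by rewrite distrC -cReN -cReD -mulrN -mulrDr -normcM norm_Re_le.
apply: (cvg_unique _ _ (Rcvg _ _ cL)) => //.
have -> : (fun n => Re (c * L_ n)) = (fun n => E (fun w => Re (c * G_ n w))).
  by apply/funext => n; rewrite (hG n).2.
apply: (@expect_dominated_convergence _ _ _ P (fun n w => Re (c * G_ n w)) _ (normc c * K)).
- by move=> n; exact: (bm_ReZ c (hG n).1).1.
- exact: bm_ReZ.
- move=> n w; apply: le_trans (norm_Re_le _) _.
  by rewrite normcM ler_wpM2l// normc_ge0.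
- by apply: filterS aG => w; exact: Rcvg.
Qed.

End has_mean.

Section circle_means.
Context (R : realType).
Local Notation Re := complex.Re.
Local Notation Im := complex.Im.
Local Notation P := (@circle_measure R).
Local Notation E := (expect P).
Local Notation bmC := bounded_measurableC.
Local Notation cval := (@circle_val R).
Implicit Types F f : R[i]^o -> R[i]^o.

Lemma expect_circle (h : circle R -> R) : bounded_measurable h ->
  E h = segment_integral (fun t => h (circle_param t)) 0 1.
Proof.
move=> bh; have mparam := @measurable_circle_param R.
pose mu0 := mrestr (@lebesgue_measure R) (measurable_itv `[0%R, 1%R[).
have bg : bounded_measurable (fun t : measurableTypeR R => h (circle_param t)).
  exact: (bounded_measurable_precomp mparam bh).
have mu0T : mu0 [set: measurableTypeR R] = 1%E.
  by rewrite /mu0 /mrestr setTI lebesgue_measure_itv /= lte_fin ltr01 oppr0 adde0.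
have ig : mu0.-integrable [set: measurableTypeR R] (EFin \o (fun t => h (circle_param t))).
  apply: measurable_bounded_integrable => //; first by rewrite [X in (X < _)%E]mu0T ltry.
    exact: bg.1.
  have [K hK] := bg.2; exists K; split; first exact: num_real.
  by move=> x Kx w _ /=; rewrite (le_trans (hK w))// ltW.
rewrite /expect /Rintegral /segment_integral; congr fine.
rewrite /circle_measure (integral_pushforward mparam) //; last first.
  by apply/measurable_EFinP; exact: bh.1.
rewrite preimage_setT.
have -> : (\int[mu0]_x (h (circle_param x))%:E =
  \int[mu0]_(x in `[0%R, 1%R[) (h (circle_param x))%:E)%E.
  pose N : set (measurableTypeR R) := ~` [set` `[0%R : R, 1%R[].
  rewrite (negligible_integral (N := N)) ?setTD ?setCK//.
  - exact: measurableC.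
  - by rewrite /= /mrestr /N setICl measure0.
have -> : (\int[mu0]_(x in `[0%R, 1%R[) (h (circle_param x))%:E =
  \int[lebesgue_measure]_(x in `[0%R, 1%R[) (h (circle_param x))%:E)%E.
  by apply: eq_measure_integral => A mA A01; rewrite /= /mrestr setIidl.
by rewrite integral_itv_bndo_bndc//; apply/measurable_EFinP; exact: measurable_funTS bg.1.
Qed.

Lemma circle_mean_constant F (L : R[i]) (r s : R) : punctured_disc_derivable F ->
  (forall r : R, 0 < r < 1 -> bmC (fun w => F (r%:C%C * cval w))) ->
  0 < r < 1 -> 0 < s < 1 ->
  has_mean P (fun w => F (r%:C%C * cval w)) L -> has_mean P (fun w => F (s%:C%C * cval w)) L.
Proof.
move=> dF bF hr hs [_ hL]; split=> [|c]; first exact: bF.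
(* Multiplication by ['i] moves the real part wanted here to the imaginary part that
   [circle_integral_constant] compares. *)
have key t : 0 < t < 1 -> E (fun w => Re (c * F (t%:C%C * cval w))) =
    segment_integral (fun x => Im ('i%C * c * F (t%:C%C * circle_exp x))) 0 1.
  move=> ht.
  have bc : bmC (fun _ : circle R => c) by exact: bounded_measurableC_cst.
  rewrite (expect_circle (bounded_measurableCM bc (bF t ht)).1); congr segment_integral.
  apply/funext => x; rewrite /circle_val /=; set y := F _.
  by rewrite -mulrA; case: (c * y) => a b /=; ring.
have dg : punctured_disc_derivable (fun z => 'i%C * c * F z).
  by move=> z hz; apply: derivableZ; exact: dF.
rewrite (key s hs) -(hL c) (key r hr).
exact: (circle_integral_constant dg hs hr).
Qed.

Definition limit_at0 F (L : R[i]) := forall e : R, 0 < e -> exists2 d : R, 0 < d &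
  forall z : R[i], 0 < normc z < d -> normc (F z - L) <= e.

(** Stands in for Cauchy's formula and for the removal of singularities: the mean is the same on all
    circles, and on a small circle it is close to the limit at the origin. *)
Lemma circle_mean_limit F L (r : R) : punctured_disc_derivable F ->
  (forall r : R, 0 < r < 1 -> bmC (fun w => F (r%:C%C * cval w))) ->
  limit_at0 F L -> 0 < r < 1 -> has_mean P (fun w => F (r%:C%C * cval w)) L.
Proof.
move=> dF bF lF hr; have [M hM] := exists_mean P (bF r hr).
suff -> : L = M by [].
apply/eqP; rewrite eq_sym -subr_eq0; apply/eqP; apply: eq0_normc.
apply: le_anti; rewrite normc_ge0 andbT; apply/ler_addgt0Pr => e e0; rewrite add0r.
have [d d0 hd] := lF e e0.
pose s : R := Num.min (d / 2) (1 / 2).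
have [s0 sd s1] : [/\ 0 < s, s < d & s < 1].
  by rewrite lt_min !gt_min; split; [apply/andP; split|apply/orP; left|apply/orP; right]; lra.
have hs : 0 < s < 1 by rewrite s0.
have hMs := circle_mean_constant dF bF hr hs hM.
apply: (has_mean_le (ltW e0) (has_meanB hMs (has_mean_cst P L))) => w; apply: hd.
rewrite normcM normc_circle mulr1 /= expr0n addr0 sqrtr_sqr ger0_norm ?s0//; exact: ltW.
Qed.

Lemma limit_at0M F G (L M : R[i]) : limit_at0 F L -> limit_at0 G M ->
  limit_at0 (fun z => F z * G z) (L * M).
Proof.
move=> lF lG e e0; have L0 := normc_ge0 L; have M0 := normc_ge0 M.
pose e' : R := Num.min 1 (e / (normc L + normc M + 1)).
have S0 : 0 < normc L + normc M + 1 by lra.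
have e'0 : 0 < e' by rewrite lt_min ltr01 divr_gt0.
have [d d0 hd] := lF e' e'0; have [d' d'0 hd'] := lG e' e'0.
exists (Num.min d d'); first by rewrite lt_min d0.
move=> z /andP[z0]; rewrite lt_min => /andP[zd zd'].
have a1 := hd z; have a2 := hd' z; rewrite z0 zd zd' in a1 a2.
have {}a1 := a1 isT; have {}a2 := a2 isT.
rewrite (_ : _ - _ = (F z - L) * (G z - M) + (F z - L) * M + L * (G z - M)); last by ring.
apply: le_trans (le_normcD _ _) _; apply: le_trans (lerD (le_normcD _ _) (lexx _)) _.
rewrite !normcM.
have [e1 e2] : e' <= 1 /\ e' * (normc L + normc M + 1) <= e.
  by rewrite -ler_pdivlMr// !ge_min !lexx orbT.
have := ler_pM (normc_ge0 _) (normc_ge0 _) a1 a2.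
have := ler_wpM2r M0 a1; have := ler_wpM2l L0 a2.
have : e' * e' <= e' by rewrite ler_piMr// ltW.
lra.
Qed.

Lemma derivable_lipschitz F (z : R[i]^o) : derivable F z 1 ->
  exists K d : R, [/\ 0 < K, 0 < d & forall h, normc h < d ->
    normc (F (z + h) - F z) <= K * normc h].
Proof.
move=> dF; have [d d0 hd] := derivable_normc dF ltr01.
exists (normc ('D_1 F z) + 1), d; split=> // [|h /hd hh].
  by rewrite ltr_wpDl// normc_ge0.
rewrite -(subrK ('D_1 F z * h) (F (z + h) - F z)); apply: le_trans (le_normcD _ _) _.
by rewrite mulrDl normcM addrC lerD2l.
Qed.

Lemma normc_real (r : R) : 0 <= r -> normc r%:C%C = r.
Proof. by move=> r0; rewrite /= expr0n addr0 sqrtr_sqr ger0_norm. Qed.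

Lemma bounded_measurableC_radial F (r K : R) : 0 <= r ->
  (forall z : R[i]^o, normc z = r -> derivable F z 1) ->
  (forall z, normc z = r -> normc (F z) <= K) ->
  bmC (fun w => F (r%:C%C * cval w)).
Proof.
move=> r0 dF FK.
have nr w : normc (r%:C%C * cval w) = r by rewrite normcM normc_circle mulr1 normc_real.
apply: (@bounded_measurableC_circle _ _ K) => [w|w e e0]; first exact: FK.
have [K' [d [K0 d0 hd]]] := derivable_lipschitz (dF _ (nr w)).
have r1 : 0 < r + 1 by lra.
exists (Num.min (d / (r + 1)) (e / (K' * (r + 1)))).
  by rewrite lt_min !divr_gt0// mulr_gt0.
move=> v; rewrite lt_min !ltr_pdivlMr ?mulr_gt0// => /andP[h1 h2].
have nvw := normc_ge0 (cval v - cval w).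
have E1 : normc (r%:C%C * (cval v - cval w)) = r * normc (cval v - cval w).
  by rewrite normcM normc_real.
rewrite (_ : r%:C%C * cval v = r%:C%C * cval w + r%:C%C * (cval v - cval w)); last by ring.
apply: le_trans (hd _ _) _; rewrite E1; first by lra.
have := mulr_ge0 (ltW K0) nvw; lra.
Qed.

End circle_means.

(** * Boundary values of inner functions *)

Lemma cvg_normcP (R : realType) (T : Type) (F : set_system T) (FF : Filter F)
    (u : T -> R[i]^o) (l : R[i]^o) :
  u @ F --> l <-> forall e : R, 0 < e -> \forall x \near F, normc (u x - l) < e.
Proof.
split=> [/cvgrPdist_lt h e e0|h].
  have e0' : 0 < e%:C%C :> R[i] by rewrite ltcR.
  have := h _ e0'; apply: filterS => x; rewrite distrC complex_normE ltcR //.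
apply/cvgrPdist_lt => e e0; have [eE Re0] := complex_gt0E e0.
by have := h _ Re0; apply: filterS => x hx; rewrite distrC complex_normE eE ltcR.
Qed.

Lemma derivable_exp (K : numFieldType) (F : K^o -> K^o) (z : K^o) n :
  derivable F z 1 -> derivable (fun y => F y ^+ n : K^o) z 1.
Proof.
move=> dF; elim: n => [|n IH].
  by under eq_fun do rewrite expr0; exact: derivable_cst.
by under eq_fun do rewrite exprS; apply: (@derivableM _ _ F (fun y => F y ^+ n)).
Qed.

Section inner_moments.
Context (R : realType) (f : R[i]^o -> R[i]^o).
Hypotheses (f_inner : inner f) (f0 : f 0 = 0).
Local Notation Re := complex.Re.
Local Notation Im := complex.Im.
Local Notation P := (@circle_measure R).
Local Notation E := (expect P).
Local Notation bmC := bounded_measurableC.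
Local Notation cval := (@circle_val R).
Local Notation L1 := ('D_1 f 0 : R[i]).

Lemma inner_derivable (z : R[i]^o) : normc z < 1 -> derivable f z 1.
Proof.
by move=> z1; have [+ _ _] := f_inner; apply; rewrite complex_normE (ltcR _ 1).
Qed.

Lemma inner_lt1 (z : R[i]^o) : normc z < 1 -> normc (f z) < 1.
Proof.
have [_ h _] := f_inner; move=> z1.
by have := h z; rewrite !complex_normE !(ltcR _ 1); apply.
Qed.

Lemma inner_limit0 : limit_at0 f 0.
Proof.
move=> e e0; have z0 : normc (0 : R[i]) < 1 by rewrite normc0 ltr01.
have [K [d [K0 d0 hd]]] := derivable_lipschitz (inner_derivable z0).
exists (Num.min d (e / K)); first by rewrite lt_min d0 divr_gt0.
move=> z /andP[_]; rewrite lt_min ltr_pdivlMr// => /andP[/hd].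
by rewrite add0r f0 subr0 => h1 h2; rewrite (le_trans h1)// mulrC ltW.
Qed.

Lemma inner_quotient_limit0 : limit_at0 (fun z => f z / z) L1.
Proof.
move=> e e0; have z0 : normc (0 : R[i]) < 1 by rewrite normc0 ltr01.
have [d d0 hd] := derivable_normc (inner_derivable z0) e0.
exists d => // z /andP[z_gt0 /hd]; rewrite add0r f0 subr0 => h.
have z_neq0 : z != 0 by apply/eqP => zE; move: z_gt0; rewrite zE normc0 ltxx.
rewrite (_ : f z / z - L1 = (f z - L1 * z) / z); last by field.
by rewrite normcM normcV ler_pdivrMr.
Qed.

Lemma derivable_inner_monomial (k j : nat) (z : R[i]^o) : 0 < normc z < 1 ->
  derivable (fun y : R[i]^o => f y ^+ j / y ^+ k : R[i]^o) z 1.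
Proof.
move=> /andP[z0 z1].
have z_neq0 : z != 0 by apply/eqP => zE; move: z0; rewrite zE normc0 ltxx.
apply: (@derivableM _ _ (fun y : R[i]^o => f y ^+ j) (fun y : R[i]^o => (y ^+ k)^-1)).
  by apply: derivable_exp; exact: inner_derivable.
apply: derivableV; first by rewrite expf_neq0.
by apply: (@derivable_exp _ id); exact: derivable_id.
Qed.

Lemma normc_radial (r : R) (w : circle R) : 0 <= r -> normc (r%:C%C * cval w) = r.
Proof. by move=> r0; rewrite normcM normc_circle mulr1 normc_real. Qed.

Lemma bounded_measurableC_inner (r : R) : 0 <= r < 1 -> bmC (fun w => f (r%:C%C * cval w)).
Proof.
move=> /andP[r0 r1]; apply: (@bounded_measurableC_radial _ _ _ 1) => // z zr.
  by apply: inner_derivable; rewrite zr.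
by apply/ltW/inner_lt1; rewrite zr.
Qed.

Lemma circle_conj (w : circle R) : cval w * conjc (cval w) = 1.
Proof.
have := sqr_normcE (cval w); rewrite normc_circle expr1n.
case: (cval w) => a b /= h; apply/eqP; rewrite eq_complex /=; apply/andP; split; apply/eqP.
  by rewrite h; ring.
ring.
Qed.

Lemma circle_inv (w : circle R) : (cval w)^-1 = conjc (cval w).
Proof.
have h := circle_conj w; have w0 : cval w != 0.
  by apply/eqP => w0; move: h; rewrite w0 mul0r => /esym/eqP; rewrite oner_eq0.
by apply: (mulfI w0); rewrite h divff.
Qed.

Let ratio k j (r : R) w : 0 < r ->
  f (r%:C%C * cval w) ^+ j / (r%:C%C * cval w) ^+ k =
  (r%:C%C ^+ k)^-1 * (conjc (cval w) ^+ k * f (r%:C%C * cval w) ^+ j).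
Proof.
by move=> r0; rewrite exprMn invfM -(exprVn (cval w)) circle_inv; ring.
Qed.

Let bm_ratio k j (r : R) : 0 < r < 1 ->
  bmC (fun w => conjc (cval w) ^+ k * f (r%:C%C * cval w) ^+ j).
Proof.
move=> /andP[r0 r1]; apply: bounded_measurableCM; apply: bounded_measurableCX.
  exact: (bounded_measurableC_conj (@bounded_measurableC_val R)).
by apply: bounded_measurableC_inner; rewrite (ltW r0).
Qed.

Let bm_quot k j (r : R) : 0 < r < 1 ->
  bmC (fun w => f (r%:C%C * cval w) ^+ j / (r%:C%C * cval w) ^+ k).
Proof.
move=> hr; have /andP[r0 _] := hr.
under eq_fun do rewrite ratio//.
apply: bounded_measurableCM (bm_ratio k j hr); exact: bounded_measurableC_cst.
Qed.

Let real_neq0 (r : R) k : 0 < r -> r%:C%C ^+ k != 0 :> R[i].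
Proof. by move=> r0; rewrite expf_neq0// fmorph_eq0 gt_eqF. Qed.

Let unratio k j (r : R) L : 0 < r ->
  has_mean P (fun w => f (r%:C%C * cval w) ^+ j / (r%:C%C * cval w) ^+ k) L ->
  has_mean P (fun w => conjc (cval w) ^+ k * f (r%:C%C * cval w) ^+ j) (r%:C%C ^+ k * L).
Proof.
move=> r0 /(has_meanZ (r%:C%C ^+ k)); apply: eq_has_mean => w.
by rewrite ratio// mulVKf// real_neq0.
Qed.

(** [f ^ j / z ^ k] may have a pole at the origin, so its mean is not identified, but it is the same
    [L] for all radii; on the circle [1 / z] is the conjugate, and the radius contributes the factor
    [r ^ k]. *)
Lemma exists_negative_moment k j : exists L : R[i], forall r : R, 0 < r < 1 ->
  has_mean P (fun w => conjc (cval w) ^+ k * f (r%:C%C * cval w) ^+ j) (r%:C%C ^+ k * L).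
Proof.
have h2 : 0 < (2^-1 : R) < 1 by apply/andP; split; lra.
have [L hL] := exists_mean P (bm_quot k j h2); exists L => r hr.
apply: unratio; first by case/andP: hr.
apply: (@circle_mean_constant _ (fun z => f z ^+ j / z ^+ k) L 2^-1 r) => //.
  by move=> z; exact: derivable_inner_monomial.
by move=> s; exact: bm_quot.
Qed.

(** [f ^ (k + m) / z ^ k = (f / z) ^ k f ^ m], where the first factor tends to [L1 ^ k] at the
    origin and the second to [0 ^ m]; the latter is 1 for [m = 0], so that both cases are covered at
    once. *)
Lemma negative_moment k m (r : R) : 0 < r < 1 ->
  has_mean P (fun w => conjc (cval w) ^+ k * f (r%:C%C * cval w) ^+ (k + m))
    (r%:C%C ^+ k * (L1 ^+ k * 0 ^+ m)).
Proof.
move=> hr; apply: unratio; first by case/andP: hr.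
apply: (@circle_mean_limit _ (fun z => f z ^+ (k + m) / z ^+ k)) => //.
- by move=> z; exact: derivable_inner_monomial.
- by move=> s; exact: bm_quot.
have -> : (fun z : R[i]^o => f z ^+ (k + m) / z ^+ k : R[i]^o) =
    (fun z => (f z / z) ^+ k * f z ^+ m).
  by apply/funext => z; rewrite exprMn exprVn exprD; ring.
have limX (F : R[i]^o -> R[i]^o) L n : limit_at0 F L -> limit_at0 (fun z => F z ^+ n) (L ^+ n).
  move=> lF; elim: n => [|n IH].
    by move=> e e0; exists 1 => // z _; rewrite !expr0 subrr normc0 ltW.
  rewrite exprS (_ : (fun z => F z ^+ n.+1) = (fun z => F z * F z ^+ n)).
    exact: limit_at0M.
  by apply/funext => z; rewrite exprS.
by apply: limit_at0M; apply: limX; [exact: inner_quotient_limit0|exact: inner_limit0].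
Qed.

Lemma positive_moment k j (r : R) : (0 < k + j)%N -> 0 < r < 1 ->
  has_mean P (fun w => cval w ^+ k * f (r%:C%C * cval w) ^+ j) 0.
Proof.
move=> kj hr; have /andP[r0 r1] := hr.
pose F (z : R[i]^o) : R[i]^o := z ^+ k * f z ^+ j.
suff : has_mean P (fun w => F (r%:C%C * cval w)) 0.
  move=> /(has_meanZ (r%:C%C ^+ k)^-1); rewrite mulr0; apply: eq_has_mean => w.
  by rewrite /F exprMn -!mulrA mulKf// real_neq0.
have Fle (z : R[i]) : normc z < 1 -> normc (F z) <= 1.
  move=> z1; rewrite /F normcM !normcX; apply: mulr_ile1; rewrite ?exprn_ge0 ?normc_ge0//.
    by rewrite exprn_ile1// ?normc_ge0// ltW.
  by rewrite exprn_ile1// ?normc_ge0// ltW// inner_lt1.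
have Fder (z : R[i]^o) : normc z < 1 -> derivable F z 1.
  move=> z1; apply: (@derivableM _ _ (fun y : R[i]^o => y ^+ k) (fun y : R[i]^o => f y ^+ j)).
    by apply: (@derivable_exp _ id); exact: derivable_id.
  by apply: derivable_exp; exact: inner_derivable.
apply: circle_mean_limit => //.
- by move=> z /andP[_]; exact: Fder.
- move=> s /andP[s0 s1]; apply: (@bounded_measurableC_radial _ _ _ 1); first exact: ltW.
    by move=> z zs; apply: Fder; rewrite zs.
  by move=> z zs; apply: Fle; rewrite zs.
move=> e e0; have [d d0 hd] := inner_limit0 e0.
exists (Num.min (Num.min d e) 1); first by rewrite !lt_min d0 e0 ltr01.
move=> z; rewrite !lt_min => /andP[z0 /andP[/andP[zd ze] z1]].
have fz := hd z; rewrite z0 zd subr0 in fz; have {}fz := fz isT.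
rewrite subr0 /F normcM !normcX.
have nz := normc_ge0 z; have nf := normc_ge0 (f z); have fz1 := ltW (inner_lt1 z1).
have zk n : normc z ^+ n <= 1 by rewrite exprn_ile1// ltW.
have fk n : normc (f z) ^+ n <= 1 by rewrite exprn_ile1.
case: k kj @F Fle Fder => [|k] kj F _ _.
  case: j kj F => [//|j] _ _.
  rewrite expr0 mul1r exprS; apply: le_trans (_ : normc (f z) * 1 <= _); last by rewrite mulr1.
  by rewrite ler_wpM2l.
apply: le_trans (_ : normc z ^+ k.+1 * 1 <= _); first by rewrite ler_wpM2l// exprn_ge0.
rewrite mulr1 exprS; apply: le_trans (_ : normc z * 1 <= _); first by rewrite ler_wpM2l.
by rewrite mulr1 ltW.
Qed.

(** The shift by 2 keeps all these radii in []0, 1[]. *)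
Definition radius (n : nat) : R := 1 - n.+2%:R^-1.

Lemma radius_bounds n : 0 < radius n < 1.
Proof.
have n0 : 0 < n.+2%:R^-1 :> R by rewrite invr_gt0 ltr0n.
have n1 : n.+2%:R^-1 < 1 :> R by rewrite invf_lt1 ?ltr0n// ltr1n.
by rewrite /radius subr_gt0 n1 gtrBl.
Qed.

Lemma cvg_radius : radius n @[n --> \oo] --> (1 : R).
Proof.
rewrite -[X in _ --> X]subr0; apply: cvgB; first exact: cvg_cst.
by rewrite (cvg_shiftS (fun n : nat => n.+1%:R^-1 : R)); exact: cvg_harmonic.
Qed.

Lemma radius_near (d : R) : 0 < d -> \forall n \near \oo, 1 - d < radius n.
Proof.
move=> d0; have /cvgrPdist_lt /(_ _ d0) := cvg_radius; apply: filterS => n.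
by rewrite ltr_norml; lra.
Qed.

Definition radial_limit (w : circle R) (l : R[i]) := forall e : R, 0 < e ->
  exists2 d : R, 0 < d & forall r, 1 - d < r < 1 -> normc (f (r%:C%C * cval w) - l) < e.

Lemma radial_limitP w (l : R[i]^o) :
  f (r%:C%C * val w) @[r --> (1 : R)^'-] --> l <-> radial_limit w l.
Proof.
rewrite cvg_normcP; split=> h e e0.
  have := h e e0; rewrite /at_left !nearE /within /= => /nbhs_ballP[d /= d0 hd].
  exists d => // r /andP[r1 r2]; apply: hd => //=.
  by rewrite /ball /= ltr_norml; lra.
have [d d0 hd] := h e e0; apply/nbhs_ballP; exists d => // r; rewrite /ball /= ltr_norml => hr r1.
by apply: hd; lra.
Qed.

Lemma boundary_radial_limit w (l : circle R) :
  radial_limit w (cval l) -> radial_limit w (cval (boundary f w)).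
Proof.
move=> /radial_limitP hl; apply/radial_limitP.
exact: (@xgetPex _ (circle1 R) [set l : circle R | f (r%:C%C * val w) @[r --> (1 : R)^'-] --> val l]
  (ex_intro _ l hl)).
Qed.

Lemma ae_boundary_radial_limit : {ae P, forall w, radial_limit w (cval (boundary f w))}.
Proof.
have [_ _] := f_inner; apply: filterS => w [l hl l1].
have l1' : `|l| == 1 by rewrite l1.
apply: (@boundary_radial_limit w (exist _ l l1')); exact/radial_limitP.
Qed.

Lemma radial_limit_cvg w l : radial_limit w l ->
  normc (f ((radius n)%:C%C * cval w) - l) @[n --> \oo] --> 0.
Proof.
move=> h; apply/cvgrPdist_lt => e e0; have [d d0 hd] := h e e0.
apply: filterS (radius_near d0) => n hn.
rewrite sub0r normrN ger0_norm ?normc_ge0//; apply: hd.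
by rewrite hn; case/andP: (radius_bounds n).
Qed.

(* Closed subsets of the circle, from which the set of points with a radial
   limit of modulus one is built by countable operations. *)
Definition radially_cauchy (k m : nat) : set (circle R) := [set w | forall r s : R,
  radius m <= r < 1 -> radius m <= s < 1 ->
  normc (f (r%:C%C * cval w) - f (s%:C%C * cval w)) <= k.+1%:R^-1 /\
  1 - k.+1%:R^-1 <= normc (f (r%:C%C * cval w))].

Lemma radial_continuous (r : R) w (e : R) : 0 <= r < 1 -> 0 < e ->
  exists2 d : R, 0 < d & forall v, normc (cval v - cval w) < d ->
    normc (f (r%:C%C * cval v) - f (r%:C%C * cval w)) < e.
Proof.
move=> /andP[r0 r1] e0.
have [K [d [K0 d0 hd]]] : exists K d : R, [/\ 0 < K, 0 < d & forall h, normc h < d ->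
    normc (f (r%:C%C * cval w + h) - f (r%:C%C * cval w)) <= K * normc h].
  by apply/derivable_lipschitz/inner_derivable; rewrite normc_radial.
exists (Num.min d (e / K)); first by rewrite lt_min d0 divr_gt0.
move=> v; rewrite lt_min ltr_pdivlMr// => /andP[h1 h2].
have hle : normc (r%:C%C * (cval v - cval w)) <= normc (cval v - cval w).
  by rewrite normcM normc_real// ler_piMl// ?normc_ge0// ltW.
rewrite (_ : r%:C%C * cval v = r%:C%C * cval w + r%:C%C * (cval v - cval w)); last by ring.
apply: le_lt_trans (hd _ (le_lt_trans hle h1)) _.
by apply: le_lt_trans (ler_wpM2l (ltW K0) hle) _; rewrite mulrC.
Qed.

Lemma normc_distance (x y : R[i]) : normc x <= normc y + normc (x - y).
Proof. by rewrite addrC -{1}(subrK y x); exact: le_normcD. Qed.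

Lemma normc_distC (x y : R[i]) : normc (x - y) = normc (y - x).
Proof. by rewrite -(normcN (x - y)) opprB. Qed.

(** For fixed radii below 1 the conditions are weak inequalities between continuous functions of
    [w]; although there are uncountably many of them, their intersection is closed. *)
Lemma measurable_radially_cauchy k m : measurable (radially_cauchy k m).
Proof.
apply: circle_measurable_closed => w /existsNP[r /existsNP[s]].
move=> /not_implyP[hr /not_implyP[hs hn]].
have /andP[rm r1] := hr; have /andP[sm s1] := hs; have /andP[m0 _] := radius_bounds m.
have r01 : 0 <= r < 1 by rewrite r1 andbT; lra.
have s01 : 0 <= s < 1 by rewrite s1 andbT; lra.
have [e e0 he] : exists2 e : R, 0 < e & forall v,
    normc (f (r%:C%C * cval v) - f (r%:C%C * cval w)) < e ->
    normc (f (s%:C%C * cval v) - f (s%:C%C * cval w)) < e -> ~ radially_cauchy k m v.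
  set a := normc (f (r%:C%C * cval w) - f (s%:C%C * cval w)) in hn.
  rewrite /radially_cauchy /=; have [q qE] : exists q : R, q = k.+1%:R^-1 by exists k.+1%:R^-1.
  rewrite -qE in hn *.
  have [h1|h1] := leP a q; last first.
    exists ((a - q) / 2) => [|v v1 v2 /(_ _ _ hr hs)[+ _]]; first by lra.
    have : a <= normc (f (r%:C%C * cval w) - f (r%:C%C * cval v)) +
       (normc (f (r%:C%C * cval v) - f (s%:C%C * cval v)) + normc (f (s%:C%C * cval v) - f (s%:C%C * cval w))).
      rewrite /a -(subrKA (f (r%:C%C * cval v))); apply: le_trans (le_normcD _ _) _.
      rewrite lerD2l -{1}(subrKA (f (s%:C%C * cval v))); exact: le_normcD.
    rewrite (normc_distC (f (r%:C%C * cval w))); lra.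
  have h2 : normc (f (r%:C%C * cval w)) < 1 - q.
    by rewrite ltNge; apply/negP => h2; apply: hn.
  exists (1 - q - normc (f (r%:C%C * cval w))) => [|v v1 _ /(_ _ _ hr hs)[_]]; first by lra.
  have := normc_distance (f (r%:C%C * cval v)) (f (r%:C%C * cval w)); lra.
have [d d0 hd] := radial_continuous w r01 e0.
have [d' d'0 hd'] := radial_continuous w s01 e0.
exists (Num.min d d'); first by rewrite lt_min d0.
by move=> v; rewrite lt_min => /andP[/hd h1 /hd' h2]; exact: he.
Qed.

Lemma inv_nat_lt (e : R) : 0 < e -> exists k, k.+1%:R^-1 < e :> R.
Proof.
move=> e0; exists (Num.truncn e^-1).
by rewrite -[ltRHS]invrK ltf_pV2 ?posrE ?invr_gt0// truncnS_gt.
Qed.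

(** The first condition in [radially_cauchy] gives convergence along the radius, the second a limit
    of modulus at least one; [|f| < 1] in the disc gives the opposite inequality. *)
Lemma radial_limit_exists w : (forall k, exists m, radially_cauchy k m w) ->
  exists l : circle R, radial_limit w (cval l).
Proof.
move=> hw; pose x n := f ((radius n)%:C%C * cval w).
have radius_le m n : (m <= n)%N -> radius m <= radius n.
  by move=> mn; rewrite /radius lerD2l lerN2 lef_pV2 ?posrE ?ltr0n// ler_nat.
have rad1 n : radius n < 1 by case/andP: (radius_bounds n).
have cauchy (g : R[i] -> R) : (forall a b, `|g a - g b| <= normc (a - b)) ->
    cvg (g (x n) @[n --> \oo]).
  move=> hg; apply/cauchy_cvgP; apply: cauchy_exP => e e0.
  have [k ke] := inv_nat_lt e0; have [m hm] := hw k.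
  exists (g (x m)); exists m => // n /= mn; rewrite /ball /=.
  apply: le_lt_trans (hg _ _) _; apply: le_lt_trans ke.
  by have [] := hm (radius m) (radius n); rewrite ?lexx ?rad1 ?radius_le.
have hRe (a b : R[i]) : `|Re a - Re b| <= normc (a - b) by rewrite -cReN -cReD norm_Re_le.
have hIm (a b : R[i]) : `|Im a - Im b| <= normc (a - b) by rewrite -cImN -cImD norm_Im_le.
pose l : R[i] := (limn (fun n => Re (x n)) +i* limn (fun n => Im (x n)))%C.
have close k m r : radially_cauchy k m w -> radius m <= r < 1 ->
    normc (f (r%:C%C * cval w) - l) <= 2 * k.+1%:R^-1.
  move=> hm hr.
  have h (g : R[i] -> R) : (forall a b, `|g a - g b| <= normc (a - b)) ->
      `|g (f (r%:C%C * cval w)) - limn (fun n => g (x n))| <= k.+1%:R^-1.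
    move=> hg; have cg := cauchy g hg.
    have c2 : `|g (f (r%:C%C * cval w)) - g (x n)| @[n --> \oo] -->
        `|g (f (r%:C%C * cval w)) - limn (fun n => g (x n))|.
      by apply: cvg_norm; apply: cvgB => //; exact: cvg_cst.
    apply: (cvgr_to_le c2); exists m => // n /= mn.
    apply: le_trans (hg _ _) _.
    by have [] := hm r (radius n); rewrite ?rad1 ?radius_le.
  apply: le_trans (normc_le_norms _) _; rewrite cReD cReN cImD cImN.
  have := h _ hRe; have := h _ hIm; rewrite /=; move: (_^-1) => q; lra.
have lim : radial_limit w l.
  move=> e e0; have [k ke] := inv_nat_lt (divr_gt0 e0 (ltr0n _ 2)); have [m hm] := hw k.
  exists (1 - radius m); first by rewrite subr_gt0.
  move=> r /andP[r1 r2]; apply: le_lt_trans (close k m r hm _) _; first by rewrite r2 andbT; lra.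
  by move: ke; move: (k.+1%:R^-1) => q; lra.
have l1 : normc l = 1.
  apply/eqP; rewrite -subr_eq0 -normr_le0; apply/ler_addgt0Pr => e e0; rewrite add0r.
  have [k ke] := inv_nat_lt (divr_gt0 e0 (ltr0n _ 3)); have [m hm] := hw k.
  have hr : radius m <= radius m < 1 by rewrite lexx rad1.
  have h1 := close k m _ hm hr; have [_ h2] := hm _ _ hr hr.
  have h3 := inner_lt1 (_ : normc ((radius m)%:C%C * cval w) < 1).
  have h4 : normc (f ((radius m)%:C%C * cval w)) < 1.
    by apply: h3; rewrite normc_radial ?rad1//; case/andP: (radius_bounds m) => /ltW.
  have h5 := normc_distance l (f ((radius m)%:C%C * cval w)); rewrite normc_distC in h5.
  have h6 := normc_distance (f ((radius m)%:C%C * cval w)) l.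
  move: ke h1 h2; move: (k.+1%:R^-1) => q ke h1 h2.
  by rewrite ler_norml; lra.
have l1' : `|l : R[i]^o| == 1 by rewrite complex_normE l1.
by exists (exist _ (l : R[i]^o) l1').
Qed.

Lemma radially_cauchy_of_limit w (l : circle R) k : radial_limit w (cval l) ->
  exists m, radially_cauchy k m w.
Proof.
have e0 : 0 < k.+1%:R^-1 / 2 :> R by rewrite divr_gt0.
have [q qE] : exists q : R, q = k.+1%:R^-1 by exists k.+1%:R^-1.
rewrite /radially_cauchy /= -qE in e0 *.
move=> /(_ _ e0)[d d0 hd]; have [m _ /(_ m (leqnn _)) /= hm] := radius_near d0.
exists m => r s /andP[r1 r2] /andP[s1 s2].
have h1 := hd r; have h2 := hd s.
have {}h1 : normc (f (r%:C%C * cval w) - cval l) < q / 2 by apply: h1; rewrite r2 andbT; lra.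
have {}h2 : normc (f (s%:C%C * cval w) - cval l) < q / 2 by apply: h2; rewrite s2 andbT; lra.
split.
  rewrite -(subrKA (cval l)); apply: le_trans (le_normcD _ _) _.
  by rewrite (normc_distC (cval l)); lra.
have := normc_distance (cval l) (f (r%:C%C * cval w)); rewrite normc_circle normc_distC; lra.
Qed.

(** The Borel sets of the circle are not completed, so convergence almost everywhere would not do.
    [D] is exactly the set where a radial limit of modulus one exists; off [D] both the
    approximations [x n] and the boundary map take the default value 1, hence the convergence holds
    everywhere. *)
Lemma bounded_measurableC_boundary : bmC (fun w => cval (boundary f w)).
Proof.
pose D := \bigcap_k \bigcup_m radially_cauchy k m.
have mD : measurable D.
  apply: bigcapT_measurable => k; apply: bigcupT_measurable => m.
  exact: measurable_radially_cauchy.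
pose x n w : R[i] := if w \in D then f ((radius n)%:C%C * cval w) else 1.
have x_cvg w : normc (x n w - cval (boundary f w)) @[n --> \oo] --> 0.
  rewrite /x; case: (boolP (w \in D)) => [/set_mem wD|/negP wD].
    apply: radial_limit_cvg; have [|l hl] := @radial_limit_exists w.
      by move=> k; have [m _ hm] := wD k I; exists m.
    exact: boundary_radial_limit hl.
  apply: cvg_near_cst; apply: nearW => n; rewrite (_ : cval _ = 1) ?subrr ?normc0//.
  rewrite /boundary xgetPN// => l /radial_limitP hl; apply: wD; apply/mem_set => k _.
  by have [m hm] := radially_cauchy_of_limit k hl; exists m.
have part (g : R[i] -> R) : (forall a b, `|g a - g b| <= normc (a - b)) ->
    (forall a, `|g a| <= normc a) ->
    (forall n, bounded_measurable (fun w => g (f ((radius n)%:C%C * cval w)))) ->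
    bounded_measurable (fun w => g (cval (boundary f w))).
  move=> hg g1 bg; split; last first.
    by exists 1 => w; apply: le_trans (g1 _) _; rewrite normc_circle.
  apply: (measurable_fun_cvg (h := fun n w => g (x n w))).
    move=> n; rewrite (_ : (fun w => g (x n w)) =
        (fun w => \1_D w * g (f ((radius n)%:C%C * cval w)) + (1 - \1_D w) * g 1)).
      apply: measurable_funD; apply: measurable_funM => //; first exact: (bg n).1.
      by apply: measurable_funB.
    apply/funext => w; rewrite /x indicE; case: (w \in D) => /=.
      by rewrite mul1r subrr mul0r addr0.
    by rewrite mul0r subr0 mul1r add0r.
  move=> w _; apply: cvg_subr_cvg0; apply: norm_cvg0.
  apply: (squeeze_cvgr _ (cvg_cst 0) (x_cvg w)); apply: nearW => n.
  by rewrite normr_ge0 normc_distC hg.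
have br n : bmC (fun w => f ((radius n)%:C%C * cval w)).
  by apply: bounded_measurableC_inner; have /andP[/ltW -> ->] := radius_bounds n.
split; apply: part => //.
- by move=> a b; rewrite -cReN -cReD norm_Re_le.
- exact: norm_Re_le.
- by move=> n; exact: (br n).1.
- by move=> a b; rewrite -cImN -cImD norm_Im_le.
- exact: norm_Im_le.
- by move=> n; exact: (br n).2.
Qed.

Lemma measurable_boundary : measurable_fun [set: circle R] (boundary f).
Proof. exact: measurable_to_circle bounded_measurableC_boundary. Qed.

Lemma normcX_distance (x y : R[i]) n : normc x <= 1 -> normc y <= 1 ->
  normc (x ^+ n - y ^+ n) <= n%:R * normc (x - y).
Proof.
move=> x1 y1; elim: n => [|n IH]; first by rewrite !expr0 subrr normc0 mul0r.
rewrite !exprS (_ : _ - _ = x * (x ^+ n - y ^+ n) + (x - y) * y ^+ n); last by ring.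
apply: le_trans (le_normcD _ _) _; rewrite !normcM normcX -natr1 mulrDl mul1r.
have y2 : normc y ^+ n <= 1 by rewrite exprn_ile1// normc_ge0.
apply: lerD; last by rewrite ler_piMr// normc_ge0.
by apply: le_trans IH; rewrite ler_piMl// normc_ge0.
Qed.

(** Dominated convergence along [radius], with bound 1: the factor [r ^ k] tends to 1 and
    disappears. *)
Lemma boundary_moment (m : circle R -> R[i]) j k L : bmC m -> (forall w, normc (m w) <= 1) ->
  (forall r : R, 0 < r < 1 ->
     has_mean P (fun w => m w * f (r%:C%C * cval w) ^+ j) (r%:C%C ^+ k * L)) ->
  has_mean P (fun w => m w * cval (boundary f w) ^+ j) L.
Proof.
move=> bm m1 hm.
have fle n w : normc (f ((radius n)%:C%C * cval w)) <= 1.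
  have /andP[r0 r1] := radius_bounds n.
  by apply/ltW/inner_lt1; rewrite normc_radial// ltW.
apply: (@has_mean_lim _ _ _ P (fun n w => m w * f ((radius n)%:C%C * cval w) ^+ j) _
  (fun n => (radius n)%:C%C ^+ k * L) L 1).
- by move=> n; apply: hm; exact: radius_bounds.
- move=> n w; rewrite normcM normcX mulr_ile1 ?exprn_ge0 ?normc_ge0//.
  by rewrite exprn_ile1// normc_ge0.
- by apply: bounded_measurableCM => //; apply: bounded_measurableCX; exact: bounded_measurableC_boundary.
- apply: filterS ae_boundary_radial_limit => w /radial_limit_cvg h.
  have h2 : j%:R * normc (f ((radius n)%:C%C * cval w) - cval (boundary f w)) @[n --> \oo] --> 0.
    by rewrite -[X in _ --> X](mulr0 j%:R); apply: cvgMr.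
  apply: (squeeze_cvgr _ (cvg_cst 0) h2); apply: nearW => n.
  rewrite normc_ge0/= -mulrBr normcM.
  have b1 := normc_ge0 (m w).
  apply: le_trans (ler_wpM2r (normc_ge0 _) (m1 w)) _.
  by rewrite mul1r normcX_distance// normc_circle.
have c1 : (radius n) ^+ k @[n --> \oo] --> (1 : R).
  by rewrite -(expr1n R k); apply: (continuous_cvg _ (@exprn_continuous R k 1)); exact: cvg_radius.
have c2 : `|radius n ^+ k - 1| * normc L @[n --> \oo] --> 0.
  rewrite -[X in _ --> X](mul0r (normc L)); apply: cvgMl.
  have c3 : `|radius n ^+ k - 1| @[n --> \oo] --> `|1 - 1 : R|.
    by apply: cvg_norm; apply: cvgB => //; exact: cvg_cst.
  by rewrite subrr normr0 in c3.
apply: cvg_trans c2; apply: near_eq_cvg; apply: nearW => n.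
rewrite (_ : _ - L = (radius n ^+ k - 1)%:C%C * L).
  by rewrite normcM /= expr0n addr0 sqrtr_sqr.
have EX : (radius n ^+ k)%:C%C = (radius n)%:C%C ^+ k :> R[i].
  by elim: (k) => [//|i IH]; rewrite !exprS -IH rmorphM.
have EB (x : R) : (x - 1)%:C%C = x%:C%C - 1 :> R[i] by rewrite rmorphB.
by rewrite EB EX mulrBl mul1r.
Qed.

End inner_moments.

(** * Continuous functions and moments on the circle *)

Section circle_facts.
Context (R : realType).
Local Notation Re := complex.Re.
Local Notation Im := complex.Im.
Local Notation cval := (@circle_val R).
Local Notation P := (@circle_measure R).

Lemma circle_param_surj (w : circle R) : exists2 t : R, 0 <= t <= 1 & circle_val (circle_param t) = cval w.
Proof.
have := sqr_normcE (cval w); rewrite normc_circle expr1n.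
have /= := norm_Re_le (cval w); have /= := norm_Im_le (cval w); rewrite normc_circle.
case: (cval w) => x y /=; rewrite !ler_norml => hy hx xy.
have pi0 := pi_gt0 R.
have p2 : 0 < 2 * pi :> R by rewrite mulr_gt0.
have a0 := acos_ge0 hx; have a1 := acos_lepi hx; have ca := acosK hx.
have sE : 1 - x ^+ 2 = y ^+ 2 by lra.
have sa := sin_acos hx; rewrite sE sqrtr_sqr in sa.
have [y0|y0] := leP 0 y.
  exists (acos x / (2 * pi)).
    by apply/andP; split; [rewrite divr_ge0// ltW|rewrite ler_pdivrMr// mul1r; lra].
  by rewrite /circle_val /= /circle_exp mulrC divfK ?gt_eqF// ca sa ger0_norm.
exists (1 - acos x / (2 * pi)).
  apply/andP; split; first by rewrite subr_ge0 ler_pdivrMr// mul1r; lra.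
  by rewrite gerBl divr_ge0// ltW.
rewrite /circle_val /= /circle_exp mulrBr mulr1 [2 * pi * (_ / _)]mulrC divfK ?gt_eqF//.
rewrite cosB sinB mulr_natl cos2pi sin2pi ca sa ltr0_norm//.
by rewrite mul1r !mul0r addr0 sub0r mul1r opprK.
Qed.

Lemma segment_integral_ge0 (g : R -> R) (a b : R) : (forall t, 0 <= g t) ->
  0 <= segment_integral g a b.
Proof. by move=> g0; apply: Rintegral_ge0. Qed.

(** If [h w0 > 0], then [h] exceeds half that value on a parameter interval around [t0], cut down to
    [[0, 1]], and its integral is positive. *)
Lemma continuous_expect_eq0 (h : circle R -> R) (K : R) : (forall w, 0 <= h w <= K) ->
  (forall w (e : R), 0 < e -> exists2 d : R, 0 < d &
     forall v, normc (cval v - cval w) < d -> `|h v - h w| <= e) ->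
  expect P h = 0 -> forall w, h w = 0.
Proof.
move=> h0K hc; have h0 w : 0 <= h w by case/andP: (h0K w).
have bh : bounded_measurable h.
  apply: (@bounded_measurable_circle _ _ K) => // w; have /andP[h0' hK] := h0K w.
  by rewrite ger0_norm.
rewrite (expect_circle bh) => I0 w0; apply/eqP; apply: contraPT I0 => hw0.
have {hw0} a0 : 0 < h w0 by rewrite lt_neqAle eq_sym hw0 h0.
have [t0 /andP[t00 t01] tE] := circle_param_surj w0.
have {}tE : circle_param t0 = w0 by apply: val_inj.
pose g t := h (circle_param t).
have near_exp (t d : R) : 0 < d -> exists2 e : R, 0 < e & forall s : R, `|s - t| < e ->
    normc (circle_exp s - circle_exp t) < d.
  move=> d0; have /cvg_normcP /(_ d d0) := @continuous_circle_exp R t.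
  move=> /nbhs_ballP[e /= e0 he]; exists e => // s hs; apply: he.
  by rewrite /ball /= distrC.
have cg t : {for t, continuous g}.
  apply/cvgrPdist_le => e e0; have [d d0 hd] := hc (circle_param t) e e0.
  have [e' e'0 he'] := near_exp t d d0.
  apply/nbhs_ballP; exists e' => // s; rewrite /ball /= distrC => hs.
  by rewrite distrC; apply: hd; exact: he'.
have a2 : 0 < h w0 / 2 by rewrite divr_gt0.
have [d d0 hd] := hc w0 _ a2; have [e e0 he] := near_exp t0 d d0.
pose a := Num.max 0 (t0 - e / 2); pose b := Num.min 1 (t0 + e / 2).
have [a0' ale] : 0 <= a /\ t0 - e / 2 <= a by rewrite !le_max !lexx orbT.
have [b1 ble] : b <= 1 /\ b <= t0 + e / 2 by rewrite !ge_min !lexx orbT.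
have ab : a < b by rewrite lt_min !gt_max ltr01; apply/andP; split; apply/andP; split; lra.
have cs x y : continuous_on_segment g x y by move=> t _; exact: cg.
have I1 : segment_integral g 0 1 = segment_integral g 0 a +
    (segment_integral g a b + segment_integral g b 1).
  rewrite -(segment_integral_cat (ltW ab) b1)// -segment_integral_cat//.
  by rewrite (le_trans (ltW ab)).
have near_g t : a <= t <= b -> `|g t - h w0| <= h w0 / 2.
  move=> /andP[ta tb]; apply: hd; rewrite -tE; apply: he.
  by rewrite ltr_norml; lra.
have := segment_integral_approx (ltW ab) (cs a b) near_g.
have := @segment_integral_ge0 g 0 a; have := @segment_integral_ge0 g b 1.
move=> /(_ (fun t => h0 _)) i1 /(_ (fun t => h0 _)) i2.
have ba : 0 < b - a by rewrite subr_gt0.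
have p := mulr_gt0 a2 ba.
rewrite ler_norml => /andP[h3 _] I0.
move: I1; rewrite [LHS]I0; lra.
Qed.

(** As [w] times its conjugate is 1 and one of the truncated differences is 0, only pure powers of
    [w] or of its conjugate have to be compared. *)
Lemma monomialE a b (w : circle R) :
  monomial a b w = cval w ^+ (a - b) * conjc (cval w) ^+ (b - a).
Proof.
rewrite /monomial; elim: a b => [|a IH] [|b]; rewrite ?subn0 ?sub0n ?expr0 ?mul1r ?mulr1//.
rewrite !subSS -IH !exprS.
by rewrite (_ : _ * (_ * _) = (cval w * conjc (cval w)) * (cval w ^+ a * conjc (cval w) ^+ b)); [rewrite circle_conj mul1r|ring].
Qed.

Section same_moments_criterion.
Context d (T : measurableType d) (Q : probability T R) (z1 z2 : T -> circle R)
  (rho1 rho2 : T -> R[i]).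

Lemma same_moments_of_means : bounded_measurableC rho1 -> bounded_measurableC rho2 ->
  (forall n, exists2 L, has_mean Q (fun w => cval (z1 w) ^+ n * rho1 w) L &
    has_mean Q (fun w => cval (z2 w) ^+ n * rho2 w) L) ->
  (forall n, exists2 L, has_mean Q (fun w => conjc (cval (z1 w)) ^+ n * rho1 w) L &
    has_mean Q (fun w => conjc (cval (z2 w)) ^+ n * rho2 w) L) ->
  same_moments Q z1 z2 rho1 rho2.
Proof.
move=> b1 b2 hp hn; split=> // c a b.
under eq_expect do rewrite monomialE; under [RHS]eq_expect do rewrite monomialE.
have [ab|/ltnW ba] := leqP a b.
  have -> : (a - b)%N = 0%N by apply/eqP; rewrite subn_eq0.
  have [L [_ h1] [_ h2]] := hn (b - a)%N.
  under eq_expect do rewrite expr0 mul1r; under [RHS]eq_expect do rewrite expr0 mul1r.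
  by rewrite h1 h2.
have -> : (b - a)%N = 0%N by apply/eqP; rewrite subn_eq0.
have [L [_ h1] [_ h2]] := hp (a - b)%N.
under eq_expect do rewrite expr0 mulr1; under [RHS]eq_expect do rewrite expr0 mulr1.
by rewrite h1 h2.
Qed.

End same_moments_criterion.

End circle_facts.

(** * The boundary map as a contracting chain *)

Section boundary_chain.
Context (R : realType) (f : R[i]^o -> R[i]^o).
Hypotheses (f_inner : inner f) (f0 : f 0 = 0).
Local Notation Re := complex.Re.
Local Notation Im := complex.Im.
Local Notation P := (@circle_measure R).
Local Notation E := (expect P).
Local Notation bmC := bounded_measurableC.
Local Notation cval := (@circle_val R).
Local Notation L1 := ('D_1 f 0 : R[i]).
Local Notation Z := (fun w => cval (boundary f w)).

Let bm_val := @bounded_measurableC_val R.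
Let bm_Z : bmC Z := bounded_measurableC_boundary f_inner.

Let unit_pow (x : R[i]) n : normc x = 1 -> normc (x ^+ n) <= 1.
Proof. by move=> x1; rewrite normcX x1 expr1n. Qed.

Lemma normc_conj (x : R[i]) : normc (conjc x) = normc x.
Proof. by case: x => a b /=; rewrite sqrrN. Qed.

Lemma boundary_positive_moment k j : (0 < k + j)%N ->
  has_mean P (fun w => cval w ^+ k * Z w ^+ j) 0.
Proof.
move=> kj; apply: (@boundary_moment _ _ f_inner (fun w => cval w ^+ k) j 0 0).
- exact: bounded_measurableCX.
- by move=> w; apply: unit_pow; exact: normc_circle.
- by move=> r hr; rewrite mulr0; exact: positive_moment.
Qed.

Lemma boundary_power_mean n : has_mean P (fun w => Z w ^+ n) (0 ^+ n).
Proof.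
case: n => [|n]; first by under eq_fun do rewrite expr0; rewrite expr0; exact: has_mean_cst.
rewrite expr0n /=; apply: eq_has_mean (boundary_positive_moment (_ : (0 < 0 + n.+1)%N)) => // w.
by rewrite expr0 mul1r.
Qed.

Lemma circle_power_mean n : has_mean P (fun w => cval w ^+ n) (0 ^+ n).
Proof.
case: n => [|n]; first by under eq_fun do rewrite expr0; rewrite expr0; exact: has_mean_cst.
rewrite expr0n /=; apply: eq_has_mean (boundary_positive_moment (_ : (0 < n.+1 + 0)%N)) => // w.
by rewrite expr0 mulr1.
Qed.

Let conj_pow_le n w : normc (conjc (cval w) ^+ n) <= 1.
Proof. by apply: unit_pow; rewrite normc_conj normc_circle. Qed.

Let bm_conj_pow n : bmC (fun w => conjc (cval w) ^+ n).
Proof. exact: bounded_measurableCX (bounded_measurableC_conj bm_val). Qed.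

Lemma boundary_negative_moment k m :
  has_mean P (fun w => conjc (cval w) ^+ k * Z w ^+ (k + m)) (L1 ^+ k * 0 ^+ m).
Proof.
apply: (@boundary_moment _ _ f_inner (fun w => conjc (cval w) ^+ k) _ k) => // r hr.
exact: negative_moment.
Qed.

(** The same [L] serves the boundary and all inner radii: [k = 2] provides [mu], and the family over
    all [k] lets [derive0_rigid] return from the boundary into the disc. *)
Lemma exists_boundary_moment k : exists L : R[i],
  has_mean P (fun w => conjc (cval w) ^+ k * Z w) L /\
  forall r : R, 0 < r < 1 ->
    has_mean P (fun w => conjc (cval w) ^+ k * f (r%:C%C * cval w)) (r%:C%C ^+ k * L).
Proof.
have [L hL] := exists_negative_moment f_inner k 1; exists L; split; last first.
  by move=> r hr; apply: eq_has_mean (hL r hr) => w; rewrite expr1.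
apply: eq_has_mean (@boundary_moment _ _ f_inner (fun w => conjc (cval w) ^+ k) 1 k L _ _ hL) => // w.
Qed.

Lemma normc_derive0_le1 : normc L1 <= 1.
Proof.
have := boundary_negative_moment 1 0; rewrite expr1 expr0 mulr1.
move=> /(has_mean_le ler01); apply => w.
by rewrite normcM !normcX normc_conj !normc_circle !expr1n mulr1.
Qed.

Lemma circle_conj_val_mean n : has_mean P (fun w => conjc (cval w) ^+ n * cval w) (n == 1%N)%:R.
Proof.
case: n => [|[|n]] /=.
- by apply: eq_has_mean (circle_power_mean 1) => w; rewrite expr0 mul1r expr1.
- by apply: eq_has_mean (has_mean_cst P 1) => w; rewrite expr1 mulrC circle_conj.
- have e0 : 0 ^+ n.+1 = 0 :> R[i] by rewrite expr0n.
  have := has_mean_conj (circle_power_mean n.+1); rewrite e0 conjc0; apply: eq_has_mean => w.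
  by rewrite rmorphXn [in RHS]exprSr -mulrA (mulrC _ (cval w)) circle_conj mulr1.
Qed.

(* Equality in Schwarz's lemma: [Z = L1 z] almost everywhere, so that all the
   Fourier coefficients of [f (r w) - L1 r w] vanish. *)
Lemma derive0_rigid : normc L1 = 1 -> forall (r : R) w, 0 < r < 1 ->
  f (r%:C%C * cval w) = L1 * (r%:C%C * cval w).
Proof.
move=> n1.
pose D w := Z w - L1 * cval w.
have bD : bmC D by apply: bounded_measurableCB => //; apply: bounded_measurableCM => //; exact: bounded_measurableC_cst.
have bD2 : bounded_measurable (fun w => normc (D w) ^+ 2).
  by under eq_fun do rewrite sqr_normcE; apply: bounded_measurableD; apply: bounded_measurableX; case: bD.
have ED : E (fun w => normc (D w) ^+ 2) = 0.
  have hm := boundary_negative_moment 1 0; rewrite expr1 expr0 mulr1 in hm.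
  have := has_mean_Re (has_meanB (has_mean_cst P 1) (has_meanZ (conjc L1) hm)).
  have -> : 1 - conjc L1 * L1 = 0.
    have := sqr_normcE L1; rewrite n1 expr1n; case: (L1) => a b /= h.
    by apply/eqP; rewrite eq_complex /=; apply/andP; split; apply/eqP; [rewrite h|]; ring.
  (* Since [|Z| = |L1 z| = 1], the expansion of [|Z - L1 z| ^ 2] contains only 2 and the cross term,
     whose mean is the first negative moment. *)
  have -> : (fun w => normc (D w) ^+ 2) =
     (fun w => 2 * Re (1 - conjc L1 * (conjc (cval w) ^+ 1 * Z w ^+ 1))).
    apply/funext => w; rewrite /D sqr_normcE !expr1.
    have := sqr_normcE (Z w); rewrite normc_circle expr1n.
    have := sqr_normcE (cval w); rewrite normc_circle expr1n.
    have := sqr_normcE L1; rewrite n1 expr1n.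
    case: (L1) (cval w) (Z w) => [a b] [c d] [e g] /= h1 h2 h3.
    have h4 : (a ^+ 2 + b ^+ 2) * (c ^+ 2 + d ^+ 2) = 1 by rewrite -h1 -h2 mulr1.
    transitivity ((e ^+ 2 + g ^+ 2) + (a ^+ 2 + b ^+ 2) * (c ^+ 2 + d ^+ 2) -
      2 * (a * (c * e + d * g) + b * (c * g - d * e))); first by ring.
    rewrite -h3 h4; ring.
  rewrite expectZ; first by move=> ->; rewrite mulr0.
  exact: (has_meanB (has_mean_cst P 1) (has_meanZ (conjc L1) hm)).1.1.
(* From mean square zero to mean zero by [x <= e + x ^ 2 / e] for every [e > 0]. *)
have meanD G M : (forall w, normc (G w) <= 1) -> has_mean P (fun w => G w * D w) M -> M = 0.
  move=> G1 [bG hG]; apply: eq0_normc; apply: le_anti; rewrite normc_ge0 andbT.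
  have [->//|Mn0] := eqVneq (normc M) 0.
  have M0 : 0 < normc M by rewrite lt_neqAle eq_sym Mn0 normc_ge0.
  apply/ler_addgt0Pr => e e0; rewrite add0r.
  have : normc M ^+ 2 <= normc M * e.
    rewrite sqr_normcE (_ : _ + _ = Re (conjc M * M)); last by case: (M) => ? ? /=; ring.
    rewrite -hG; apply: le_trans (ler_norm _) _.
    have bm_rhs : bounded_measurable (fun w => normc M * e + normc M / e * normc (D w) ^+ 2).
      apply: bounded_measurableD; first exact: bounded_measurable_cst.
      by apply: bounded_measurableM => //; exact: bounded_measurable_cst.
    apply: le_trans (expect_norm_le (g := fun w => normc M * e + normc M / e * normc (D w) ^+ 2) _ _ _ _) _ => //.
    - have bc : bmC (fun _ : circle R => conjc M) by exact: bounded_measurableC_cst.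
      exact: (bounded_measurableCM bc bG).1.
    - move=> w; apply: le_trans (norm_Re_le _) _.
      rewrite !normcM normc_conj -mulrA -mulrDr; apply: ler_wpM2l; first exact: ltW.
      have x0 := normc_ge0 (D w); set x := normc (D w) in x0 *.
      apply: le_trans (_ : x <= _); first by rewrite ler_piMl.
      rewrite -(ler_pM2l e0) mulrDr mulVKf ?gt_eqF//.
      by have := sqr_ge0 (x - e); have := sqr_ge0 x; have := sqr_ge0 e; nra.
    rewrite expectD; [|exact: bounded_measurable_cst|by apply: bounded_measurableM => //; exact: bounded_measurable_cst].
    by rewrite expect_cst (@expectZ _ _ _ P _ _ bD2) ED mulr0 addr0.
  by rewrite expr2 ler_pM2l.
move=> r w0 hr; have /andP[r0 r1] := hr.
pose Dr w := f (r%:C%C * cval w) - L1 * (r%:C%C * cval w).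
have bDr : bmC Dr.
  apply: bounded_measurableCB.
    by apply: bounded_measurableC_inner; rewrite ?(ltW r0).
  do 2 (apply: bounded_measurableCM; first exact: bounded_measurableC_cst).
  exact: bm_val.
have b0 : bmC (fun _ : circle R => 0 : R[i]) by exact: bounded_measurableC_cst.
have sm : same_moments P id id Dr (fun=> 0).
  apply: same_moments_of_means => // n; exists 0.
  - have h1 := positive_moment f_inner f0 (_ : (0 < n + 1)%N) hr.
    have {}h1 := h1 (ltn_addl _ (ltnSn 0)).
    have h2 := has_meanZ (L1 * r%:C%C) (circle_power_mean n.+1).
    have := has_meanB h1 h2; rewrite expr0n /= mulr0 subr0; apply: eq_has_mean => w.
    by rewrite /Dr expr1 exprSr; ring.
  - by under eq_fun do rewrite mulr0; exact: has_mean_cst.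
  - have [L [hL hr']] := exists_boundary_moment n.
    have LE : L = L1 * (n == 1%N)%:R.
      have := has_meanB hL (has_meanZ L1 (circle_conj_val_mean n)).
      have eqG w : conjc (cval w) ^+ n * Z w - L1 * (conjc (cval w) ^+ n * cval w) =
        conjc (cval w) ^+ n * D w by rewrite /D; ring.
      by move=> /(eq_has_mean eqG) /(meanD _ _ (conj_pow_le n)) /eqP; rewrite subr_eq0 => /eqP.
    have := has_meanB (hr' r hr) (has_meanZ (L1 * r%:C%C) (circle_conj_val_mean n)).
    rewrite (_ : _ - _ = 0).
      by apply: eq_has_mean => w; rewrite /Dr; ring.
    rewrite LE; case: eqP => [->|_]; last by rewrite !mulr0 subrr.
    by rewrite expr1; ring.
  - by under eq_fun do rewrite mulr0; exact: has_mean_cst.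
have EDr : E (fun w => normc (Dr w) ^+ 2) = 0.
  have mid : measurable_fun [set: circle R] (@id (circle R)) by exact: measurable_id.
  have := expect_eq_of_moments mid mid sm (bounded_measurableC_conj bDr).
  under [X in _ = X -> _]eq_expect do rewrite mulr0 /=.
  rewrite expect_cst => h; rewrite -[RHS]h; apply: eq_expect => w.
  by rewrite sqr_normcE; case: (Dr w) => a b /=; ring.
have Dr_cont w (e : R) : 0 < e -> exists2 d : R, 0 < d &
    forall v, normc (cval v - cval w) < d -> normc (Dr v - Dr w) <= e.
  move=> e0; have e2 : 0 < e / 2 by rewrite divr_gt0.
  have r01 : 0 <= r < 1 by rewrite r1 ltW.
  have [d d0 hd] := radial_continuous f_inner w r01 e2.
  exists (Num.min d (e / 2)); first by rewrite lt_min d0.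
  move=> v; rewrite lt_min => /andP[/hd h1 h2].
  rewrite (_ : Dr v - Dr w = (f (r%:C%C * cval v) - f (r%:C%C * cval w)) -
    L1 * (r%:C%C * (cval v - cval w))); last by rewrite /Dr; ring.
  apply: le_trans (le_normcD _ _) _; rewrite normcN !normcM n1 mul1r normc_real ?(ltW r0)//.
  have : r * normc (cval v - cval w) <= normc (cval v - cval w).
    by rewrite ler_piMl ?normc_ge0// ltW.
  lra.
have Dr2 w : normc (Dr w) <= 2.
  apply: le_trans (le_normcD _ _) _; rewrite normcN normcM n1 mul1r.
  have zr : normc (r%:C%C * cval w) = r by rewrite normc_radial// ltW.
  have := inner_lt1 f_inner (_ : normc (r%:C%C * cval w) < 1); rewrite zr => /(_ r1); lra.
(* [Dr] is continuous on the circle because [r < 1], so the vanishing of its mean square forces it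
   to vanish at every point. *)
have := continuous_expect_eq0 (K := 4) _ _ EDr.
move=> /(_ _ _ w0) h; apply/eqP; rewrite -subr_eq0; apply/eqP; apply: eq0_normc.
apply/eqP; rewrite -sqrf_eq0; apply/eqP; apply: h.
  move=> w; rewrite sqr_ge0 /=.
  by have := Dr2 w; have := normc_ge0 (Dr w); nra.
move=> w e e0; have e4 : 0 < e / 4 by rewrite divr_gt0.
have [d d0 hd] := Dr_cont w _ e4; exists d => // v /hd hv.
have h1 := normc_distance (Dr v) (Dr w); have h2 := normc_distance (Dr w) (Dr v).
rewrite (normc_distC (Dr w)) in h2.
have a1 := Dr2 v; have a2 := Dr2 w; have p1 := normc_ge0 (Dr v); have p2 := normc_ge0 (Dr w).
rewrite subr_sqr normrM.
have q1 : `|normc (Dr v) - normc (Dr w)| <= e / 4 by rewrite ler_norml; lra.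
have q2 : `|normc (Dr v) + normc (Dr w)| <= 4 by rewrite ger0_norm; lra.
by have := ler_pM (normr_ge0 _) (normr_ge0 _) q1 q2; lra.
Qed.

Lemma normc_derive0_lt1 : ~ is_rotation f -> normc L1 < 1.
Proof.
move=> nrot; rewrite lt_neqAle normc_derive0_le1 andbT; apply/eqP => n1; apply: nrot.
exists L1; first by rewrite complex_normE n1.
move=> z z1; have [->|z0] := eqVneq z 0; first by rewrite f0 mulr0.
have nz : 0 < normc z.
  by rewrite lt_neqAle normc_ge0 andbT eq_sym; apply: contra_neq z0; exact: eq0_normc.
have nz1 : normc z < 1 by move: z1; rewrite complex_normE (ltcR _ 1).
pose u : R[i]^o := (normc z)%:C%C^-1 * z.
have nc : (normc z)%:C%C != 0 :> R[i] by rewrite fmorph_eq0 gt_eqF.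
have u1 : `|u| == 1.
  by rewrite complex_normE /u normcM normcV normc_real ?normc_ge0// mulVf// gt_eqF.
have := derive0_rigid n1 (exist _ u u1 : circle R) (r := normc z).
rewrite /circle_val /= /u mulVKf// nz nz1; exact.
Qed.

(** [mu] is the conjugate of the mean of [conj z ^ 2 Z]. Since [conj z ^ k Z ^ n] has mean zero for
    [n > k], and products of nonnegative powers of [z] and [Z] have mean zero unless constant, [z]
    has a Fourier coefficient relative to [Z] at most at the power 1, and [z ^ 2] at most at the
    powers 1 and 2. *)
Lemma boundary_contracting_chain : ~ is_rotation f ->
  exists mu, contracting_chain P (boundary f) cval (conjc L1) mu.
Proof.
move=> nrot; have [nu [hnu _]] := exists_boundary_moment 2; exists (conjc nu).
have mT := measurable_boundary f_inner.
have b0 : bmC (fun _ : circle R => 0 : R[i]) by exact: bounded_measurableC_cst.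
have h0 (z : circle R -> R[i]) : has_mean P (fun w => z w * 0) 0.
  by under eq_fun do rewrite mulr0; exact: has_mean_cst.
have pos k j : (0 < k + j)%N -> has_mean P (fun w => Z w ^+ j * cval w ^+ k) 0.
  by move=> kj; apply: eq_has_mean (boundary_positive_moment kj) => w; rewrite mulrC.
have ZZ w : Z w * conjc (Z w) = 1 by exact: circle_conj.
(* All Fourier coefficients of [rho] relative to [Z] vanish; those with conjugate powers of [Z] are
   the conjugates of the means of [Z ^ n conj rho]. *)
have vanish g rho : bmC g -> bmC rho ->
    (forall n, has_mean P (fun w => Z w ^+ n * rho w) 0) ->
    (forall n, has_mean P (fun w => Z w ^+ n * conjc (rho w)) 0) ->
    E (fun w => Re (g (boundary f w) * rho w)) = 0.
  move=> bg brho hp hn.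
  have sm : same_moments P (boundary f) (boundary f) rho (fun=> 0).
    apply: same_moments_of_means => // n; exists 0 => //.
    have := has_mean_conj (hn n); rewrite conjc0; apply: eq_has_mean => w.
    by rewrite rmorphM rmorphXn /= conjcK.
  rewrite (expect_eq_of_moments mT mT sm bg).
  by under eq_expect do rewrite mulr0; rewrite expect_cst.
have bm1 : bmC (fun w => cval w - conjc L1 * Z w).
  apply: bounded_measurableCB => //; apply: bounded_measurableCM => //.
  exact: bounded_measurableC_cst.
have bm2 : bmC (fun w => cval w ^+ 2 - conjc nu * Z w - conjc L1 ^+ 2 * Z w ^+ 2).
  apply: bounded_measurableCB; first apply: bounded_measurableCB.
  - exact: bounded_measurableCX.
  - by apply: bounded_measurableCM => //; exact: bounded_measurableC_cst.
  - by apply: bounded_measurableCM; [exact: bounded_measurableC_cst|exact: bounded_measurableCX].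
split => //.
- by move=> w; rewrite -sqr_normcE normc_circle expr1n.
- by rewrite normc_conj; exact: normc_derive0_lt1.
- rewrite normc_conj; apply: (has_mean_le ler01 hnu) => w.
  by rewrite normcM normc_circle mulr1 conj_pow_le.
(* Invariance of the measure: the powers of [Z] and those of [z] have the same means, so the two
   maps have the same law. *)
- move=> h bh.
  have b1 : bmC (fun _ : circle R => 1 : R[i]) by exact: bounded_measurableC_cst.
  have sm : same_moments P (boundary f) id (fun=> 1) (fun=> 1).
    apply: same_moments_of_means => // n.
      exists (0 ^+ n).
        by apply: eq_has_mean (boundary_power_mean n) => w; rewrite mulr1.
      by apply: eq_has_mean (circle_power_mean n) => w; rewrite mulr1.
    exists (conjc (0 ^+ n)).
      by apply: eq_has_mean (has_mean_conj (boundary_power_mean n)) => w; rewrite mulr1 rmorphXn.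
    by apply: eq_has_mean (has_mean_conj (circle_power_mean n)) => w; rewrite mulr1 rmorphXn.
  have mid : measurable_fun [set: circle R] (@id (circle R)) by exact: measurable_id.
  have := expect_eq_of_moments mT mid sm (bounded_measurableC_real bh).
  by under eq_expect do rewrite mulr1 /=; under [X in _ = X -> _]eq_expect do rewrite mulr1 /=.
- move=> c; have [_ /(_ c) h] := circle_power_mean 1; rewrite expr1 mulr0 in h.
  rewrite [RHS](_ : 0 = Re (0 : R[i]))// -h.
- by move=> c; have [_ /(_ c) ->] := circle_power_mean 2; rewrite expr0n /= mulr0.
- move=> g bg; apply: (vanish g) => // n.
    have := has_meanB (pos 1%N n isT) (has_meanZ (conjc L1) (boundary_power_mean n.+1)).
    rewrite expr0n /= mulr0 subr0; apply: eq_has_mean => w.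
    by rewrite expr1 exprSr; ring.
  case: n => [|n].
    have := has_meanB (has_mean_conj (circle_power_mean 1))
      (has_meanZ L1 (has_mean_conj (boundary_power_mean 1))).
    rewrite !expr1 conjc0 mulr0 subr0; apply: eq_has_mean => w.
    by rewrite expr0 mul1r rmorphB rmorphM /= conjcK !expr1.
  have := has_meanB (boundary_negative_moment 1 n) (has_meanZ L1 (boundary_power_mean n)).
  rewrite expr1 subrr; apply: eq_has_mean => w.
  rewrite rmorphB rmorphM /= conjcK !expr1 add1n.
  rewrite mulrBr (mulrC (Z w ^+ n.+1)) mulrCA exprSr -!mulrA.
  by rewrite ZZ mulr1.
move=> g bg; apply: (vanish g) => // n.
  have := has_meanB (has_meanB (pos 2%N n isT) (has_meanZ (conjc nu) (boundary_power_mean n.+1)))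
    (has_meanZ (conjc L1 ^+ 2) (boundary_power_mean n.+2)).
  rewrite !expr0n /= !mulr0 !subr0; apply: eq_has_mean => w.
  by rewrite !exprSr; ring.
have conjE w : conjc (cval w ^+ 2 - conjc nu * Z w - conjc L1 ^+ 2 * Z w ^+ 2) =
    conjc (cval w) ^+ 2 - nu * conjc (Z w) - L1 ^+ 2 * conjc (Z w) ^+ 2.
  by rewrite !expr2 !rmorphB !rmorphM /= !conjcK.
have c1 := has_mean_conj (boundary_power_mean 1).
have c2 := has_mean_conj (boundary_power_mean 2).
have v2 := has_mean_conj (circle_power_mean 2).
have e0 j : conjc (0 ^+ j.+1) = 0 :> R[i] by rewrite expr0n conjc0.
rewrite !e0 in c1 c2 v2.
case: n => [|[|n]].
- have := has_meanB (has_meanB v2 (has_meanZ nu c1)) (has_meanZ (L1 ^+ 2) c2).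
  rewrite !mulr0 !subr0; apply: eq_has_mean => w.
  by rewrite conjE !rmorphXn expr0 mul1r expr1.
- have := has_meanB (has_meanB hnu (has_meanZ nu (has_mean_cst P 1))) (has_meanZ (L1 ^+ 2) c1).
  rewrite mulr1 subrr mulr0 subr0; apply: eq_has_mean => w.
  rewrite conjE expr1; have := ZZ w; set x := conjc (Z w); set y := Z w => yx.
  rewrite [RHS](_ : _ = conjc (cval w) ^+ 2 * y - nu * (y * x) - L1 ^+ 2 * (y * x * x)); last by ring.
  by rewrite !yx mul1r mulr1.
have := has_meanB (has_meanB (boundary_negative_moment 2 n) (has_meanZ nu (boundary_power_mean n.+1)))
  (has_meanZ (L1 ^+ 2) (boundary_power_mean n)).
rewrite [0 ^+ n.+1]expr0n /= mulr0 subr0 subrr; apply: eq_has_mean => w.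
rewrite conjE add2n; have := ZZ w; set x := conjc (Z w); set y := Z w => yx.
rewrite [RHS](_ : _ = conjc (cval w) ^+ 2 * y ^+ n.+2 - nu * (y ^+ n.+1 * (y * x)) -
  L1 ^+ 2 * (y ^+ n * (y * x) ^+ 2)); last by rewrite !exprS; ring.
by rewrite yx expr1n !mulr1.
Qed.

End boundary_chain.

(** * Rates *)

Section rates.
Context (R : realType).

(** The logarithm is absorbed by a small power: [- ln l <= l ^ (- eta) / eta], which is [ln y <= y]
    at [y = l ^ (- eta)]. *)
Lemma log_rate_le (K eta l : R) : 1 <= K -> 0 < eta -> eta <= 1 -> 0 < l -> l <= 1 ->
  K * l * (1 + ln (1 + (K * l)^-1)) <= K * (2 + eta^-1) * l `^ (1 - eta).
Proof.
move=> K1 e0 e1 l0 l1; have K0 : 0 < K by lra.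
have ie0 : 0 < eta^-1 by rewrite invr_gt0.
have il1 : 1 <= l^-1 by rewrite invf_ge1.
have h1 : ln (1 + (K * l)^-1) <= 1 - ln l.
  have iKl : (K * l)^-1 <= l^-1.
    by rewrite lef_pV2 ?posrE ?mulr_gt0// ler_peMl// ltW.
  apply: le_trans (_ : ln (2 * l^-1) <= _).
    rewrite ler_ln ?posrE; [lra|by rewrite addr_gt0// invr_gt0 mulr_gt0|by rewrite mulr_gt0// invr_gt0].
  rewrite lnM ?posrE ?invr_gt0// lnV ?posrE// lerD2r.
  by have := @le_ln1Dx R 1; apply; lra.
have h2 : - ln l <= eta^-1 * l `^ (- eta).
  have := @ln_sublinear R (l `^ (- eta)); rewrite powR_gt0// => /(_ isT).
  rewrite ln_powR => h; rewrite -ler_pdivrMl ?invrK ?mulrN; first by lra.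
  by [].
have lE : l * l `^ (- eta) = l `^ (1 - eta).
  by rewrite powRD ?powRr1 ?ltW// (gt_eqF l0) implybT.
have lle : l <= l `^ (1 - eta) by apply: ger1_powR; [rewrite l0|lra].
rewrite -!mulrA ler_wpM2l ?(ltW K0)//.
apply: le_trans (_ : l * (2 + eta^-1 * l `^ (- eta)) <= _).
  by rewrite ler_wpM2l ?(ltW l0)//; lra.
rewrite mulrDr mulrCA lE mulrDl; lra.
Qed.

Lemma sum_sqr_le_sqr_sum (x : nat -> R) (m n : nat) : (forall i, 0 <= x i) ->
  \sum_(m <= i < n) x i ^+ 2 <= (\sum_(m <= i < n) x i) ^+ 2.
Proof.
move=> x0; suff h : forall r : seq nat, 0 <= \sum_(i <- r) x i /\
    \sum_(i <- r) x i ^+ 2 <= (\sum_(i <- r) x i) ^+ 2 by have [] := h (index_iota m n).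
elim=> [|i r [h0 h1]]; first by rewrite !big_nil expr0n.
rewrite !big_cons; have xi := x0 i; split; first exact: addr_ge0.
by move: (\sum_(j <- r) x j) (\sum_(j <- r) x j ^+ 2) h0 h1 => u v *; nra.
Qed.

Lemma root_ratio_bounds (S2 S4 : R) : 0 < S2 -> 0 < S4 -> S4 <= S2 ^+ 2 ->
  0 < S4 `^ 4^-1 * S2 `^ (- 2^-1) /\ S4 `^ 4^-1 * S2 `^ (- 2^-1) <= 1.
Proof.
move=> S20 S40 S42; split; first by rewrite mulr_gt0 ?powR_gt0.
rewrite powRN ler_pdivrMr ?powR_gt0// mul1r.
apply: le_trans (ge0_ler_powR _ _ _ S42) _; rewrite ?nnegrE ?sqr_ge0 ?(ltW S40)//.
rewrite -powR_mulrn ?(ltW S20)// -powRrM (_ : 2%:R * 4^-1 = 2^-1)//.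
by field.
Qed.

(** Explains the loss [eta = 1 / (3 + 2 delta)]: then [1 - eta = (2 + 2 delta) / (3 + 2 delta)], and
    a quarter and a half of it are the two exponents of the theorem. *)
Lemma root_ratio_powR (S2 S4 delta : R) : 0 < S2 -> 0 < S4 -> 1 <= delta ->
  (S4 `^ 4^-1 * S2 `^ (- 2^-1)) `^ (1 - (3 + 2 * delta)^-1) =
  S4 `^ ((1 + delta) / (6 + 4 * delta)) * S2 `^ (- ((1 + delta) / (3 + 2 * delta))).
Proof.
move=> S20 S40 d1; rewrite powRM ?powR_ge0// -!powRrM.
have h3 : 3 + 2 * delta != 0 by rewrite gt_eqF//; lra.
have h6 : 6 + 4 * delta != 0 by rewrite gt_eqF//; lra.
by congr (_ `^ _ * _ `^ _); field; rewrite ?h3 ?h6.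
Qed.

End rates.

(** * The weighted sum as a walk, and its rate *)

Section chain_sums.
Context d (T : measurableType d) (R : realType) (P : probability T R)
  (S : T -> T) (z : T -> R[i]) (lam mu : R[i])
  (HC : contracting_chain P S z lam mu).
Local Notation Re := complex.Re.
Local Notation Im := complex.Im.
Local Notation E := (expect P).
Local Notation bm := bounded_measurable.
Local Notation walk := (walk S z lam).
Implicit Types (a : nat -> R[i]) (u : R[i]).

Definition chain_sum a N w : R[i] := \sum_(1 <= n < N.+1) a n * z (iter n S w).

Fixpoint discounted_sum a (m : nat) : R[i] :=
  if m is m'.+1 then lam * discounted_sum a m' + a m else 0.

Local Notation A := discounted_sum.

(** Abel summation: the coefficient of [z] at a point of the orbit comes from two consecutive
    increments and is [B j - lam B j.+1 = b j]. At the far end the starting value cancels the last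
    subtracted term, and at [w] the boundary term with [B k] is left. *)
Lemma walk_telescope (B b : nat -> R[i]) k w :
  (forall j, (j < k)%N -> B j = lam * B j.+1 + b j) ->
  walk (fun w => Re (lam * B 0%N * z w)) B k w =
  Re (lam * B k * z w) + \sum_(0 <= j < k) Re (b j * z (iter (k - j.+1) S w)).
Proof.
elim: k w => [|k IH] w hB; first by rewrite big_geq// addr0.
have -> : walk (fun w => Re (lam * B 0%N * z w)) B k.+1 w =
  walk (fun w => Re (lam * B 0%N * z w)) B k (S w) + Re (B k * (z w - lam * z (S w))) by [].
rewrite IH; last by move=> j jk; apply: hB; exact: ltnW.
rewrite big_nat_recr//= subnn /=.
rewrite (eq_big_nat _ _ (F2 := fun j => Re (b j * z (iter (k.+1 - j.+1) S w)))); last first.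
  by move=> j /andP[_ jk]; rewrite -iterSr subSn.
set s := \sum_(0 <= j < k) _.
have e : Re (B k * z w) = Re (lam * B k.+1 * z w) + Re (b k * z w).
  by rewrite {1}(hB k (ltnSn k)) mulrDl cReD.
have e2 : Re (B k * (z w - lam * z (S w))) = Re (B k * z w) - Re (lam * B k * z (S w)).
  by rewrite -cReN -cReD; congr Re; ring.
rewrite e2 e; lra.
Qed.

Lemma big_nat_reflect (F : nat -> R) N :
  \sum_(1 <= n < N.+1) F n = \sum_(0 <= j < N) F (N - j)%N.
Proof.
rewrite big_add1 /= big_nat_rev /=; apply: eq_big_nat => j /andP[_ jN].
by rewrite add0n subnSK.
Qed.

Definition reversed_sums a u N i := u * A a (N - i).

(** The sum starts at [n = 1], hence the walk is taken at [S w], and its first increment is the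
    farthest along the orbit, hence the reversal. The boundary term of [walk_telescope] vanishes
    because [discounted_sum a 0 = 0]. *)
Lemma chain_sum_walk a u N w : Re (u * chain_sum a N w) =
  walk (fun w => Re (lam * (u * A a N) * z w)) (reversed_sums a u N) N (S w).
Proof.
have := @walk_telescope (reversed_sums a u N) (fun j => u * a (N - j)%N) N (S w).
rewrite /reversed_sums subn0 => ->; last first.
  move=> j jN; rewrite subnS; case: (N - j)%N (subn_gt0 j N) => [|m _]; first by rewrite jN.
  by rewrite /=; ring.
rewrite subnn /= !mulr0 mul0r add0r /chain_sum.
have -> : Re (u * (\sum_(1 <= n < N.+1) a n * z (iter n S w))) =
    \sum_(1 <= n < N.+1) Re (u * a n * z (iter n S w)).
  elim: N => [|N IH]; first by rewrite !big_geq// mulr0.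
  by rewrite !(big_nat_recr N.+1)//= mulrDr cReD IH mulrA.
rewrite big_nat_reflect; apply: eq_big_nat => j /andP[_ jN].
by rewrite -iterSr subnSK.
Qed.

Definition chain_variance a N : R :=
  normc (lam * A a N) ^+ 2 + \sum_(1 <= m < N.+1) var_incr lam (A a m).

Lemma var_incrZ u (x : R[i]) : var_incr lam (u * x) = normc u ^+ 2 * var_incr lam x.
Proof. by rewrite /var_incr normcM exprMn mulrCA. Qed.

Lemma reversed_variance a u N :
  normc (lam * (u * A a N)) ^+ 2 + \sum_(0 <= j < N) var_incr lam (reversed_sums a u N j) =
  normc u ^+ 2 * chain_variance a N.
Proof.
rewrite /chain_variance big_nat_reflect mulrDr mulr_sumr; congr (_ + _).
  by rewrite mulrCA normcM exprMn.
by apply: eq_bigr => j _; rewrite var_incrZ.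
Qed.

Let bm_W a u N :
  bm (walk (fun w => Re (lam * (u * A a N) * z w)) (reversed_sums a u N) N).
Proof. by apply: (bm_walk HC); exact: (bm_Rez HC). Qed.

Lemma expect_chain_sum_Re a u N :
  E (fun w => Re (u * chain_sum a N w) ^+ 2) = 2^-1 * (normc u ^+ 2 * chain_variance a N).
Proof.
under eq_expect do rewrite chain_sum_walk.
rewrite (chain_invariant HC (bounded_measurableX 2 (bm_W a u N))) (expect_walk_var HC).
by rewrite -reversed_variance big_mkord.
Qed.

Lemma bm_chain_sum_Re a u N : bm (fun w => Re (u * chain_sum a N w)).
Proof.
under eq_fun do rewrite chain_sum_walk.
exact: (bounded_measurable_precomp (chain_measurable HC) (bm_W a u N)).
Qed.

(** [|X| ^ 2 = (Re X) ^ 2 + (Re (i X)) ^ 2], and the real part has the same second moment for every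
    rotation of the sum. *)
Lemma expect_chain_sum_sqr a N :
  E (fun w => normc (chain_sum a N w) ^+ 2) = chain_variance a N.
Proof.
have e w : normc (chain_sum a N w) ^+ 2 =
    Re (1 * chain_sum a N w) ^+ 2 + Re ('i%C * chain_sum a N w) ^+ 2.
  by rewrite sqr_normcE mul1r; case: chain_sum => x y /=; ring.
under eq_expect do rewrite e.
rewrite expectD; [|exact: bounded_measurableX (bm_chain_sum_Re a _ N)..].
rewrite !expect_chain_sum_Re normc1 (_ : normc 'i%C = 1).
  by rewrite expr1n mul1r; lra.
by rewrite /= expr0n add0r expr1n sqrtr1.
Qed.

Lemma bm_chain_sum_sqr a N : bm (fun w => normc (chain_sum a N w) ^+ 2).
Proof.
have e w : normc (chain_sum a N w) ^+ 2 =
    Re (1 * chain_sum a N w) ^+ 2 + Re ('i%C * chain_sum a N w) ^+ 2.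
  by rewrite sqr_normcE mul1r; case: chain_sum => x y /=; ring.
under eq_fun do rewrite e.
by apply: bounded_measurableD; exact: bounded_measurableX (bm_chain_sum_Re a _ N).
Qed.

Let lam1 := chain_lam HC.
Let lam0 := normc_ge0 lam.

(** From [a n = A n - lam A (n - 1)] comes [|a n| ^ 2 <= 2 |A n| ^ 2 + 2 |A (n - 1)| ^ 2]. The
    induction is strengthened by [2 |A N| ^ 2], the share of the last term that the next step
    consumes. *)
Lemma sum_sqr_le_discounted a N : \sum_(1 <= n < N.+1) normc (a n) ^+ 2 <=
  4 * \sum_(1 <= m < N.+1) normc (A a m) ^+ 2.
Proof.
suff : \sum_(1 <= n < N.+1) normc (a n) ^+ 2 + 2 * normc (A a N) ^+ 2 <=
    4 * \sum_(1 <= m < N.+1) normc (A a m) ^+ 2.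
  by have := sqr_ge0 (normc (A a N)); lra.
elim: N => [|N IH]; first by rewrite !big_geq// (_ : A a 0%N = 0)// normc0 expr0n !mulr0 addr0.
rewrite !(big_nat_recr N.+1)//= mulrDr.
set x := normc (lam * A a N + a N.+1).
have h : normc (a N.+1) <= x + normc (A a N).
  rewrite -[X in normc X](addKr (lam * A a N)) addrC; apply: le_trans (le_normcD _ _) _.
  rewrite normcN normcM lerD2l ler_piMl ?normc_ge0//; exact: ltW.
have := normc_ge0 (a N.+1); have x0 : 0 <= x by exact: normc_ge0.
have := normc_ge0 (A a N); move: (normc (A a N)) (normc (a N.+1)) h IH => y t h IH y0 t0.
have := sqr_ge0 (x - y); have : t ^+ 2 <= (x + y) ^+ 2 by rewrite ler_pXn2r ?nnegrE ?addr_ge0.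
rewrite sqrrD sqrrB; lra.
Qed.

(** Allows the normalisation by [sigma_N] to be exchanged for the one by the square sum of the
    coefficients, at the cost of a constant depending on [lam] only. *)
Lemma chain_variance_ge a N : (1 - normc lam ^+ 2) / 4 * \sum_(1 <= n < N.+1) normc (a n) ^+ 2
  <= chain_variance a N.
Proof.
have l1 : 0 <= 1 - normc lam ^+ 2 by rewrite subr_ge0 exprn_ile1// ltW.
rewrite /chain_variance -mulr_sumr.
have := ler_wpM2l l1 (sum_sqr_le_discounted a N); have := sqr_ge0 (normc (lam * A a N)).
lra.
Qed.

Lemma normc_discounted_le a N (B : R) : 0 <= B ->
  (forall n, (1 <= n <= N)%N -> normc (a n) <= B) ->
  forall m, (m <= N)%N -> normc (A a m) <= B / (1 - normc lam).
Proof.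
move=> B0 aB; have l1 : 0 < 1 - normc lam by rewrite subr_gt0.
elim=> [_|m IH mN]; first by rewrite normc0 divr_ge0// ltW.
apply: le_trans (le_normcD _ _) _; rewrite normcM.
have h1 := ler_wpM2l lam0 (IH (ltnW mN)); have h2 := aB m.+1; rewrite mN /= in h2.
apply: le_trans (lerD h1 (h2 isT)) _.
rewrite le_eqVlt; apply/orP; left; apply/eqP; field; rewrite gt_eqF//.
Qed.

Theorem chain_sum_rate (delta : R) : 1 <= delta -> exists2 C : R, 0 < C &
  forall a N u, (0 < \sum_(1 <= n < N.+1) normc (a n) ^+ 2) ->
    normc u ^+ 2 * chain_variance a N = 1 -> forall x : R,
    `|fine (P [set w | Re (u * chain_sum a N w) <= x]) - gauss_cdf x| <=
    C * (\sum_(1 <= n < N.+1) normc (a n) ^+ 4) `^ ((1 + delta) / (6 + 4 * delta))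
      * (\sum_(1 <= n < N.+1) normc (a n) ^+ 2) `^ (- ((1 + delta) / (3 + 2 * delta))).
Proof.
move=> d1; have [K K0 hK] := chain_berry_esseen HC.
have l0' := normc_ge0 lam; have l1 : 0 < 1 - normc lam by rewrite subr_gt0.
have l2 : 0 < 1 - normc lam ^+ 2 by rewrite subr_gt0 expr_lt1.
have l21 : 1 - normc lam ^+ 2 <= 1 by have := sqr_ge0 (normc lam); lra.
(* [kappa] compares the two normalisations, [normc u <= kappa / sqrt S2]; [K1] includes the
   geometric series of [normc_discounted_le] as well. *)
pose kappa : R := Num.sqrt (4 / (1 - normc lam ^+ 2)).
have kq : 1 <= 4 / (1 - normc lam ^+ 2) by rewrite ler_pdivlMr//; lra.
have kappa1 : 1 <= kappa by rewrite -sqrtr1 ler_wsqrtr.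
have kappa2 : kappa ^+ 2 = 4 / (1 - normc lam ^+ 2) by rewrite sqr_sqrtr//; lra.
pose K1 := kappa / (1 - normc lam).
have K11 : 1 <= K1 by rewrite ler_pdivlMr//; lra.
pose eta : R := (3 + 2 * delta)^-1.
have eta0 : 0 < eta by rewrite invr_gt0; lra.
have eta1 : eta <= 1 by rewrite invf_le1; lra.
exists (K * (K1 * (2 + eta^-1))).
  by rewrite !mulr_gt0// ?addr_gt0 ?invr_gt0//; lra.
move=> a N u; set S2 := \sum_(1 <= n < N.+1) normc (a n) ^+ 2.
set S4 := \sum_(1 <= n < N.+1) normc (a n) ^+ 4 => S20 uV x.
have S4E : S4 = \sum_(1 <= n < N.+1) (normc (a n) ^+ 2) ^+ 2.
  by apply: eq_bigr => n _; rewrite -exprM.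
have S42 : S4 <= S2 ^+ 2 by rewrite S4E; apply: sum_sqr_le_sqr_sum => n; exact: sqr_ge0.
have a4 n : (1 <= n <= N)%N -> normc (a n) ^+ 4 <= S4.
  move=> nN; rewrite /S4 (bigD1_seq n) ?iota_uniq ?mem_index_iota//= lerDl.
  by apply: sumr_ge0 => i _; rewrite exprn_ge0// normc_ge0.
have S40 : 0 < S4.
  have S4ge : 0 <= S4 by apply: sumr_ge0 => i _; rewrite exprn_ge0// normc_ge0.
  rewrite lt_neqAle S4ge andbT eq_sym; apply/eqP => S4z.
  move: S20; rewrite /S2 big1_seq ?ltxx// => n /andP[_]; rewrite mem_index_iota ltnS => nN.
  have := a4 n nN; rewrite S4z => h.
  have : normc (a n) ^+ 4 = 0 by apply: le_anti; rewrite h exprn_ge0// normc_ge0.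
  by move/eqP; rewrite expf_eq0 => /andP[_ /eqP ->]; rewrite expr0n.
(* The largest [|a n|] is at most the fourth root of [S4]: this is how the fourth powers enter. *)
set B := S4 `^ 4^-1.
have aB n : (1 <= n <= N)%N -> normc (a n) <= B.
  move=> nN.
  have h : (normc (a n) ^+ 4) `^ 4^-1 <= B.
    apply: ge0_ler_powR; last exact: a4.
    - by rewrite invr_ge0.
    - by rewrite nnegrE exprn_ge0// normc_ge0.
    - by rewrite nnegrE ltW.
  by rewrite -powR_mulrn ?normc_ge0// -powRrM divff ?pnatr_eq0// powRr1 ?normc_ge0 in h.
have B0 : 0 <= B by exact: powR_ge0.
have [l0 ll] := root_ratio_bounds S20 S40 S42; rewrite -/B in l0 ll.
set l := B * S2 `^ (- 2^-1) in l0 ll.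
have sS2 : S2 `^ (- 2^-1) = (Num.sqrt S2)^-1 by rewrite powRN powR12_sqrt// ltW.
have u_le : normc u <= kappa * S2 `^ (- 2^-1).
  rewrite sS2 -(@ler_pXn2r _ 2) ?nnegrE ?normc_ge0 ?mulr_ge0 ?invr_ge0 ?sqrtr_ge0//.
  rewrite exprMn exprVn kappa2 sqr_sqrtr ?(ltW S20)//.
  have V0 := chain_variance_ge a N; rewrite -/S2 in V0.
  have c0 : 0 < (1 - normc lam ^+ 2) / 4 * S2 by rewrite !mulr_gt0// ?divr_gt0.
  have Vgt0 := lt_le_trans c0 V0.
  have -> : normc u ^+ 2 = (chain_variance a N)^-1.
    have Vn0 : chain_variance a N != 0 by rewrite gt_eqF.
    by apply: (mulIf Vn0); rewrite uV mulVf.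
  rewrite (_ : _ / S2 = ((1 - normc lam ^+ 2) / 4 * S2)^-1) ?lef_pV2 ?posrE//.
  by field; rewrite !gt_eqF.
have uA m : (m <= N)%N -> normc (u * A a m) <= K1 * l.
  move=> mN; rewrite normcM.
  have := ler_pM (normc_ge0 _) (normc_ge0 _) u_le (normc_discounted_le B0 aB mN).
  by move=> h; apply: le_trans h _; rewrite le_eqVlt /K1 /l; apply/orP; left; apply/eqP; ring.
have M0 : 0 < K1 * l by rewrite mulr_gt0//; lra.
have := hK (lam * (u * A a N)) (reversed_sums a u N) N (K1 * l) M0.
have cM : normc (lam * (u * A a N)) <= K1 * l.
  by rewrite normcM; apply: le_trans (uA N (leqnn N)); rewrite ler_piMl ?normc_ge0// ltW.
have AM i : (i < N)%N -> normc (reversed_sums a u N i) <= K1 * l.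
  by move=> iN; apply: uA; exact: leq_subr.
move=> /(_ cM AM); rewrite reversed_variance => /(_ uV x).
(* The representation as a walk holds at [S w]; invariance of the measure removes the shift. *)
have <- : fine (P [set w | Re (u * chain_sum a N w) <= x]) = fine (P [set w |
    walk (fun w => Re (lam * (u * A a N) * z w)) (reversed_sums a u N) N w <= x]).
  rewrite -(expect_le P (bm_chain_sum_Re a u N)) -(expect_le P (bm_W a u N)).
  rewrite -(chain_invariant HC (bm_le (bm_W a u N) x)).
  by apply: eq_expect => w; rewrite chain_sum_walk.
move=> h; apply: le_trans h _.
have e := root_ratio_powR S20 S40 d1; rewrite -/B -/l -/eta in e.
rewrite -[leRHS]mulrA -e -[leRHS]mulrA ler_wpM2l ?(ltW K0)//.
exact: log_rate_le.
Qed.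

End chain_sums.

Lemma Lnorm2_sqrt d (T : measurableType d) (R : realType) (P : probability T R)
    (h : T -> R) : bounded_measurable (fun w => h w ^+ 2) ->
  fine ('N[P]_2%:E [EFin \o h])%E = Num.sqrt (expect P (fun w => h w ^+ 2)).
Proof.
move=> bh; rewrite unlock /Lnorm.
have -> : (\int[P]_x (`|(EFin \o h) x| `^ 2))%E = (expect P (fun w => h w ^+ 2))%:E.
  rewrite /expect /Rintegral fineK; last first.
    by apply: integrable_fin_num => //; exact: bounded_measurable_integrable.
  apply: eq_integral => x _; rewrite [LHS](_ : _ = (`|h x| `^ 2)%:E)//; congr EFin.
  by rewrite (powR_mulrn 2) ?normr_ge0// real_normK ?num_real.
rewrite poweR_EFin /= powR12_sqrt//.
by apply: expect_ge0 => w; exact: sqr_ge0.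
Qed.

Unset Implicit Arguments.

Theorem theorem1 (R : realType) (f : R[i]^o -> R[i]^o)
    (f_inner : inner f) (f0 : f 0 = 0) (f_not_rotation : ~ is_rotation f)
    (delta : R) (delta_ge1 : 1 <= delta) :
  exists C : R, 0 < C /\
  forall a : nat -> R[i]^o,
    (\sum_(1 <= n <oo) (normc (a n) ^+ 2)%:E)%E = +oo%E ->
    normc (a N) ^+ 2 / (\sum_(1 <= n < N.+1) normc (a n) ^+ 2)
      @[N --> \oo] --> (0 : R) ->
    forall N : nat, (1 <= N)%N ->
      (exists2 n : nat, (1 <= n <= N)%N & a n != 0) ->
      let lambda : R[i]^o := conjc (f^`()%classic 0) in
      (ereal_sup [set `|circle_measure
                          [set w | (complex.Re (val alpha * ZN f a N w) <= x)%R]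
                        - normal_prob 0 (Num.sqrt (2^-1)) `]-oo, x]|
                 | x in [set: R] & alpha in [set: circle R]]
       <= (C * (\sum_(1 <= n < N.+1) normc (a n) ^+ 4)
                 `^ ((1 + delta) / (6 + 4 * delta))
             * (\sum_(1 <= n < N.+1) normc (a n) ^+ 2)
                 `^ (- ((1 + delta) / (3 + 2 * delta)))
           + (27 / 10) * (normc lambda / (1 - normc lambda))
             * (normc (\sum_(1 <= n < N.+1) lambda ^+ (N - n) * a n)
                / Num.sqrt (\sum_(1 <= n < N.+1) normc (a n) ^+ 2)))%R%:E)%E.
Proof.
have [mu HC] := boundary_contracting_chain f_inner f0 f_not_rotation.
have [C C0 hC] := chain_sum_rate HC delta_ge1.
exists C; split => // a _ _ N _ [n nN an0] /=.
have l1 := chain_lam HC; set lam : R[i] := conjc _ in HC hC l1.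
rewrite derive1E -/lam.
set S2 := \sum_(1 <= n < N.+1) normc (a n) ^+ 2.
have S20 : 0 < S2.
  rewrite /S2 (bigD1_seq n) ?iota_uniq ?mem_index_iota//=.
  rewrite ltr_wpDr//; first by apply: sumr_ge0 => i _; exact: sqr_ge0.
  rewrite exprn_gt0// lt_neqAle normc_ge0 andbT eq_sym.
  by apply: contra_neq an0; exact: eq0_normc.
apply: ge_ereal_sup => _ [x _ [alpha _ <-]].
have sE : sigmaN f a N = Num.sqrt (chain_variance lam a N).
  rewrite -(expect_chain_sum_sqr HC).
  exact: (@Lnorm2_sqrt _ _ _ (@circle_measure R)
    (fun w => normc (chain_sum (boundary f) (@circle_val R) a N w)) (bm_chain_sum_sqr HC a N)).
have V0 : 0 < chain_variance lam a N.
  apply: lt_le_trans (chain_variance_ge HC a N); rewrite mulr_gt0// divr_gt0// subr_gt0.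
  by rewrite expr_lt1 ?normc_ge0.
(* The rate asks of [u] only that [|u| sigma_N = 1], hence it is uniform in [alpha]. *)
pose u : R[i] := val alpha * ((sigmaN f a N)^-1)%:C%C.
have uV : normc u ^+ 2 * chain_variance lam a N = 1.
  rewrite /u normcM (normc_circle alpha) mul1r normc_real ?invr_ge0 ?sE ?sqrtr_ge0//.
  by rewrite exprVn sqr_sqrtr ?ltW// mulVf// gt_eqF.
have := hC a N u S20 uV x; rewrite -/S2.
have -> : [set w | complex.Re (val alpha * ZN f a N w) <= x] =
    [set w | complex.Re (u * chain_sum (boundary f) (@circle_val R) a N w) <= x].
  by apply/seteqP; split => w /=; rewrite /ZN /u mulrA.
rewrite gauss_cdf_fin => h.
rewrite -[X in `|X - _|%E]fineK ?fin_num_measure//; last first.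
  exact: (measurable_le_set (bm_chain_sum_Re HC a u N)).
rewrite -EFinB /= lee_fin; apply: le_trans h _; rewrite lerDl.
(* What remains is that the second summand is nonnegative, which follows from [normc lam < 1]. *)
have ln0 := normc_ge0 lam.
by rewrite !mulr_ge0 ?normc_ge0 ?invr_ge0 ?sqrtr_ge0// subr_ge0 ltW.
Qed.
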